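(* The BNS-invariants $\Sigma^1(H)$ for $H\in\{G,G_y,{}_yG,{}_yG_y\}$ are all of the form $S(H)\setminus P\cong S^2\setminus P$ for some set $P$ with $|P|=2$. More precisely, for $H=G$ we have $P=\{[\chi_0],[\chi_1]\}$, for $H={}_yG$ we have $P=\{[\psi_0],[\chi_1]\}$, for $H=G_y$ we have $P=\{[\chi_0],[-\psi_1]\}$, and for $H={}_yG_y$ we have $P=\{[\psi_0],[-\psi_1]\}$.
   Context: **Lodha--Moore groups.** Let $2^{\mathbb{N}}$ be the set of infinite binary sequences and $2^{<\mathbb{N}}$ the set of finite binary sequences, including the empty sequence $\emptyset$. Maps act on the right, so in a product $ab$ one applies first $a$, then $b$. Let $x\colon 2^{\mathbb{N}}\to 2^{\mathbb{N}}$ be the bijection $00\eta\mapsto 0\eta$, $01\eta\mapsto 10\eta$, $1\eta\mapsto 11\eta$. Let $y\colon 2^{\mathbb{N}}\to 2^{\mathbb{N}}$ be the bijection defined, together with its inverse, recursively by $(00\eta).y=0(\eta.y)$, $(01\eta).y=10(\eta.y^{-1})$, $(1\eta).y=11(\eta.y)$ and $(0\eta).y^{-1}=00(\eta.y^{-1})$, $(10\eta).y^{-1}=01(\eta.y)$, $(11\eta).y^{-1}=1(\eta.y^{-1})$. For $s\in 2^{<\mathbb{N}}$ let $x_s$ (resp. $y_s$) be the bijection of $2^{\mathbb{N}}$ sending $s\eta$ to $s(\eta.x)$ (resp. $s(\eta.y)$) and fixing every sequence not having $s$ as a prefix. Let $0^n$, $1^n$ denote the words of $n$ zeros, resp. $n$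 ones, with $0^0=1^0=\emptyset$. The Lodha--Moore groups are the following four groups of bijections of $2^{\mathbb{N}}$: - ${}_yG_y=\langle x_s,y_t\mid s,t\in 2^{<\mathbb{N}}\rangle$; - $G_y=\langle x_s,y_t\mid s,t\in 2^{<\mathbb{N}},\ t\notin\{0^n\}_{n\ge 0}\rangle$; - ${}_yG=\langle x_s,y_t\mid s,t\in 2^{<\mathbb{N}},\ t\notin\{1^n\}_{n\ge 0}\rangle$; - $G=\langle x_s,y_t\mid s,t\in 2^{<\mathbb{N}},\ t\notin\{0^n,1^n\}_{n\ge 0}\rangle$. They are finitely generated with abelianization $\mathbb{Z}^3$. **Characters.** A character of a group $H$ is a homomorphism $H\to\mathbb{R}$. The following prescriptions on the generators define homomorphisms to $\mathbb{Z}$ on the indicated groups: - $\chi_0$ (on $G$ and $G_y$): $\chi_0(x_{0^n})=-1$ for $n\ge0$, $\chi_0(x_s)=0$ for other $s$, $\chi_0(y_s)=0$ for all $s$; - $\chi_1$ (on $G$ and ${}_yG$): $\chi_1(x_{1^n})=1$ for $n\ge 0$, $\chi_1(x_s)=0$ for other $s$, $\chi_1(y_s)=0$ for all $s$; - $\psi_0$ (on ${}_yG$ and ${}_yG_y$): $\psi_0(y_{0^n})=1$ for $n\ge0$ (when $y_{0^n}$ is a generator), $\psi_0(y_s)=0$ for other $s$, $\psi_0(x_s)=0$ for all $s$; - $\psi_1$ (on $G_y$ and ${}_yG_y$): $\psi_1(y_{1^n})=1$ for $n\ge0$ (when $y_{1^n}$ is a generator), $\psi_1(y_s)=0$ for other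 $s$, $\psi_1(x_s)=0$ for all $s$. **BNS-invariant.** For a finitely generated group $H$, the character sphere $S(H)$ is the set of classes $[\chi]$ of nonzero characters of $H$ modulo multiplication by positive reals; it is a sphere $S^{d-1}$, $d$ being the torsion-free rank of the abelianization. Let $\Gamma(H)$ be the Cayley graph of $H$ with respect to a finite generating set (edges joining $g$ to $gs$ for generators $s$, so that $H$ acts on the left), and $\Gamma(H)^{\chi\ge0}$ its full subgraph spanned by the vertices $g$ with $\chi(g)\ge0$. Then $\Sigma^1(H)=\{[\chi]\in S(H)\mid\Gamma(H)^{\chi\ge0}\text{ is connected}\}$; this does not depend on the finite generating set. *)

(* Defs.v *)
From HB Require Import structures.
From mathcomp Require Import all_boot all_order all_algebra.
From mathcomp Require Import generic_quotient.
From mathcomp Require Import all_classical all_reals all_analysis.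
From Stdlib Require Import Relation_Operators.

Set Implicit Arguments.
Unset Strict Implicit.
Unset Printing Implicit Defensive.

Import Order.TTheory GRing.Theory Num.Theory.
Import numFieldNormedType.Exports.

Local Open Scope classical_set_scope.
Local Open Scope quotient_scope.
Local Open Scope ring_scope.

(* The letter 0 is [false] and 1 is [true]. *)

Definition word : Type := seq bool.
Definition bitseqs : Type := nat -> bool.

Definition bcons (b : bool) (eta : bitseqs) : bitseqs :=
  fun n => if n is n'.+1 then eta n' else b.
Definition bcat (s : word) (eta : bitseqs) : bitseqs := foldr bcons eta s.
Definition btake (n : nat) (eta : bitseqs) : word := mkseq eta n.
Definition bdrop (n : nat) (eta : bitseqs) : bitseqs := fun k => eta (n + k)%N.

Lemma bcons_eta (eta : bitseqs) : eta = bcons (eta 0%N) (bdrop 1 eta).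
Proof. by apply/funext; case. Qed.

Lemma btake_bcat s eta : btake (size s) (bcat s eta) = s.
Proof.
rewrite /btake /mkseq; elim: s => [//|b s IH] /=; congr cons.
by rewrite -[in RHS]IH -[1%N]addn0 iotaDl -map_comp; apply: eq_map.
Qed.

Lemma bdrop_bcat s eta : bdrop (size s) (bcat s eta) = eta.
Proof.
by rewrite /bdrop; elim: s => [|b s IH] //=; rewrite -[RHS]IH.
Qed.

Lemma bcat_take_drop n eta : bcat (btake n eta) (bdrop n eta) = eta.
Proof.
elim: n eta => [//|n IH] eta; rewrite [RHS]bcons_eta -(IH (bdrop 1 eta)).
by rewrite /btake /mkseq /= -[1%N]addn0 iotaDl -map_comp.
Qed.

Lemma bitseqs_ind2 (P : bitseqs -> Prop) :
  (forall a b eta, P (bcat [:: a; b] eta)) -> forall eta, P eta.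
Proof. by move=> H eta; rewrite -(bcat_take_drop 2 eta); exact: H. Qed.

Definition xmap (eta : bitseqs) : bitseqs :=
  match eta 0%N, eta 1%N with
  | false, false => bcat [:: false] (bdrop 2 eta)
  | false, true => bcat [:: true; false] (bdrop 2 eta)
  | true, _ => bcat [:: true; true] (bdrop 1 eta)
  end.

Definition xmap_inv (eta : bitseqs) : bitseqs :=
  match eta 0%N, eta 1%N with
  | false, _ => bcat [:: false; false] (bdrop 1 eta)
  | true, false => bcat [:: false; true] (bdrop 2 eta)
  | true, true => bcat [:: true] (bdrop 2 eta)
  end.

Lemma xmapK : cancel xmap xmap_inv.
Proof. by elim/bitseqs_ind2 => - [] [] eta; apply/funext => -[|[|k]]. Qed.

Lemma xmap_invK : cancel xmap_inv xmap.
Proof. by elim/bitseqs_ind2 => - [] [] eta; apply/funext => -[|[|k]]. Qed.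

(* [yaux n false] and [yaux n true] unfold n times the mutually recursive
   equations of y and of its inverse.  Each unfolding emits at least one bit,
   so bit k of the value is known after k + 1 of them.  The equations
   themselves are [ymap00] to [ymap_inv11]. *)
Fixpoint yaux (n : nat) (inv : bool) (eta : bitseqs) : bitseqs :=
  if n is n'.+1 then
    match inv, eta 0%N, eta 1%N with
    | false, false, false => bcat [:: false] (yaux n' false (bdrop 2 eta))
    | false, false, true => bcat [:: true; false] (yaux n' true (bdrop 2 eta))
    | false, true, _ => bcat [:: true; true] (yaux n' false (bdrop 1 eta))
    | true, false, _ => bcat [:: false; false] (yaux n' true (bdrop 1 eta))
    | true, true, false => bcat [:: false; true] (yaux n' false (bdrop 2 eta))
    | true, true, true => bcat [:: true] (yaux n' true (bdrop 2 eta))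
    end
  else eta.

Definition ymap (eta : bitseqs) : bitseqs := fun k => yaux k.+1 false eta k.
Definition ymap_inv (eta : bitseqs) : bitseqs := fun k => yaux k.+1 true eta k.

Lemma yaux_stable n m i eta k : (k < n)%N -> (k < m)%N ->
  yaux n i eta k = yaux m i eta k.
Proof.
elim: n m i eta k => [//|n IH] [//|m] i eta k kn km /=.
case: i (eta 0%N) (eta 1%N) => [] [] []; case: k kn km => [|[|k]] //= kn km;
  by apply: IH; rewrite -ltnS // ltnW.
Qed.

Lemma ymap00 eta :
  ymap (bcat [:: false; false] eta) = bcat [:: false] (ymap eta).
Proof. by apply/funext => -[|k]. Qed.

Lemma ymap01 eta :
  ymap (bcat [:: false; true] eta) = bcat [:: true; false] (ymap_inv eta).
Proof. by apply/funext => -[|[|k]] //; exact: (@yaux_stable k.+2 k.+1 true eta). Qed.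

Lemma ymap1 eta : ymap (bcat [:: true] eta) = bcat [:: true; true] (ymap eta).
Proof. by apply/funext => -[|[|k]] //; exact: (@yaux_stable k.+2 k.+1 false eta). Qed.

Lemma ymap_inv0 eta :
  ymap_inv (bcat [:: false] eta) = bcat [:: false; false] (ymap_inv eta).
Proof. by apply/funext => -[|[|k]] //; exact: (@yaux_stable k.+2 k.+1 true eta). Qed.

Lemma ymap_inv10 eta :
  ymap_inv (bcat [:: true; false] eta) = bcat [:: false; true] (ymap eta).
Proof. by apply/funext => -[|[|k]] //; exact: (@yaux_stable k.+2 k.+1 false eta). Qed.

Lemma ymap_inv11 eta :
  ymap_inv (bcat [:: true; true] eta) = bcat [:: true] (ymap_inv eta).
Proof. by apply/funext => -[|k]. Qed.

Lemma ymapK_bit k eta :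
  ymap_inv (ymap eta) k = eta k /\ ymap (ymap_inv eta) k = eta k.
Proof.
elim/ltn_ind: k eta => k IH; elim/bitseqs_ind2 => a b eta; split.
- case: a; last case: b.
  + rewrite -[bcat _ _]/(bcat [:: true] (bcat [:: b] eta)) ymap1 ymap_inv11.
    by case: k IH => // k IH; exact: (IH k (ltnSn k) _).1.
  + rewrite ymap01 ymap_inv10.
    by case: k IH => [|[|k]] // IH; exact: (IH k (leqnSn _) _).2.
  + rewrite ymap00 ymap_inv0.
    by case: k IH => [|[|k]] // IH; exact: (IH k (leqnSn _) _).1.
- case: a; first case: b.
  + rewrite ymap_inv11 ymap1.
    by case: k IH => [|[|k]] // IH; exact: (IH k (leqnSn _) _).2.
  + rewrite ymap_inv10 ymap01.
    by case: k IH => [|[|k]] // IH; exact: (IH k (leqnSn _) _).1.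
  + rewrite -[bcat _ _]/(bcat [:: false] (bcat [:: b] eta)) ymap_inv0 ymap00.
    by case: k IH => // k IH; exact: (IH k (ltnSn k) _).2.
Qed.

Lemma ymapK : cancel ymap ymap_inv.
Proof. by move=> eta; apply/funext => k; exact: (ymapK_bit k eta).1. Qed.

Lemma ymap_invK : cancel ymap_inv ymap.
Proof. by move=> eta; apply/funext => k; exact: (ymapK_bit k eta).2. Qed.

Record biperm := Biperm {
  bfun :> bitseqs -> bitseqs;
  binv : bitseqs -> bitseqs;
  bfunK : cancel bfun binv;
  binvK : cancel binv bfun }.

HB.instance Definition _ := gen_eqMixin biperm.
HB.instance Definition _ := gen_choiceMixin biperm.

Lemma biperm_eq (f g : biperm) : bfun f = bfun g -> f = g.
Proof.
case: f g => [f f' fK f'K] [g g' gK g'K] /= fg; subst g.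
have fg' : f' = g' by apply/funext => eta; rewrite -[in LHS](g'K eta) fK.
by subst g'; congr Biperm; exact: Prop_irrelevance.
Qed.

Definition biperm1 : biperm :=
  @Biperm id id (fun _ => erefl) (fun _ => erefl).
Definition bipermV (f : biperm) : biperm := Biperm (@binvK f) (@bfunK f).
(* Maps act on the right: f is applied first. *)
Definition bipermM (f g : biperm) : biperm :=
  Biperm (can_comp (@bfunK g) (@bfunK f)) (can_comp (@binvK f) (@binvK g)).

Lemma bipermA : associative bipermM.
Proof. by move=> f g h; exact: biperm_eq. Qed.
Lemma biperm1M : left_id biperm1 bipermM.
Proof. by move=> f; exact: biperm_eq. Qed.
Lemma bipermM1 : right_id biperm1 bipermM.
Proof. by move=> f; exact: biperm_eq. Qed.
Lemma bipermVM : left_inverse biperm1 bipermV bipermM.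
Proof. by move=> f; apply/biperm_eq/funext => eta /=; exact: binvK. Qed.
Lemma bipermMV : right_inverse biperm1 bipermV bipermM.
Proof. by move=> f; apply/biperm_eq/funext => eta /=; exact: bfunK. Qed.

HB.instance Definition _ :=
  isGroup.Build biperm bipermA biperm1M bipermM1 bipermVM bipermMV.

Definition act_below (s : word) (f : bitseqs -> bitseqs) (eta : bitseqs) :
    bitseqs :=
  if btake (size s) eta == s then bcat s (f (bdrop (size s) eta)) else eta.

Lemma act_belowK s f g : cancel f g -> cancel (act_below s f) (act_below s g).
Proof.
move=> fK eta; rewrite /act_below.
have [E|/negbTE sE] := eqVneq (btake (size s) eta) s; last by rewrite sE.
by rewrite btake_bcat eqxx bdrop_bcat fK -{1}E bcat_take_drop.
Qed.

Definition x_ (s : word) : biperm :=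
  Biperm (act_belowK s xmapK) (act_belowK s xmap_invK).
Definition y_ (s : word) : biperm :=
  Biperm (act_belowK s ymapK) (act_belowK s ymap_invK).

Inductive generated (gT : groupType) (A : set gT) : set gT :=
| gen_in g of A g : generated A g
| gen_one : generated A 1%g
| gen_mul g h of generated A g & generated A h : generated A (g * h)%g
| gen_inv g of generated A g : generated A g^-1%g.

Definition gen_pred (gT : groupType) (A : set gT) : {pred gT} :=
  [pred g | `[< generated A g >]].

Record gen_group (gT : groupType) (A : set gT) := GenGroup {
  gen_val :> gT;
  gen_valP : gen_val \in gen_pred A }.

HB.instance Definition _ (gT : groupType) (A : set gT) :=
  [isSub for @gen_val gT A].
HB.instance Definition _ (gT : groupType) (A : set gT) :=
  [Choice of @gen_group gT A by <:].

Lemma gen_pred_closed (gT : groupType) (A : set gT) : group_closed (gen_pred A).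
Proof.
split=> [|g h /asboolP gA /asboolP hA]; apply/asboolP; first exact: gen_one.
by apply: gen_mul => //; exact: gen_inv.
Qed.

HB.instance Definition _ (gT : groupType) (A : set gT) :=
  SubChoice_isSubGroup.Build gT _ (@gen_group gT A) (gen_pred_closed A).

Definition generates (H : groupType) (S : set H) : Prop :=
  generated S = [set: H].

Definition finitely_generated (H : groupType) : Prop :=
  exists S : set H, finite_set S /\ generates S.

Definition zeros : set word := [set nseq n false | n in [set: nat]].
Definition ones : set word := [set nseq n true | n in [set: nat]].

Definition LM_gens (E : set word) : set biperm :=
  [set x_ s | s in [set: word]] `|` [set y_ t | t in ~` E].

(* E is the set of words t for which y_t is left out of the generators. *)
Definition LM (E : set word) : groupType := gen_group (LM_gens E).

Definition LM_yGy : groupType := LM set0.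
Definition LM_Gy : groupType := LM zeros.
Definition LM_yG : groupType := LM ones.
Definition LM_G : groupType := LM (zeros `|` ones).

Lemma x_gen_subproof E s : x_ s \in gen_pred (LM_gens E).
Proof. by apply/asboolP; apply: gen_in; left; exists s. Qed.
Definition x_gen E s : LM E := GenGroup (x_gen_subproof E s).

Lemma y_gen_subproof E t : (~` E) t -> y_ t \in gen_pred (LM_gens E).
Proof. by move=> Et; apply/asboolP; apply: gen_in; right; exists t. Qed.
Definition y_gen E t (Et : (~` E) t) : LM E := GenGroup (y_gen_subproof Et).

Section CharacterSphere.
Variables (R : realType) (H : groupType).

(* Homomorphisms to R carry the topology of pointwise convergence; for H
   finitely generated this is the topology of the finite-dimensional real
   vector space Hom(H, R). *)
Definition nonzero_characters : set {ptws H -> R} :=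
  [set chi | {morph chi : g h / (g * h)%g >-> g + h} /\ exists g, chi g != 0].

Definition nzchar : topologicalType := set_type nonzero_characters.

Definition char_val (c : nzchar) : H -> R := set_val c.

Lemma char_valM (c : nzchar) g h :
  char_val c (g * h)%g = char_val c g + char_val c h.
Proof. exact: (set_valP c).1. Qed.

Lemma nzchar_opp_subproof (c : nzchar) :
  (fun g => - char_val c g) \in nonzero_characters.
Proof.
apply/mem_set; split=> [g h|]; first by rewrite char_valM opprD.
by have [_ [g cg]] := set_valP c; exists g; rewrite oppr_eq0.
Qed.

Definition nzchar_opp (c : nzchar) : nzchar :=
  exist _ (fun g => - char_val c g) (nzchar_opp_subproof c).

Definition same_ray (c d : nzchar) : bool :=
  `[< exists r : R, 0 < r /\ forall g, char_val d g = r * char_val c g >].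

Lemma same_ray_refl : reflexive same_ray.
Proof. by move=> c; apply/asboolP; exists 1; split=> // g; rewrite mul1r. Qed.

Lemma same_ray_sym : symmetric same_ray.
Proof.
move=> c d; apply: asbool_equiv_eq.
split=> -[r [r0 E]]; exists r^-1; rewrite invr_gt0; split=> // g;
  by rewrite E mulKf ?gt_eqF.
Qed.

Lemma same_ray_trans : transitive same_ray.
Proof.
move=> d c e /asboolP[r [r0 E]] /asboolP[s [s0 F]]; apply/asboolP.
by exists (s * r); split=> [|g]; [exact: mulr_gt0 | rewrite F E mulrA].
Qed.

Canonical same_ray_equiv :=
  EquivRel same_ray same_ray_refl same_ray_sym same_ray_trans.

Definition char_sphere : topologicalType :=
  quotient_topology {eq_quot same_ray_equiv}.

Definition char_class (c : nzchar) : char_sphere :=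
  \pi_{eq_quot same_ray_equiv} c.

Lemma char_classP (c d : nzchar) : char_class c = char_class d <->
  exists r : R, 0 < r /\ forall g, char_val d g = r * char_val c g.
Proof.
split=> [/eqmodP/asboolP//|rE].
by apply/eqmodP/asboolP.
Qed.

End CharacterSphere.

Definition cayley (H : groupType) (S : set H) (g h : H) : Prop :=
  exists2 s, S s & h = (g * s)%g.

(* Connectedness of the full subgraph spanned by A, for the undirected graph
   with an edge between g and h whenever E g h. *)
Definition full_subgraph_connected (V : Type) (E : V -> V -> Prop)
    (A : set V) : Prop :=
  forall g h, A g -> A h ->
    clos_refl_sym_trans V (fun a b => [/\ A a, A b & E a b]) g h.

Definition Sigma1 (R : realType) (H : groupType) (S : set H) :
    set (char_sphere R H) :=
  [set char_class c | c in [set c : nzchar R H |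
    full_subgraph_connected (cayley S) [set g | 0 <= char_val c g]]].

Definition sphere2 (R : realType) : topologicalType :=
  set_type [set v : 'rV[R]_3 | \sum_i v 0 i ^+ 2 = 1].

Definition homeomorphism (T U : topologicalType) (f : T -> U) : Prop :=
  continuous f /\ exists g : U -> T, [/\ cancel f g, cancel g f & continuous g].

(* Sigma^1 does not depend on the finite generating set, hence the universal
   quantification over S; finite generation makes it non-vacuous. *)
Definition BNS_is_sphere_minus (R : realType) (H : groupType)
    (P : set (char_sphere R H)) : Prop :=
  [/\ finitely_generated H,
      forall S : set H, finite_set S -> generates S -> Sigma1 S = ~` P,
      (P #= `I_2)%card &
      exists f : char_sphere R H -> sphere2 R,
        homeomorphism f /\ f @` (~` P) = ~` (f @` P)].

Section Prescriptions.
Variables (R : realType) (E : set word).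
Implicit Type c : nzchar R (LM E).

Definition is_chi0 c : Prop :=
  [/\ forall n, char_val c (x_gen E (nseq n false)) = -1,
      forall s, ~ zeros s -> char_val c (x_gen E s) = 0 &
      forall t (Et : (~` E) t), char_val c (y_gen Et) = 0].

Definition is_chi1 c : Prop :=
  [/\ forall n, char_val c (x_gen E (nseq n true)) = 1,
      forall s, ~ ones s -> char_val c (x_gen E s) = 0 &
      forall t (Et : (~` E) t), char_val c (y_gen Et) = 0].

Definition is_psi0 c : Prop :=
  [/\ forall n (En : (~` E) (nseq n false)), char_val c (y_gen En) = 1,
      forall t (Et : (~` E) t), ~ zeros t -> char_val c (y_gen Et) = 0 &
      forall s, char_val c (x_gen E s) = 0].

Definition is_psi1 c : Prop :=
  [/\ forall n (En : (~` E) (nseq n true)), char_val c (y_gen En) = 1,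
      forall t (Et : (~` E) t), ~ ones t -> char_val c (y_gen Et) = 0 &
      forall s, char_val c (x_gen E s) = 0].

End Prescriptions.

(* Main.v *)
Require Import Defs.
From HB Require Import structures.
From mathcomp Require Import all_boot all_order all_algebra.
From mathcomp Require Import generic_quotient.
From mathcomp Require Import all_classical all_reals all_analysis.
From mathcomp Require Import lra zify.
From Stdlib Require Import Relation_Operators.

(** The half-space of a character chi is connected exactly when each of its
    elements is reachable from 1 inside it, and the reachable elements form
    the least set that contains 1 and the generators and inverses of generators
    of nonnegative value, and that is closed under products and under
    quotients g h^-1 with chi h <= chi g ([reach_closed], [reach_min]).

    Proving connectedness.  After a conjugation, such a closed set may be
    assumed to contain any prescribed finite list of elements of nonnegative
    value ([connected_of_finite]).  This gives two criteria.  The half-space is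
    connected when the group has finitely many generators, each commuting with
    an element of nonzero value that commutes with one fixed element of nonzero
    value ([connected_of_commuting]); and when the group is generated by an
    element t of positive value and a subgroup on which chi vanishes that
    conjugation by t maps into itself ([connected_of_ascending]).

    A character of a Lodha--Moore group is determined by its values at three
    elements: one acting at the left end, one acting at the right end, and y_10
    ([char_eq]).  If the value at y_10 is nonzero, or those at both ends are,
    elements supported on disjoint cones meet the commuting criterion.
    Otherwise the value at one end only is nonzero; the relations in which
    conjugation doubles a translation, or pushes a cone into itself, meet the
    ascending criterion for one of its two signs.  The other sign gives one
    ray for each end.

    Proving that these two half-spaces are not connected.  In the
    Stern--Brocot coordinate z of a sequence ending in 10^oo, the map x is
    z - 1 near the left end and y is z / 2 everywhere.  If only x acts at the
    left end, the germs there are translations and the character is the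
    translation length; the elements that act on all z >= N as a translation of
    nonnegative length form a closed set, proper for each N, and the finitely
    many generators lie in one of these sets ([disconnected_translation]).  If
    y acts there too, the germs are z |-> 2^-k (z + c) and the character is k;
    the germs with k >= 0 and m c an integer form a closed set, proper for each
    m, and again a single m serves all the generators
    ([disconnected_scaling]).  Exchanging the two letters inverts x and y and
    exchanges the ends, so the right end follows.

    The sphere is two-dimensional because there are three independent
    characters: the two germs at the ends ([left_hom], [right_hom]), and a
    character that does not vanish at y_10 ([interior_hom]).  The last one is
    the sum over the dyadic points of the base-2 logarithms of the ratio of the
    left scale to the right scale; this sum is finite, and it is additive by
    the chain rule because the group permutes the dyadic points. *)

Set Implicit Arguments.
Unset Strict Implicit.
Unset Printing Implicit Defensive.

Import Order.TTheory GRing.Theory Num.Theory.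
Import numFieldNormedType.Exports.

Local Open Scope classical_set_scope.
Local Open Scope ring_scope.

(** * Subgroups given by generators *)

Definition subgroup_set (gT : groupType) (N : set gT) : Prop :=
  [/\ N 1%g, forall g h, N g -> N h -> N (g * h)%g & forall g, N g -> N g^-1%g].

Lemma generated_subgroup (gT : groupType) (A : set gT) :
  subgroup_set (generated A).
Proof.
by split; [exact: gen_one|move=> g h; exact: gen_mul|move=> g; exact: gen_inv].
Qed.

Lemma generated_min (gT : groupType) (A N : set gT) :
  subgroup_set N -> A `<=` N -> generated A `<=` N.
Proof.
move=> [N1 NM NV] AN g; elim=> [h /AN//|//|h k _ Nh _ Nk|h _ Nh];
  [exact: NM|exact: NV].
Qed.

Lemma generated_setT (gT : groupType) (A B : set gT) :
  generated A = [set: gT] -> A `<=` generated B -> generated B = [set: gT].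
Proof.
move=> AT AB; apply/seteqP; split=> // g _.
by apply: (generated_min (generated_subgroup B) AB); rewrite AT.
Qed.

(** * Characters and connected half-spaces of Cayley graphs *)

Section Connected.
Variables (R : realType) (H : groupType) (chi : H -> R).
Hypothesis chiM : {morph chi : g h / (g * h)%g >-> g + h}.

Lemma chi1 : chi 1%g = 0.
Proof. by apply: (addrI (chi 1%g)); rewrite -chiM mulg1 addr0. Qed.

Lemma chiV g : chi g^-1%g = - chi g.
Proof. by apply: (addrI (chi g)); rewrite -chiM mulgV chi1 subrr. Qed.

Lemma chiX g n : chi (g ^+ n)%g = chi g *+ n.
Proof. by elim: n => [|n IH]; rewrite ?chi1 // expgS chiM IH mulrS. Qed.

Lemma chiJ g h : chi (g ^ h)%g = chi g.
Proof. by rewrite conjgE !chiM chiV addrCA addNr addr0. Qed.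

(** The closure properties of the set of elements that a path inside the
    half-space joins to 1. *)
Definition quot_closed (M : set H) : Prop :=
  [/\ M 1%g, forall g h, M g -> M h -> M (g * h)%g &
      forall g h, M g -> M h -> chi h <= chi g -> M (g * h^-1)%g].

Lemma quot_closedV M g : quot_closed M -> M g -> chi g <= 0 -> M g^-1%g.
Proof. by move=> [M1 MM MQ] Mg g0; rewrite -[_^-1%g]mul1g; apply: MQ; rewrite ?chi1. Qed.

Lemma quot_closedX M g n : quot_closed M -> M g -> M (g ^+ n)%g.
Proof.
move=> [M1 MM MQ] Mg; elim: n => [|n IH]; first by rewrite expg0.
by rewrite expgS; exact: MM.
Qed.

Lemma quot_closed_conj M c : quot_closed M ->
  quot_closed [set g | M (g ^ c)%g].
Proof.
move=> [M1 MM MQ]; split=> /= [|g h Mg Mh|g h Mg Mh hg].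
- by rewrite conj1g.
- by rewrite conjMg; exact: MM.
- by rewrite conjMg conjVg; apply: MQ => //; rewrite !chiJ.
Qed.

Lemma subgroup_of_quot_closed M (T0 : set H) : quot_closed M ->
  T0 `<=` M -> (forall g, T0 g -> chi g = 0) ->
  generated T0 `<=` [set g | M g /\ chi g = 0].
Proof.
move=> MC TM T00; apply: generated_min; last by move=> g Tg; split; auto.
case: (MC) => M1 MM MQ; split=> /= [|g h [Mg g0] [Mh h0]|g [Mg g0]].
- by split=> //; exact: chi1.
- by split; [exact: MM|rewrite chiM g0 h0 addr0].
- by split; [apply: quot_closedV; rewrite ?g0|rewrite chiV g0 oppr0].
Qed.

(** A high power of a lifts h into M, even after h has been multiplied on the
    left by a negative power of a; this uniformity makes the property pass to
    products. *)
Definition absorbs (M : set H) (a h : H) : Prop :=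
  forall k : nat, exists j : nat, M ((a ^+ k)^-1 * h * a ^+ j)%g.

(** The elements absorbed with their inverses form a subgroup, so g a^j lies in
    M for some j; as chi g >= 0, the quotient by a^j stays in M. *)
Lemma absorbs_all (M T : set H) (a : H) : quot_closed M -> M a -> 0 <= chi a ->
  generated T = [set: H] ->
  (forall t, T t -> absorbs M a t /\ absorbs M a t^-1%g) ->
  forall g, 0 <= chi g -> M g.
Proof.
move=> MC Ma a0 TT Tab g g0; have [M1 MM MQ] := MC.
have absM h k : absorbs M a h -> absorbs M a k -> absorbs M a (h * k)%g.
  move=> ah ak i; have [j Mj] := ah i; have [l Ml] := ak j.
  by exists l; have := MM _ _ Mj Ml; rewrite !mulgA mulgK.
have : generated T g by rewrite TT.
have sub : subgroup_set [set h | absorbs M a h /\ absorbs M a h^-1%g].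
  split=> /= [|h k [h1 h2] [k1 k2]|h [h1 h2]].
  - have a1 : absorbs M a 1%g by move=> k; exists k; rewrite mulg1 mulVg.
    by rewrite invg1; split.
  - by rewrite invgM; split; exact: absM.
  - by rewrite invgK; split.
move=> /(generated_min sub Tab)[/(_ 0%N)[j] + _].
rewrite expg0 invg1 mul1g => Mj.
rewrite -(mulgK (a ^+ j)%g g); apply: MQ => //; first exact: quot_closedX MC Ma.
by rewrite chiM lerDr.
Qed.

(** Since b has positive value, some power b^j outweighs a^k, and the quotient
    of commuting elements can be written in the order that closure allows. *)
Lemma absorbs_commute (M : set H) (a b : H) : quot_closed M -> M a -> M b ->
  commute a b -> 0 < chi b ->
  forall k : nat, exists j : nat, M ((a ^+ k)^-1 * b ^+ j)%g.
Proof.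
move=> MC Ma Mb ab b0 k; have [M1 MM MQ] := MC.
have [j jk] : exists j : nat, chi (a ^+ k)%g <= chi b *+ j.
  exists (Num.bound `|chi (a ^+ k)%g / chi b|).
  rewrite -mulr_natr -ler_pdivrMl // mulrC.
  by apply: le_trans (ler_norm _) (ltW (archi_boundP (normr_ge0 _))).
exists j; have -> : ((a ^+ k)^-1 * b ^+ j = b ^+ j * (a ^+ k)^-1)%g.
  exact: commute_sym (commuteV (commute_sym (commuteX2 k j ab))).
by apply: MQ; rewrite ?[leRHS]chiX //; exact: quot_closedX MC _.
Qed.

Section CayleyGraph.
Variable S : set H.

Let pos : set H := [set g | 0 <= chi g].

Definition linked (g h : H) : Prop := clos_refl_sym_trans H
  (fun a b => [/\ pos a, pos b & cayley S a b]) g h.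

(** The group acts on its Cayley graph by left translations, and a translation
    by an element of nonnegative value keeps the half-space inside itself. *)
Lemma linked_mull k g h : 0 <= chi k -> linked g h -> linked (k * g)%g (k * h)%g.
Proof.
move=> k0; elim=> [a b [pa pb [s Ss E]]|a|a b _ IH|a b c _ IH1 _ IH2].
- subst b; rewrite /pos /= in pa pb; apply: rst_step; split; rewrite /pos /=.
  + by rewrite chiM addr_ge0.
  + by rewrite chiM addr_ge0.
  + by exists s; rewrite ?mulgA.
- exact: rst_refl.
- exact: rst_sym.
- exact: rst_trans IH1 IH2.
Qed.

Definition reach : set H := [set g | 0 <= chi g /\ linked 1%g g].

Lemma connected_reach :
  full_subgraph_connected (cayley S) pos <-> (forall g, 0 <= chi g -> reach g).
Proof.
split=> [co g g0|re g h g0 h0].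
  by split=> //; apply: co => //; rewrite /pos /= chi1.
by apply: rst_trans (rst_sym _ _ _ _ (re g g0).2) (re h h0).2.
Qed.

Lemma reach_closed : quot_closed reach.
Proof.
split; first by split; [rewrite chi1|exact: rst_refl].
  move=> g h [g0 lg] [h0 lh]; split; first by rewrite chiM addr_ge0.
  by apply: rst_trans lg _; rewrite -[X in clos_refl_sym_trans _ _ X](mulg1 g);
    exact: linked_mull.
move=> g h [g0 lg] [h0 lh] hg.
have q0 : 0 <= chi (g * h^-1)%g by rewrite chiM chiV subr_ge0.
split=> //; apply: rst_trans lg (rst_sym _ _ _ _ _).
by have := linked_mull q0 lh; rewrite mulg1 mulgVK.
Qed.

Lemma reach_gen s : S s -> 0 <= chi s -> reach s.
Proof.
move=> Ss s0; split=> //; apply: rst_step; split=> //; rewrite /pos /= ?chi1 //.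
by exists s; rewrite ?mul1g.
Qed.

Lemma reach_genV s : S s -> chi s <= 0 -> reach s^-1%g.
Proof.
move=> Ss s0; have p : 0 <= chi s^-1%g by rewrite chiV oppr_ge0.
split=> //; apply/rst_sym/rst_step; split; rewrite /pos /= ?chi1 //.
by exists s; rewrite ?mulVg.
Qed.

(** Along an edge inside the half-space, membership in M passes in both
    directions: one is a product and the other an allowed quotient. *)
Lemma reach_min M : quot_closed M ->
  (forall s, S s -> 0 <= chi s -> M s) ->
  (forall s, S s -> chi s <= 0 -> M s^-1%g) -> reach `<=` M.
Proof.
move=> [M1 MM MQ] SM SMV g [g0 lg].
suff [M1g _] : M 1%g <-> M g by exact: M1g.
elim: lg => [a b [pa pb [s Ss E]]|//|a b _ [? ?]|a b c _ [? ?] _ [? ?]];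
  [|by split|by split; auto].
have bE : a = (b * s^-1)%g by rewrite E mulgK.
have ab : chi b = chi a + chi s by rewrite E chiM.
rewrite /pos /= in pa pb.
split=> [Ma|Mb]; have [s0|/ltW s0] := leP 0 (chi s).
- by rewrite E; apply: MM => //; exact: SM.
- rewrite E -[s]invgK; apply: MQ; rewrite ?chiV //; first exact: SMV.
  by lra.
- by rewrite bE; apply: MQ => //; [exact: SM|lra].
- by rewrite bE; apply: MM => //; exact: SMV.
Qed.

Hypothesis genS : generates S.

(** The values along a word spelling h drop by a bounded amount, so the word can
    be followed inside the half-space from any vertex that is high enough. *)
Lemma linked_mulr h : exists C : R, forall g, C <= chi g -> linked g (g * h)%g.
Proof.
have : generated S h by rewrite genS.
elim=> [s Ss||a b _ [C HC] _ [D HD]|a _ [C HC]].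
- exists (Num.max 0 (- chi s)) => g; rewrite ge_max => /andP[g0 gs].
  apply: rst_step; split=> //; last by exists s.
  by rewrite /pos /= chiM; lra.
- by exists 0 => g _; rewrite mulg1; exact: rst_refl.
- exists (Num.max C (D - chi a)) => g; rewrite ge_max => /andP[gC gD].
  rewrite mulgA; apply: rst_trans (HC _ gC) (HD _ _).
  by rewrite chiM; lra.
- exists (C + chi a) => g gC; apply: rst_sym.
  rewrite -[X in clos_refl_sym_trans _ _ _ X](mulgVK a g); apply: HC.
  by rewrite chiM chiV; lra.
Qed.

Hypothesis chi_neq0 : exists g, chi g != 0.

Lemma reach_pos : exists2 u, reach u & 0 < chi u.
Proof.
have [s Ss s0] : exists2 s, S s & chi s != 0.
  apply: contrapT => no; case: chi_neq0 => g /eqP; apply.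
  have : generated S g by rewrite genS.
  elim=> [s Ss||a b _ a0 _ b0|a _ a0]; rewrite ?chi1 ?chiM ?chiV ?a0 ?b0 ?addr0
    ?oppr0 //.
  by apply: contrapT => /eqP s0; apply: no; exists s.
have [ns|ps] := ltP (chi s) 0.
  by exists s^-1%g; [exact/reach_genV/ltW|rewrite chiV oppr_gt0].
by exists s; [exact: reach_gen|rewrite lt_neqAle eq_sym s0].
Qed.

(** Walking up along a power of an element of positive value leaves room for
    the paths that spell the entries of L. *)
Lemma reach_conj (L : seq H) :
  exists c, forall l, l \in L -> 0 <= chi l -> reach (l ^ c)%g.
Proof.
have [C HC] : exists C, forall l, l \in L -> forall g, C <= chi g -> linked g (g * l)%g.
  elim: L => [|l L [C HC]]; first by exists 0.
  have [D HD] := linked_mulr l; exists (Num.max C D) => k.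
  rewrite inE => /orP[/eqP->|kL] g; rewrite ge_max => /andP[gC gD].
    exact: HD.
  exact: HC.
have [u ru u0] := reach_pos.
have [n un] : exists n, C <= chi (u ^+ n)%g.
  exists (Num.bound `|C / chi u|); rewrite chiX -mulr_natr -ler_pdivrMl // mulrC.
  by apply: le_trans (ler_norm _) (ltW (archi_boundP (normr_ge0 _))).
have [_ _ MQ] := reach_closed.
have rn : reach (u ^+ n)%g by exact: quot_closedX reach_closed ru.
exists ((u ^+ n)^-1)%g => l lL l0.
rewrite conjgE invgK mulgA; apply: MQ => //; last by rewrite chiM lerDl.
split; first by rewrite chiM addr_ge0 // chiX mulrn_wge0 // ltW.
by apply: rst_trans rn.2 (HC _ lL _ un).
Qed.

(** This is why connectedness does not depend on the finite generating set:
    only a conjugate of L needs to be reachable, and closed sets are carried to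
    closed sets by conjugation. *)
Lemma connected_of_finite (L : seq H) :
  (forall M, quot_closed M -> (forall l, l \in L -> 0 <= chi l -> M l) ->
     forall g, 0 <= chi g -> M g) ->
  full_subgraph_connected (cayley S) pos.
Proof.
move=> HL; apply/connected_reach => g g0.
have [c Lc] := reach_conj L.
have := HL _ (quot_closed_conj c reach_closed) Lc (g ^ c^-1)%g.
by rewrite /= conjgKV chiJ; apply.
Qed.

(** For t in T with its companion b, a negative power of a is first traded for
    a power of b, which a commutes with and which moves across t; the power of
    b is then traded back for a power of a, so a absorbs t. *)
Theorem connected_of_commuting (T B : seq H) (a : H) :
  generated [set` T] = [set: H] ->
  chi a != 0 ->
  (forall b, b \in B -> chi b != 0 /\ commute a b) ->
  (forall t, t \in T -> exists2 b, b \in B & commute t b) ->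
  full_subgraph_connected (cayley S) pos.
Proof.
move=> TT a0 Bab TB.
pose K := a :: B ++ T.
apply: (@connected_of_finite (K ++ [seq k^-1%g | k <- K])) => M MC LM.
have [M1 MM MQ] := MC.
have KM k : k \in K -> 0 <= chi k -> M k.
  by move=> kK; apply: LM; rewrite mem_cat kK.
have KMV k : k \in K -> chi k <= 0 -> M k^-1%g.
  move=> kK k0; apply: LM; first by rewrite mem_cat; apply/orP; right; by apply/mapP; exists k.
  by rewrite chiV oppr_ge0.
have orient k : k \in K -> chi k != 0 -> exists2 k', M k' /\ 0 < chi k' &
    forall g, commute g k -> commute g k'.
  move=> kK k0; have [kn|kp] := ltP (chi k) 0.
    exists k^-1%g; last by move=> g; exact: commuteV.
    by split; [apply: KMV => //; exact: ltW|rewrite chiV oppr_gt0].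
  by exists k => //; split; [exact: KM|rewrite lt_neqAle eq_sym k0].
(* a and its companions may have negative value; replace them by inverses *)
have [a' [Ma' a'0] a'C] := orient a (mem_head _ _) a0.
apply: (absorbs_all MC Ma' (ltW a'0) TT) => t /= tT.
have [b bB tb] := TB t tT.
have [b0 ab] := Bab b bB.
have bK : b \in K by rewrite inE mem_cat bB orbT.
have tK : t \in K by rewrite inE mem_cat tT !orbT.
have [b' [Mb' b'0] b'C] := orient b bK b0.
have tb' := b'C _ tb.
have ab' : commute a' b'.
  by apply/commute_sym/a'C/commute_sym/b'C.
have ba' := commute_sym ab'.
suff step u : commute u b' -> (exists j, M (u * b' ^+ j)%g) -> absorbs M a' u.
  have abs_b' u : M u \/ M u^-1%g -> commute u b' -> exists j, M (u * b' ^+ j)%g.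
    move=> [Mu|MuV] ub; first by exists 0%N; rewrite expg0 mulg1.
    have [j Mj] := absorbs_commute MC MuV Mb'
      (commute_sym (commuteV (commute_sym ub))) b'0 1.
    by exists j; rewrite expg1 invgK in Mj.
  have tM : M t \/ M t^-1%g.
    by have [tn|tp] := leP (chi t) 0; [right; exact: KMV|left; apply/KM/ltW].
  have tV := commute_sym (commuteV (commute_sym tb')).
  by split; apply: step => //; apply: abs_b' => //; rewrite invgK; tauto.
move=> ub [i Mi] k.
have [j Mj] := absorbs_commute MC Ma' Mb' ab' b'0 k.
have [l Ml] := absorbs_commute MC Mb' Ma' ba' a'0 (i + j).
exists l.
have := MM _ _ (MM _ _ Mj Mi) Ml; congr M.
rewrite addnC expgnDr invgM !mulgA.
rewrite (mulgK (b' ^+ i)%g) -!mulgA; congr (_ * _)%g.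
rewrite !mulgA; congr (_ * _)%g.
by rewrite (commute_sym (commuteX j ub)) mulgK.
Qed.

(** A closed set M that contains t and T0 contains the whole span of T0, since
    chi vanishes on it; in t^-k b t^k t^j the conjugate stays in that span, so
    t absorbs T0. *)
Theorem connected_of_ascending (T0 : seq H) (t : H) :
  generated [set` t :: T0] = [set: H] ->
  0 < chi t -> (forall b, b \in T0 -> chi b = 0) ->
  (forall b, b \in T0 -> generated [set` T0] (b ^ t)%g) ->
  full_subgraph_connected (cayley S) pos.
Proof.
move=> TT t0 B0 Bt.
apply: (@connected_of_finite (t :: T0)) => M MC LM.
have Mt : M t by apply: LM; rewrite ?mem_head // ltW.
have BM : generated [set` T0] `<=` [set g | M g /\ chi g = 0].
  apply: subgroup_of_quot_closed => // b /= bB.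
  by apply: LM; rewrite ?B0 // inE bB orbT.
have BJ : generated [set` T0] `<=` [set g | generated [set` T0] (g ^ t)%g].
  apply: generated_min => //; split=> /= [|g h|g].
  - by rewrite conj1g; exact: gen_one.
  - by rewrite conjMg; exact: gen_mul.
  - by rewrite conjVg; exact: gen_inv.
have BJn n b : generated [set` T0] b -> generated [set` T0] (b ^ (t ^+ n))%g.
  by elim: n => [|n IH] Bb; rewrite ?expg0 ?conjg1 // expgSr conjgM; apply/BJ/IH.
have absB b : generated [set` T0] b -> absorbs M t b.
  by move=> /BJn Bn k; exists k; have [+ _] := BM _ (Bn k); rewrite conjgE mulgA.
have [M1 MM MQ] := MC.
apply: (absorbs_all MC Mt (ltW t0) TT) => s; rewrite /= inE => /predU1P[->|sB].
  split=> k; last first.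
    exists k.+1; rewrite -mulgA expgS mulKg mulVg //.
  by exists k; rewrite -mulgA -expgS expgSr mulKg.
by split; apply: absB; [exact: gen_in|apply/gen_inv/gen_in].
Qed.

End CayleyGraph.
End Connected.

Local Open Scope group_scope.

(** * Homeomorphisms acting below a word *)

Lemma bipermE (f g : biperm) eta : (f * g) eta = g (f eta).
Proof. by []. Qed.

Lemma bipermVE (f : biperm) eta : f^-1 eta = binv f eta.
Proof. by []. Qed.

Lemma biperm1E eta : (1 : biperm) eta = eta.
Proof. by []. Qed.

Lemma bipermP (f g : biperm) : f =1 g -> f = g.
Proof. by move=> fg; apply/biperm_eq/funext. Qed.

Lemma biperm_injective (f : biperm) : injective f.
Proof. exact: can_inj (@bfunK f). Qed.

Lemma bipermKV (f : biperm) eta : f^-1 (f eta) = eta.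
Proof. exact: bfunK. Qed.

Lemma bipermVK (f : biperm) eta : f (f^-1 eta) = eta.
Proof. exact: binvK. Qed.

Lemma bcat_cat s t eta : bcat (s ++ t) eta = bcat s (bcat t eta).
Proof. by rewrite /bcat foldr_cat. Qed.

Lemma bcat_inj s : injective (bcat s).
Proof. exact: can_inj (bdrop_bcat s). Qed.

Definition below (s : word) (f : biperm) : biperm :=
  Biperm (act_belowK s (@bfunK f)) (act_belowK s (@binvK f)).

Definition x_root : biperm := Biperm xmapK xmap_invK.
Definition y_root : biperm := Biperm ymapK ymap_invK.

Lemma x_below s : x_ s = below s x_root. Proof. by []. Qed.
Lemma y_below s : y_ s = below s y_root. Proof. by []. Qed.

Lemma below_in s f eta : below s f (bcat s eta) = bcat s (f eta).
Proof. by rewrite /= /act_below btake_bcat eqxx bdrop_bcat. Qed.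

Lemma below_out s f xi : btake (size s) xi != s -> below s f xi = xi.
Proof. by rewrite /= /act_below => /negbTE->. Qed.

Lemma cone_case s xi : (exists eta, xi = bcat s eta) \/ btake (size s) xi != s.
Proof.
have [E|] := eqVneq (btake (size s) xi) s; [left|by right].
by exists (bdrop (size s) xi); rewrite -[LHS](bcat_take_drop (size s)) E.
Qed.

Lemma btake_neq s xi : (forall eta, xi <> bcat s eta) -> btake (size s) xi != s.
Proof. by case: (cone_case s xi) => // -[eta ->] /(_ eta). Qed.

Lemma belowM s f g : below s (f * g) = below s f * below s g.
Proof.
apply: bipermP => xi; rewrite bipermE.
have [[eta ->]|out] := cone_case s xi; first by rewrite !below_in.
by rewrite !below_out // below_out.
Qed.

Lemma belowV s f : below s f^-1 = (below s f)^-1.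
Proof. exact: biperm_eq. Qed.

Lemma below_nil f : below [::] f = f.
Proof. exact: biperm_eq. Qed.

Lemma below_cat s t f : below (s ++ t) f = below s (below t f).
Proof.
apply: bipermP => xi.
have [[eta ->]|out] := cone_case s xi; last first.
  rewrite [RHS]below_out // below_out //; apply: btake_neq => zeta E.
  by move: out; rewrite E bcat_cat btake_bcat eqxx.
rewrite below_in; have [[zeta ->]|out] := cone_case t eta.
  by rewrite -bcat_cat below_in below_in -bcat_cat.
rewrite [in RHS]below_out // below_out //; apply: btake_neq => zeta.
by rewrite bcat_cat => /bcat_inj E; move: out; rewrite E btake_bcat eqxx.
Qed.

Definition maps (g : biperm) (s t : word) : Prop :=
  forall eta, g (bcat s eta) = bcat t eta.

Lemma mapsM g h s t u : maps g s t -> maps h t u -> maps (g * h) s u.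
Proof. by move=> gst htu eta; rewrite bipermE gst htu. Qed.

Lemma mapsV g s t : maps g s t -> maps g^-1 t s.
Proof. by move=> gst eta; rewrite -gst bipermKV. Qed.

Lemma maps_cat g s t u : maps g s t -> maps g (s ++ u) (t ++ u).
Proof. by move=> gst eta; rewrite !bcat_cat gst. Qed.

(** Carrying the cone of s onto the cone of t, g carries the support of f along
    with it. *)
Lemma belowC g s t f : maps g s t -> below s f * g = g * below t f.
Proof.
move=> gst; apply: bipermP => xi; rewrite !bipermE.
have [[eta ->]|out] := cone_case s xi; first by rewrite below_in !gst below_in.
rewrite [in LHS]below_out // below_out //; apply: btake_neq => eta.
by rewrite -gst => /biperm_injective E; move: out; rewrite E btake_bcat eqxx.
Qed.

Lemma belowJ g s t f : maps g s t -> below s f ^ g = below t f.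
Proof. by move=> gst; rewrite conjgE (belowC _ gst) mulKg. Qed.

Definition incomparable (s t : word) : bool := ~~ prefix s t && ~~ prefix t s.

Lemma incomparable_bcat s t eta zeta : incomparable s t ->
  bcat s eta <> bcat t zeta.
Proof.
rewrite /incomparable; elim: s t => [//|b s IH] [|c t] //=.
rewrite [c == b]eq_sym => + E; have -> : b = c by have := congr1 (@^~ 0%N) E.
rewrite eqxx /=; move/IH; apply.
by apply/funext => n; have := congr1 (@^~ n.+1) E.
Qed.

Lemma maps_below s t f : incomparable s t -> maps (below s f) t t.
Proof.
move=> st eta; apply/below_out/btake_neq => zeta E.
exact: incomparable_bcat st (esym E).
Qed.

Lemma below_commute s t f g : incomparable s t ->
  commute (below s f) (below t g).
Proof. by move=> st; apply/commute_sym/belowC/maps_below. Qed.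

(** * Relations between the generators *)

Lemma x_root00 : maps x_root [:: false; false] [:: false].
Proof. by move=> eta; apply/funext => -[|[|k]]. Qed.

Lemma x_root01 : maps x_root [:: false; true] [:: true; false].
Proof. by move=> eta; apply/funext => -[|[|k]]. Qed.

Lemma x_root1 : maps x_root [:: true] [:: true; true].
Proof. by move=> eta; apply/funext => -[|[|k]]. Qed.

Lemma maps_below_cat f s t u : maps f s t -> maps (below u f) (u ++ s) (u ++ t).
Proof. by move=> fst eta; rewrite !bcat_cat below_in fst. Qed.

Lemma maps_x00 u : maps (x_ u) (u ++ [:: false; false]) (u ++ [:: false]).
Proof. exact: maps_below_cat x_root00. Qed.

Lemma maps_x01 u : maps (x_ u) (u ++ [:: false; true]) (u ++ [:: true; false]).
Proof. exact: maps_below_cat x_root01. Qed.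

Lemma maps_x1 u : maps (x_ u) (u ++ [:: true]) (u ++ [:: true; true]).
Proof. exact: maps_below_cat x_root1. Qed.

Lemma below_bcons b s f eta : below (b :: s) f (bcat [:: b] eta) =
  bcat [:: b] (below s f eta).
Proof. by rewrite -[b :: s]/([:: b] ++ s) below_cat below_in. Qed.

Lemma below_0_1 s f eta :
  below (false :: s) f (bcat [:: true] eta) = bcat [:: true] eta.
Proof. exact: below_out. Qed.

Lemma below_1_0 s f eta :
  below (true :: s) f (bcat [:: false] eta) = bcat [:: false] eta.
Proof. exact: below_out. Qed.

Lemma bitseqs_x_ind (P : bitseqs -> Prop) :
  (forall eta, P (bcat [:: false; false] eta)) ->
  (forall eta, P (bcat [:: false; true] eta)) ->
  (forall eta, P (bcat [:: true] eta)) -> forall eta, P eta.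
Proof.
move=> P00 P01 P1; elim/bitseqs_ind2 => -[] b eta; first exact: P1.
by case: b; [exact: P01|exact: P00].
Qed.

Lemma bitseqs_x_indV (P : bitseqs -> Prop) :
  (forall eta, P (bcat [:: true; true] eta)) ->
  (forall eta, P (bcat [:: true; false] eta)) ->
  (forall eta, P (bcat [:: false] eta)) -> forall eta, P eta.
Proof.
move=> P11 P10 P0; elim/bitseqs_ind2 => -[] b eta; last exact: P0.
by case: b; [exact: P11|exact: P10].
Qed.

(** The pentagon relation of Thompson's group F. *)
Lemma x_root_rel :
  x_root * x_root = below [:: false] x_root * x_root * below [:: true] x_root.
Proof.
apply: bipermP; elim/bitseqs_x_ind => eta; rewrite !bipermE.
- rewrite x_root00 -[bcat [:: false; false] eta]/(bcat [:: false] (bcat [:: false] eta)).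
  rewrite below_bcons below_nil.
  move: eta; elim/bitseqs_ind2 => a b eta; apply/funext.
  by case: a; case: b => -[|[|[|k]]].
- rewrite x_root01 -[bcat [:: false; true] eta]/(bcat [:: false] (bcat [:: true] eta)).
  rewrite below_bcons below_nil.
  by apply/funext => -[|[|[|k]]].
- rewrite x_root1.
  rewrite -[bcat [:: true; true] eta]/(bcat [:: true] (bcat [:: true] eta)).
  by rewrite below_bcons below_nil !x_root1.
Qed.

(** One unfolding of the recursion that defines y: x sorts the three cones, and
    the copies of y on them do the rest. *)
Lemma y_root_rel : y_root = x_root * below [:: false] y_root *
  (below [:: true; false] y_root)^-1 * below [:: true; true] y_root.
Proof.
apply: bipermP; elim/bitseqs_x_ind => eta; rewrite !bipermE -belowV.
- rewrite x_root00 [LHS]ymap00 below_bcons below_nil.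
  by rewrite !below_1_0.
- rewrite x_root01 [LHS]ymap01 -[bcat [:: true; false] eta]/(bcat [:: true] (bcat [:: false] eta)).
  rewrite below_0_1 below_bcons below_bcons below_bcons below_nil.
  by rewrite below_1_0.
- rewrite x_root1 [LHS]ymap1 -[bcat [:: true; true] eta]/(bcat [:: true] (bcat [:: true] eta)).
  rewrite below_0_1 below_bcons below_0_1.
  by rewrite !below_bcons below_nil.
Qed.

Lemma x_rel s : x_ s * x_ s = x_ (s ++ [:: false]) * x_ s * x_ (s ++ [:: true]).
Proof.
by rewrite !x_below !below_cat -!belowM x_root_rel.
Qed.

Lemma y_rel s : y_ s = x_ s * y_ (s ++ [:: false]) *
  (y_ (s ++ [:: true; false]))^-1 * y_ (s ++ [:: true; true]).
Proof.
by rewrite x_below !y_below !below_cat -belowV -!belowM -y_root_rel.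
Qed.

(** * The symmetry exchanging the two letters *)

Definition flip (xi : bitseqs) : bitseqs := fun n => ~~ xi n.

Lemma flipK : involutive flip.
Proof. by move=> xi; apply/funext => n; rewrite /flip negbK. Qed.

Lemma flip_bcat s xi : flip (bcat s xi) = bcat (map negb s) (flip xi).
Proof.
by elim: s => //= b s IH; rewrite -IH; apply/funext => -[|n].
Qed.

Definition flip_conj (f : biperm) : biperm :=
  Biperm (can_comp (can_comp flipK (@bfunK f)) flipK)
         (can_comp (can_comp flipK (@binvK f)) flipK).

Lemma flip_conjE f xi : flip_conj f xi = flip (f (flip xi)).
Proof. by []. Qed.

Lemma flip_conjM f g : flip_conj (f * g) = flip_conj f * flip_conj g.
Proof. by apply: bipermP => xi; rewrite bipermE !flip_conjE flipK. Qed.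

Lemma flip_conjV f : flip_conj f^-1 = (flip_conj f)^-1.
Proof. exact: biperm_eq. Qed.

Lemma flip_conjK f : flip_conj (flip_conj f) = f.
Proof. by apply: bipermP => xi; rewrite !flip_conjE !flipK. Qed.

Lemma flip_conj1 : flip_conj 1 = 1.
Proof. by apply: bipermP => xi; rewrite flip_conjE !biperm1E flipK. Qed.

Lemma flip_conj_below s f :
  flip_conj (below s f) = below (map negb s) (flip_conj f).
Proof.
apply: bipermP => xi; rewrite flip_conjE.
have [[eta ->]|out] := cone_case (map negb s) xi.
  rewrite flip_bcat -map_comp (eq_map negbK) map_id below_in below_in flip_bcat.
  by rewrite flip_conjE.
rewrite [RHS]below_out // below_out ?flipK //; apply: btake_neq => eta E.
by move: out; rewrite -(flipK xi) E flip_bcat btake_bcat eqxx.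
Qed.

Lemma flip_conj_x_root : flip_conj x_root = x_root^-1.
Proof.
apply: bipermP; elim/bitseqs_ind2 => a b eta.
by rewrite flip_conjE bipermVE; apply/funext; case: a; case: b => -[|[|[|k]]] //=;
  rewrite /flip /= negbK.
Qed.

(** Exchanging the letters turns the recursion of y into that of its inverse.
    The two sides are compared bit by bit, because the recursion does not
    shrink an infinite sequence but determines its bits one after another. *)
Lemma flip_conj_y_root : flip_conj y_root = y_root^-1.
Proof.
suff H k eta : flip (ymap (flip eta)) k = ymap_inv eta k /\
    flip (ymap_inv (flip eta)) k = ymap eta k.
  by apply: bipermP => eta; apply/funext => k; rewrite flip_conjE; exact: (H k eta).1.
elim/ltn_ind: k eta => k IH eta; split.
- move: eta; elim/bitseqs_x_indV => eta; rewrite flip_bcat /=.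
  + rewrite -[bcons _ _]/(bcat [:: false; false] (flip eta)) ymap00 ymap_inv11 flip_bcat.
    by case: k IH => // k IH; exact: (IH k (ltnSn k) _).1.
  + rewrite -[bcons _ _]/(bcat [:: false; true] (flip eta)) ymap01 ymap_inv10 flip_bcat.
    by case: k IH => [|[|k]] // IH; exact: (IH k (leqnSn _) _).2.
  + rewrite -[bcons _ _]/(bcat [:: true] (flip eta)) ymap1 ymap_inv0 flip_bcat.
    by case: k IH => [|[|k]] // IH; exact: (IH k (leqnSn _) _).1.
- move: eta; elim/bitseqs_x_ind => eta; rewrite flip_bcat /=.
  + rewrite -[bcons _ _]/(bcat [:: true; true] (flip eta)) ymap00 ymap_inv11 flip_bcat.
    by case: k IH => // k IH; exact: (IH k (ltnSn k) _).2.
  + rewrite -[bcons _ _]/(bcat [:: true; false] (flip eta)) ymap01 ymap_inv10 flip_bcat.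
    by case: k IH => [|[|k]] // IH; exact: (IH k (leqnSn _) _).1.
  + rewrite -[bcons _ _]/(bcat [:: false] (flip eta)) ymap1 ymap_inv0 flip_bcat.
    by case: k IH => [|[|k]] // IH; exact: (IH k (leqnSn _) _).2.
Qed.

(** * Generating sets *)

Definition nonconst (s : word) : bool := (false \in s) && (true \in s).

Lemma word_case s :
  [\/ nonconst s, s = nseq (size s) false | s = nseq (size s) true].
Proof.
have all_const (b : bool) : (~~ b) \notin s -> s = nseq (size s) b.
  move=> bs; apply/all_pred1P/allP => c cs; apply/eqP.
  by case: c b cs bs => -[] // ->.
rewrite /nonconst; have [f0|/(all_const true)] := boolP (false \in s); last by constructor 3.
by have [t0|/(all_const false)] := boolP (true \in s); [constructor 1|constructor 2].
Qed.

Lemma nonconst_zeros n : ~~ nonconst (nseq n false).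
Proof. by rewrite /nonconst !mem_nseq andbF andbF. Qed.

Lemma nonconst_ones n : ~~ nonconst (nseq n true).
Proof. by rewrite /nonconst !mem_nseq andbF. Qed.

Lemma conj_closed (N : set biperm) g h : subgroup_set N -> N g -> N h -> N (g ^ h).
Proof. by move=> [_ NM NV] Ng Nh; rewrite conjgE; apply: (NM _ _ (NV _ Nh)); exact: NM. Qed.

Lemma conj_closedV (N : set biperm) g h k : subgroup_set N ->
  g ^ h = k -> N h -> N k -> N g.
Proof.
move=> NS E Nh Nk; rewrite -(conjgK h g) E; apply: conj_closed => //.
by case: NS => _ _; apply.
Qed.

Section Generation.
Variables (N : set biperm) (p : word).
Hypotheses (NS : subgroup_set N) (Nx : N (x_ p)) (Nx1 : N (x_ (p ++ [:: true]))).

Let NM g h : N g -> N h -> N (g * h). Proof. by case: NS => _ + _; apply. Qed.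
Let NV g : N g -> N g^-1. Proof. by case: NS => _ _; apply. Qed.
Let N1 : N 1. Proof. by case: NS. Qed.

Let maps_x00p s : maps (x_ p) (p ++ [:: false, false & s]) (p ++ false :: s).
Proof.
by rewrite -[_ :: _]/([:: false; false] ++ s) catA -[_ :: s]/([:: false] ++ s)
  [in X in maps _ _ X]catA; apply/maps_cat/maps_x00.
Qed.

Let maps_x01p s : maps (x_ p) (p ++ [:: false, true & s]) (p ++ [:: true, false & s]).
Proof.
by rewrite -[_ :: _]/([:: false; true] ++ s) catA -[[:: true, _ & _]]/([:: true; false] ++ s)
  [in X in maps _ _ X]catA; apply/maps_cat/maps_x01.
Qed.

Let maps_x1p s : maps (x_ p) (p ++ true :: s) (p ++ [:: true, true & s]).
Proof.
by rewrite -[_ :: s]/([:: true] ++ s) catA -[[:: true, _ & _]]/([:: true; true] ++ s)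
  [in X in maps _ _ X]catA; apply/maps_cat/maps_x1.
Qed.

(** Repeated letters at the front of a word can be collapsed by x, and a word
    with alternating front can first be given a repeated letter; so every cone
    away from both ends is carried to the cone of 10. *)
Lemma nonconst_transitive s : nonconst s ->
  exists g, N g /\ maps g (p ++ s) (p ++ [:: true; false]).
Proof.
have step g t u : N g -> maps g (p ++ t) (p ++ u) ->
    (exists h, N h /\ maps h (p ++ u) (p ++ [:: true; false])) ->
    exists h, N h /\ maps h (p ++ t) (p ++ [:: true; false]).
  move=> Ng gtu [h [Nh hu]]; exists (g * h); split; first exact: NM.
  exact: mapsM gtu hu.
have [n] := ubnP (size s); elim: n s => // n IH [|b [|c [|d s]]] //.
- by case: b.
- case: b; case: c => // _ _; first by exists 1.
  by apply: (step (x_ p) _ [:: true; false]) (maps_x01p [::]) _; last by exists 1.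
- rewrite /= => sn ns.
  have IH10 e : exists h, N h /\ maps h (p ++ [:: true, false, e & s]) (p ++ [:: true; false]).
    have IHs : exists h, N h /\ maps h (p ++ [:: true, false & s]) (p ++ [:: true; false]).
      by apply: IH; first exact: sn; rewrite /nonconst !inE.
    case: e.
      (* 101 becomes 110, which collapses to 10 *)
      apply: (step (x_ (p ++ [:: true])) _ [:: true, true, false & s]) => //.
        by have := maps_cat s (@maps_x01 (p ++ [:: true])); rewrite -!catA.
      by apply: (step (x_ p)^-1) IHs; [exact: NV|exact/mapsV/maps_x1p].
    apply: (step (x_ (p ++ [:: true]))) IHs => //.
    by have := maps_cat s (@maps_x00 (p ++ [:: true])); rewrite -!catA.
  case: b c ns => -[] ns //.
  + apply: (step (x_ p)^-1 _ [:: true, d & s]); [exact: NV| |].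
      exact/mapsV/maps_x1p.
    by apply: IH; first exact: sn; move: ns; rewrite /nonconst !inE.
  + by apply: (step (x_ p)) (IH10 d) => //; exact: maps_x01p.
  + apply: (step (x_ p) _ [:: false, d & s]) => //.
    by apply: IH; first exact: sn; move: ns; rewrite /nonconst !inE.
Qed.

Lemma gen_nonconst f s : nonconst s -> N (below (p ++ [:: true; false]) f) ->
  N (below (p ++ s) f).
Proof.
move=> /nonconst_transitive[g [Ng gs]] N10.
exact: conj_closedV NS (belowJ f gs) Ng N10.
Qed.

Lemma gen_zeros f n : N (below (p ++ [:: false]) f) ->
  N (below (p ++ nseq n.+1 false) f).
Proof.
move=> N0; elim: n => // n IH.
exact: conj_closedV NS (belowJ f (maps_x00p (nseq n false))) Nx IH.
Qed.

Lemma gen_ones f n : N (below (p ++ [:: true]) f) ->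
  N (below (p ++ nseq n.+1 true) f).
Proof.
move=> N0; elim: n => // n IH.
by rewrite -(belowJ f (maps_x1p (nseq n true))); exact: conj_closed.
Qed.

Lemma gen_x s : N (x_ (p ++ s)).
Proof.
have Nx0 : N (x_ (p ++ [:: false])).
  have E : x_ (p ++ [:: false]) =
      x_ p * x_ p * (x_ (p ++ [:: true]))^-1 * (x_ p)^-1.
    by rewrite x_rel !mulgK.
  by rewrite E; do ![apply: NM|apply: NV].
have [ns|->|->] := word_case s.
- apply: (@gen_nonconst x_root) => //; rewrite -x_below.
  have E : x_ (p ++ [:: true; false]) = x_ (p ++ [:: true]) * x_ (p ++ [:: true]) *
      (x_ (p ++ [:: true; true]))^-1 * (x_ (p ++ [:: true]))^-1.
    by rewrite x_rel -!catA !mulgK.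
  by rewrite E; do ![apply: NM|apply: NV] => //; exact: (@gen_ones x_root 1).
- by case: (size s) => [|n]; [rewrite cats0|exact: (@gen_zeros x_root)].
- by case: (size s) => [|n]; [rewrite cats0|exact: (@gen_ones x_root)].
Qed.

End Generation.

(** * Excluded words *)

(** The flags tell whether y acts at the left end and at the right end; the
    four choices give the four groups.  The empty word is a constant word of
    both letters, so y itself is a generator only if both flags are set. *)
Definition ends_excluded (f0 f1 : bool) (E : set word) : Prop :=
  forall t, E t <-> (~~ f0 /\ zeros t) \/ (~~ f1 /\ ones t).

Lemma zerosP t : zeros t <-> t = nseq (size t) false.
Proof. by split=> [[n _ <-]|->]; [rewrite size_nseq|exists (size t)]. Qed.

Lemma onesP t : ones t <-> t = nseq (size t) true.
Proof. by split=> [[n _ <-]|->]; [rewrite size_nseq|exists (size t)]. Qed.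

Section LodhaMoore.
Variables (f0 f1 : bool) (E : set word).
Hypothesis EP : ends_excluded f0 f1 E.

Lemma allowed_nonconst t : nonconst t -> ~ E t.
Proof.
move=> nt /EP[[_ [n _ E0]]|[_ [n _ E0]]]; move: nt; rewrite -E0.
  by rewrite (negbTE (nonconst_zeros n)).
by rewrite (negbTE (nonconst_ones n)).
Qed.

Lemma allowed_zeros n : f0 -> ~ E (nseq n.+1 false).
Proof. by move=> h /EP[[]|[_ [[|m] _]]] //; rewrite h. Qed.

Lemma allowed_ones n : f1 -> ~ E (nseq n.+1 true).
Proof. by move=> h /EP[[_ [[|m] _]]|[]] //; rewrite h. Qed.

Lemma allowed_case t : ~ E t -> [\/ nonconst t,
  f0 /\ (exists n, t = nseq n.+1 false), f1 /\ (exists n, t = nseq n.+1 true) |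
  [/\ f0, f1 & t = [::]]].
Proof.
move=> Et; have [nt|tE|tE] := word_case t; first by constructor 1.
- have h0 : f0 by apply: contrapT => /negP h0; apply/Et/EP; left; split=> //; apply/zerosP.
  case sE: (size t) tE => [|n] tE; last by constructor 2; split=> //; exists n.
  constructor 4; split=> //; apply: contrapT => /negP h1; apply/Et/EP; right; split=> //.
  by exists 0%N => //; rewrite tE.
- have h0 : f1 by apply: contrapT => /negP h0; apply/Et/EP; right; split=> //; apply/onesP.
  case sE: (size t) tE => [|n] tE; last by constructor 3; split=> //; exists n.
  constructor 4; split=> //; apply: contrapT => /negP h1; apply/Et/EP; left; split=> //.
  by exists 0%N => //; rewrite tE.
Qed.

(** The maps x and x_1 generate all the x_s, which conjugate y_10 to every y_t
    with t nonconstant, and move y_0 and y_1 along the constant words.  The map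
    y itself comes from its unfolding. *)
Lemma LM_gens_sub (N : set biperm) : subgroup_set N ->
  N (x_ [::]) -> N (x_ [:: true]) -> N (y_ [:: true; false]) ->
  (f0 -> N (y_ [:: false])) -> (f1 -> N (y_ [:: true])) ->
  LM_gens E `<=` N.
Proof.
move=> NS Nx Nx1 Ny Ny0 Ny1 g [[s _ <-]|[t /allowed_case + <-]].
  exact: (@gen_x N [::]).
have Nzeros n : f0 -> N (y_ (nseq n.+1 false)).
  by move=> /Ny0; exact: (@gen_zeros N [::] _ _ y_root).
have Nones n : f1 -> N (y_ (nseq n.+1 true)).
  by move=> /Ny1; exact: (@gen_ones N [::] _ _ y_root).
case=> [nt|[h0 [n ->]]|[h1 [n ->]]|[h0 h1 ->]].
- exact: (@gen_nonconst N [::] _ _ _ y_root).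
- exact: Nzeros.
- exact: Nones.
have [_ NM NV] := NS; rewrite y_rel.
apply: (NM); last exact: (Nones 1%N h1).
apply: (NM); last exact: NV.
by apply: (NM); last exact: (Nzeros 0%N h0).
Qed.

End LodhaMoore.

Local Close Scope group_scope.

(** * The Stern--Brocot coordinate *)

Definition zeroseq : bitseqs := fun _ => false.
(** The sequence s10^oo: the right-hand member of the pair s01^oo, s10^oo of
    sequences that are the binary expansions of one dyadic number. *)
Definition dyadic (s : word) : bitseqs := bcat s (bcons true zeroseq).

(** The Stern--Brocot coordinate of s10^oo.  The cone of 0 is the part above 1,
    the cone of 1 is the part below 1, and the left end is at infinity. *)
Fixpoint sbcoord (s : word) : rat :=
  match s with
  | [::] => 1
  | false :: s' => 1 + sbcoord s'
  | true :: s' => sbcoord s' / (1 + sbcoord s')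
  end.

Lemma sbcoord_gt0 s : 0 < sbcoord s.
Proof.
elim: s => //= -[] s IH; last by rewrite addr_gt0.
by rewrite divr_gt0 // addr_gt0.
Qed.

Lemma sbcoord0 s : sbcoord (false :: s) = 1 + sbcoord s. Proof. by []. Qed.

Lemma frac_eq (z w : rat) : 0 < z -> w * (1 + z) = z -> w = z / (1 + z).
Proof.
move=> z0 E; have n0 : 1 + z != 0 by rewrite lt0r_neq0 // addr_gt0.
by apply: (mulIf n0); rewrite divfK.
Qed.

Lemma fracK (z : rat) : 0 < z -> z / (1 + z) * (1 + z) = z.
Proof. by move=> z0; rewrite divfK // lt0r_neq0 // addr_gt0. Qed.

Lemma sbcoord_consP b s : if b then sbcoord (b :: s) < 1 else 1 < sbcoord (b :: s).
Proof.
have s0 := sbcoord_gt0 s; case: b => /=; last by lra.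
by rewrite ltr_pdivrMr; lra.
Qed.

Lemma frac_inj (z w : rat) : 0 < z -> 0 < w ->
  z / (1 + z) = w / (1 + w) -> z = w.
Proof.
move=> z0 w0 E; have Ez := fracK z0; have Ew := fracK w0.
by rewrite E in Ez; move: Ez Ew; set u := w / _ => Ez Ew; nra.
Qed.

Lemma sbcoord_inj : injective sbcoord.
Proof.
elim=> [|b s IH] [|c t] //.
- by have := sbcoord_consP c t; case: c => + E; rewrite -E ltxx.
- by have := sbcoord_consP b s; case: b => + E; rewrite E ltxx.
have := sbcoord_consP b s; have := sbcoord_consP c t.
case: b; case: c => h1 h2 E; try by move: h1; rewrite -E => /lt_trans /(_ h2); rewrite ltxx.
- by congr cons; apply: IH; apply: frac_inj E; exact: sbcoord_gt0.
- by congr cons; apply: IH; apply: addrI E.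
Qed.

(** The subtractive Euclidean algorithm run on m and n spells the word. *)
Lemma sbcoord_surj_nat m n : (0 < m)%N -> (0 < n)%N ->
  exists s, sbcoord s = m%:R / n%:R.
Proof.
have [k] := ubnP (m + n); elim: k m n => // k IH m n mn m0 n0.
have mr : (0 : rat) < m%:R by rewrite ltr0n.
have nr : (0 : rat) < n%:R by rewrite ltr0n.
have [mn'|nm|->] := ltngtP m n; last by exists [::]; rewrite divff ?lt0r_neq0.
- have [||| s sE] := IH m (n - m)%N; try lia.
  exists (true :: s) => /=; rewrite sE natrB; last exact: ltnW.
  have d0 : (0 : rat) < n%:R - m%:R by rewrite subr_gt0 ltr_nat.
  apply/esym/frac_eq; first by rewrite divr_gt0.
  apply: (mulIf (lt0r_neq0 d0)); rewrite -mulrA mulrDl mul1r !divfK ?lt0r_neq0 //.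
  by rewrite subrK divfK ?lt0r_neq0.
- have [||| s sE] := IH (m - n)%N n; try lia.
  exists (false :: s) => /=; rewrite sE natrB; last exact: ltnW.
  by rewrite mulrBl divff ?lt0r_neq0 // addrC subrK.
Qed.

Lemma sbcoord_surj (q : rat) : 0 < q -> exists s, sbcoord s = q.
Proof.
move=> q0; have := divq_num_den q; have := denq_gt0 q.
move: (q0); rewrite -numq_gt0; case: (numq q) => // m; case: (denq q) => // n.
by rewrite !ltz_nat => m0 n0 <-; exact: sbcoord_surj_nat.
Qed.

Lemma sbcoord_zeros n s : sbcoord (nseq n false ++ s) = n%:R + sbcoord s.
Proof. by elim: n => [|n IH] /=; rewrite ?add0r // IH addrA -natr1 [1 + _]addrC. Qed.

Lemma sbcoord_large n s : n%:R < sbcoord s -> exists t, s = nseq n false ++ t.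
Proof.
elim: n s => [|n IH] s ns; first by exists s.
have n1 : 1 < sbcoord s by apply: le_lt_trans ns; rewrite ler1n.
case: s ns n1 => [|[] s] ns n1; first by rewrite ltxx in n1.
  by have := lt_trans n1 (sbcoord_consP true s); rewrite ltxx.
have [|t ->] := IH s; last by exists t.
by move: ns => /=; rewrite -natr1; lra.
Qed.

Lemma dyadic_cons b s : dyadic (b :: s) = bcat [:: b] (dyadic s).
Proof. by []. Qed.

Lemma dyadic_cat s t : dyadic (s ++ t) = bcat s (dyadic t).
Proof. exact: bcat_cat. Qed.

Lemma dyadic_inj : injective dyadic.
Proof.
have nz b s : dyadic [::] <> dyadic (b :: s).
  move/(congr1 (bdrop 1)) => /= E.
  have : forall k, dyadic s k = false by move=> k; have := congr1 (@^~ k) E.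
  by elim: s {E} => [/(_ 0%N)//|c s IH] H; apply: IH => k; have := H k.+1.
elim=> [|b s IH] [|c t] // E; [by case: (nz c t)|by case: (nz b s)|].
have -> : b = c by have := congr1 (@^~ 0%N) E.
by congr cons; apply: IH; apply/funext => k; have := congr1 (@^~ k.+1) E.
Qed.

Lemma y_root_zeroseq : ymap zeroseq = zeroseq /\ ymap_inv zeroseq = zeroseq.
Proof.
have z2 : bcat [:: false; false] zeroseq = zeroseq by apply/funext => -[|[|k]].
have z1 : bcat [:: false] zeroseq = zeroseq by apply/funext => -[|k].
have E1 := ymap00 zeroseq; rewrite z2 in E1.
have E2 := ymap_inv0 zeroseq; rewrite z1 in E2.
suff H k : ymap zeroseq k = false /\ ymap_inv zeroseq k = false.
  by split; apply/funext => k; case: (H k).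
elim/ltn_ind: k => k IH; rewrite E1 E2.
case: k IH => [|[|k]] IH //.
by split; [exact: (IH k.+1 (ltnSn _)).1|exact: (IH k (leqnSn _)).2].
Qed.

(** In the Stern--Brocot coordinate y is multiplication by one half.  Both
    directions are proved together because y on the cone of 01 is given by its
    inverse on a shorter word. *)
Lemma y_root_dyadic s :
  (exists t, y_root (dyadic s) = dyadic t /\ sbcoord t = sbcoord s / 2) /\
  (exists t, y_root^-1%g (dyadic s) = dyadic t /\ sbcoord t = sbcoord s * 2).
Proof.
have frac2 (z : rat) : 0 < z ->
    z / (1 + z) / (1 + z / (1 + z)) = (z * 2 / (1 + z * 2)) / 2.
  move=> z0; have E := fracK z0; have z20 : 0 < z * 2 by lra.
  have F := fracK z20; move: (z / (1 + z)) (z * 2 / (1 + z * 2)) E F => w v E F.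
  have w0 : 0 < w by nra.
  by apply/esym/frac_eq => //; nra.
have frac1 (z : rat) : 0 < z ->
    (1 + z * 2) / (1 + (1 + z * 2)) = (1 + z / (1 + z)) / 2.
  move=> z0; have E := fracK z0; move: (z / (1 + z)) E => w E.
  by apply/esym/frac_eq; [lra|nra].
have [yz yz'] := y_root_zeroseq.
have r0 : dyadic [::] = bcat [:: true; false] zeroseq by apply/funext => -[|[|k]].
have [n] := ubnP (size s); elim: n s => // n IH s; rewrite ltnS => sn.
split.
- case: s sn => [|[] [|b s]] sn.
  + exists [:: true]; split=> //=; first by rewrite [LHS]ymap1 yz.
  + have [|[t [tE zt]] _] := IH [::]; first exact: sn.
    exists [:: true, true & t]; split.
      by rewrite dyadic_cons [LHS]ymap1; congr bcat.
    by rewrite /= zt frac2 ?divfK // divr_gt0 ?sbcoord_gt0.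
  + have [|[t [tE zt]] _] := IH (b :: s); first exact: sn.
    exists [:: true, true & t]; split.
      by rewrite dyadic_cons [LHS]ymap1; congr bcat.
    by rewrite [LHS]/= zt frac2 ?divfK // divr_gt0 ?sbcoord_gt0.
  + by exists [::]; split; [rewrite [LHS]ymap01 yz' r0|rewrite /=; lra].
  + have [|H1 H2] := IH s; first exact: ltnW.
    case: b {sn}; last first.
      case: H1 => t [tE zt]; exists (false :: t).
      split; first by rewrite [LHS]ymap00; congr bcat.
      by rewrite /= zt; lra.
    case: H2 => t [tE zt]; exists [:: true, false & t].
    split; first by rewrite [LHS]ymap01; congr bcat.
    by rewrite /= zt frac1 // sbcoord_gt0.
- case: s sn => [|[] [|b s]] sn.
  + by exists [:: false]; split; [rewrite r0 [LHS]ymap_inv10 yz|rewrite /=; lra].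
  + by exists [::]; split; [rewrite [LHS]ymap_inv11 yz'|exact/eqP].
  + have [|H1 H2] := IH s; first exact: ltnW.
    case: b {sn}.
      case: H2 => t [tE zt]; exists (true :: t).
      split; first by rewrite [LHS]ymap_inv11; congr bcat.
      by rewrite /= zt frac2 ?sbcoord_gt0 // divfK.
    case: H1 => t [tE zt]; exists [:: false, true & t].
    split; first by rewrite [LHS]ymap_inv10; congr bcat.
    rewrite /= zt; have z0 := sbcoord_gt0 s; have zs2 : 0 < sbcoord s / 2 by lra.
    by have := frac1 _ zs2; rewrite divfK // => ->; lra.
  + have [|_ [t [tE zt]]] := IH [::]; first exact: sn.
    exists [:: false, false & t]; split.
      by rewrite dyadic_cons [LHS]ymap_inv0; congr bcat.
    by rewrite /= zt /=; lra.
  + have [|_ [t [tE zt]]] := IH (b :: s); first exact: sn.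
    exists [:: false, false & t]; split.
      by rewrite dyadic_cons [LHS]ymap_inv0; congr bcat.
    by rewrite [LHS]sbcoord0 [sbcoord (false :: t)]sbcoord0 [in RHS]sbcoord0 zt; lra.
Qed.

(** * Affine germs *)

(** Near the left end of the cone of u, the map g goes to the left end of the
    cone of v, and reads z |-> a z + b in the coordinates of the two cones. *)
Definition affine_germ (u v : word) (g : biperm) (a b : rat) : Prop :=
  exists N : rat, forall s, N <= sbcoord s ->
    exists2 t, g (bcat u (dyadic s)) = bcat v (dyadic t) & sbcoord t = a * sbcoord s + b.

Lemma nat_above (F : archiRealFieldType) (q : F) : exists n : nat, q <= n%:R.
Proof.
exists (Num.bound `|q|); apply: le_trans (ler_norm _) _.
by rewrite ltW // archi_boundP.
Qed.

Lemma germ_uniq u v g a b a' b' :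
  affine_germ u v g a b -> affine_germ u v g a' b' -> a = a' /\ b = b'.
Proof.
move=> [N HN] [N' HN'].
have [n Nn] := nat_above (Num.max N N').
have E s : n%:R <= sbcoord s -> a * sbcoord s + b = a' * sbcoord s + b'.
  move=> ns; move: (le_trans Nn ns); rewrite ge_max => /andP[h h'].
  have [t gt <-] := HN s h; have [t' gt' <-] := HN' s h'.
  by congr sbcoord; apply/dyadic_inj/(@bcat_inj v); rewrite -gt.
have z m : sbcoord (nseq m false) = m%:R + 1 by rewrite -{1}(cats0 (nseq m _)) sbcoord_zeros.
have := E (nseq n false); have := E (nseq n.+1 false).
rewrite !z -natr1; move: (n%:R : rat) => x E1 E2.
have {}E1 := E1 ltac:(lra); have {}E2 := E2 ltac:(lra).
have aa' : a = a' by lra.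
by split=> //; rewrite aa' in E2; lra.
Qed.

Lemma germ_mul u v w g h a b a' b' : 0 < a ->
  affine_germ u v g a b -> affine_germ v w h a' b' ->
  affine_germ u w (g * h)%g (a' * a) (a' * b + b').
Proof.
move=> a0 [N HN] [N' HN']; exists (Num.max N ((N' - b) / a)) => s.
rewrite ge_max ler_pdivrMr // => /andP[Ns N's].
have [t gt tE] := HN s Ns.
have [|r hr rE] := HN' t; first by rewrite tE; lra.
by exists r; [rewrite bipermE gt|rewrite rE tE; lra].
Qed.

(** Every positive rational is the coordinate of a word, so the points reached
    by g fill a neighbourhood of the end. *)
Lemma germ_inv u v g a b : 0 < a ->
  affine_germ u v g a b -> affine_germ v u g^-1%g a^-1 (- (b / a)).
Proof.
move=> a0 [N HN]; exists (a * Num.max N 1 + b) => t tN.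
have qN : Num.max N 1 <= (sbcoord t - b) / a by rewrite ler_pdivlMr //; lra.
move: qN; rewrite ge_max => /andP[qN q1].
have [s sE] := sbcoord_surj (lt_le_trans ltr01 q1).
have [|t' gt tE] := HN s; first by rewrite sE.
have {tE} : sbcoord t' = sbcoord t by rewrite tE sE mulrC divfK ?subrK // lt0r_neq0.
move/sbcoord_inj => tt'; subst t'; exists s; first by rewrite -gt bipermKV.
by rewrite sE mulrBl mulrC.
Qed.

Lemma germ_maps u v g : maps g u v -> affine_germ u v g 1 0.
Proof. by move=> guv; exists 0 => s _; exists s; [exact: guv|rewrite mul1r addr0]. Qed.

Lemma germ_lift u v p q (g h : biperm) a b :
  (forall eta, g (bcat u eta) = bcat v (h eta)) -> affine_germ p q h a b ->
  affine_germ (u ++ p) (v ++ q) g a b.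
Proof.
move=> gh [N HN]; exists N => s /HN[t ht tE].
by exists t => //; rewrite !bcat_cat gh ht.
Qed.

(** Passing from a cone to its leftmost subcone of depth n translates the
    coordinate by n and leaves scales unchanged. *)
Lemma germ_shift u v m n g a b :
  affine_germ (u ++ nseq m false) (v ++ nseq n false) g a b ->
  affine_germ u v g a (b + n%:R - a * m%:R).
Proof.
move=> [N HN]; exists (Num.max (N + m%:R) (m%:R + 1)) => s.
rewrite ge_max => /andP[Ns ms].
have [|s' sE] := @sbcoord_large m s; first by lra.
have zs : sbcoord s = m%:R + sbcoord s' by rewrite sE sbcoord_zeros.
have [|t gt tE] := HN s'; first by lra.
exists (nseq n false ++ t); last by rewrite sbcoord_zeros tE zs; lra.
by rewrite sE !dyadic_cat -bcat_cat gt bcat_cat.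
Qed.

Lemma incomparable_size s t : size s = size t -> s != t -> incomparable s t.
Proof.
move=> st; apply: contraR; rewrite /incomparable negb_and !negbK.
by move=> /orP[] /prefixP[r E]; move: (st); rewrite E size_cat;
  case: r E => [|? ? _] /=; rewrite ?cats0 => // *; rewrite ?eqxx //; lia.
Qed.

Lemma germ_below_zeros n f a b : affine_germ [::] [::] f a b ->
  affine_germ [::] [::] (below (nseq n false) f) a (b + n%:R - a * n%:R).
Proof.
move=> fab; apply: germ_shift; rewrite /= -[nseq n false]cats0.
by apply: germ_lift fab => eta; rewrite cats0; exact: below_in.
Qed.

Lemma germ_below_out s f : ~ zeros s ->
  affine_germ [::] [::] (below s f) 1 0.
Proof.
move=> sz; rewrite -[0](subrr (1 * (size s)%:R)) -[X in X - _]add0r mul1r.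
rewrite -[X in _ - X]mul1r; apply: germ_shift; apply/germ_maps/maps_below.
apply: incomparable_size; first by rewrite size_nseq.
by apply/eqP => E; apply/sz/zerosP.
Qed.

Lemma germ_x_root : affine_germ [::] [::] x_root 1 (- 1).
Proof.
have -> : (- 1 : rat) = 0 + 1%:R - 1 * 2%:R by lra.
by apply: germ_shift; exact/germ_maps/x_root00.
Qed.

Lemma germ_y_root : affine_germ [::] [::] y_root 2^-1 0.
Proof.
exists 0 => s _; have [[t [tE zt]] _] := y_root_dyadic s.
by exists t => //; rewrite zt; lra.
Qed.

(** * The germ at the left end *)

(** The germs that occur at the left end are z |-> 2^-k z + b. *)
Definition end_germ (g : biperm) (k : int) (b : rat) : Prop :=
  affine_germ [::] [::] g (2%:Q ^ (- k)) b.

Lemma pow2_gt0 (k : int) : 0 < 2%:Q ^ k. Proof. exact: exprz_gt0. Qed.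

Lemma pow2_inj : injective (fun k : int => 2%:Q ^ k).
Proof. exact: ieexprIz. Qed.

Lemma end_germ_uniq g k b k' b' :
  end_germ g k b -> end_germ g k' b' -> k = k' /\ b = b'.
Proof.
by move=> h /(germ_uniq h)[/pow2_inj/oppr_inj].
Qed.

Lemma end_germ_mul g h k b k' b' : end_germ g k b -> end_germ h k' b' ->
  end_germ (g * h)%g (k + k') (2%:Q ^ (- k') * b + b').
Proof.
move=> gk hk; rewrite /end_germ opprD addrC expfzDr //.
exact: germ_mul (pow2_gt0 _) gk hk.
Qed.

Lemma end_germ_inv g k b : end_germ g k b ->
  end_germ g^-1%g (- k) (- (b * 2%:Q ^ k)).
Proof.
move=> gk; have := germ_inv (pow2_gt0 _) gk.
by rewrite /end_germ -invr_expz !invr_expz !opprK.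
Qed.

Lemma end_germ1 : end_germ 1%g 0 0.
Proof. by rewrite /end_germ oppr0 expr0z; apply: germ_maps. Qed.

Lemma end_germ_x_zeros n : end_germ (x_ (nseq n false)) 0 (- 1).
Proof.
rewrite /end_germ oppr0 expr0z.
have := germ_below_zeros n germ_x_root; congr affine_germ; lra.
Qed.

Lemma end_germ_out s f : ~ zeros s -> end_germ (below s f) 0 0.
Proof. by rewrite /end_germ oppr0 expr0z; exact: germ_below_out. Qed.

Lemma end_germ_y_zeros n : end_germ (y_ (nseq n false)) 1 (n%:R / 2).
Proof.
have := germ_below_zeros n germ_y_root; rewrite /end_germ exprN1.
by congr affine_germ; lra.
Qed.

(** * Jumps at the dyadic points *)

Definition mirror (s : word) : word := map negb s.

Lemma mirrorK : involutive mirror.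
Proof. by move=> s; rewrite /mirror -map_comp (eq_map negbK) map_id. Qed.

Lemma mirror_cat s t : mirror (s ++ t) = mirror s ++ mirror t.
Proof. exact: map_cat. Qed.

Lemma size_mirror s : size (mirror s) = size s.
Proof. exact: size_map. Qed.

Lemma prefix_mirror s t : prefix (mirror s) (mirror t) = prefix s t.
Proof. by elim: s t => [|b s IH] [|c t] //=; rewrite IH (inj_eq negb_inj). Qed.

(** With g carrying the pair s01^oo, s10^oo to the pair of t, the integer j is
    the base-2 logarithm of the ratio of the left scale of g to its right scale
    there.  The left side is read through the exchange of letters, where it
    becomes a right side. *)
Definition jump (g : biperm) (s : word) (j : int) : Prop :=
  exists t a b b',
    [/\ 0 < a, g (dyadic s) = dyadic t, flip_conj g (dyadic (mirror s)) = dyadic (mirror t),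
        affine_germ (rcons s true) (rcons t true) g a b &
        affine_germ (rcons (mirror s) true) (rcons (mirror t) true)
          (flip_conj g) (a * 2%:Q ^ j) b'].

Lemma jump_uniq g s j j' : jump g s j -> jump g s j' -> j = j'.
Proof.
move=> [t [a [b [c [a0 gt _ R L]]]]] [t' [a' [b' [c' [_ gt' _ R' L']]]]].
have tt' : t' = t by apply: dyadic_inj; rewrite -gt.
subst t'; have [aa' _] := germ_uniq R R'; have [E _] := germ_uniq L L'.
apply: pow2_inj; apply: (mulfI (lt0r_neq0 a0)).
by rewrite E -aa'.
Qed.

(** The chain rule. *)
Lemma jumpM (g h : biperm) s t j j' : g (dyadic s) = dyadic t ->
  jump g s j -> jump h t j' -> jump (g * h)%g s (j + j').
Proof.
move=> gst [t1 [a [b [c [a0 gt fgt R L]]]]] [u [a' [b' [c' [a'0 hu fhu R' L']]]]].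
have E : t1 = t by apply: dyadic_inj; rewrite -gt.
subst t1; exists u, (a' * a), (a' * b + b'), (a' * 2%:Q ^ j' * c + c').
split; [exact: mulr_gt0|by rewrite bipermE gt| |exact: germ_mul R R'|].
  by rewrite flip_conjM bipermE fgt.
rewrite flip_conjM.
have -> : a' * a * 2%:Q ^ (j + j') = (a' * 2%:Q ^ j') * (a * 2%:Q ^ j).
  by rewrite addrC expfzDr // mulrACA.
by apply: germ_mul L L'; rewrite mulr_gt0 // pow2_gt0.
Qed.

Lemma jumpV (g : biperm) s t j : g (dyadic s) = dyadic t -> jump g s j -> jump g^-1%g t (- j).
Proof.
move=> gst [t1 [a [b [c [a0 gt fgt R L]]]]].
have E : t1 = t by apply: dyadic_inj; rewrite -gt.
subst t1; have p0 : 0 < a * 2%:Q ^ j by rewrite mulr_gt0 // pow2_gt0.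
exists s, a^-1, (- (b / a)), (- (c / (a * 2%:Q ^ j))).
split; [by rewrite invr_gt0|by rewrite -gt bipermKV| |exact: germ_inv R|].
  by rewrite flip_conjV -fgt bipermKV.
rewrite flip_conjV -invr_expz -invfM; exact: germ_inv L.
Qed.

Lemma jump1 s : jump 1%g s 0.
Proof.
exists s, 1, 0, 0; rewrite expr0z mulr1 flip_conj1.
by split=> //; exact: germ_maps.
Qed.

Lemma jump_flip g s : jump g s 0 -> jump (flip_conj g) (mirror s) 0.
Proof.
move=> [t [a [b [c []]]]]; rewrite expr0z mulr1 => a0 gt fgt R L.
exists (mirror t), a, c, b; rewrite expr0z mulr1 !mirrorK flip_conjK.
by split.
Qed.

(** The recursion shared by x and y: x is the case where k is the identity, and
    y the case where k is y. *)
Definition unfolds (f k : biperm) : Prop :=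
  forall eta, [/\ f (bcat [:: false; false] eta) = bcat [:: false] (k eta),
    f (bcat [:: false; true] eta) = bcat [:: true; false] (k^-1%g eta) &
    f (bcat [:: true] eta) = bcat [:: true; true] (k eta)].

Section Unfolds.
Variables (f k : biperm) (a b : rat).
Hypotheses (fk : unfolds f k) (a0 : 0 < a).
Hypotheses (flipf : flip_conj f = f^-1%g) (flipk : flip_conj k = k^-1%g).
Hypotheses (kz : k zeroseq = zeroseq) (kg : affine_germ [::] [::] k a b).

Let f00 eta : f (bcat [:: false; false] eta) = bcat [:: false] (k eta).
Proof. by case: (fk eta). Qed.
Let f01 eta : f (bcat [:: false; true] eta) = bcat [:: true; false] (k^-1%g eta).
Proof. by case: (fk eta). Qed.
Let f1 eta : f (bcat [:: true] eta) = bcat [:: true; true] (k eta).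
Proof. by case: (fk eta). Qed.
Let fV0 eta : f^-1%g (bcat [:: false] eta) = bcat [:: false; false] (k^-1%g eta).
Proof. by rewrite -(bipermVK k eta) -f00 !bipermKV. Qed.
Let fV10 eta : f^-1%g (bcat [:: true; false] eta) = bcat [:: false; true] (k eta).
Proof. by rewrite -[in LHS](bipermKV k eta) -f01 !bipermKV. Qed.
Let fV11 eta : f^-1%g (bcat [:: true; true] eta) = bcat [:: true] (k^-1%g eta).
Proof. by rewrite -(bipermVK k eta) -f1 !bipermKV. Qed.

Let kVz : k^-1%g zeroseq = zeroseq. Proof. by rewrite -{1}kz bipermKV. Qed.

Let kVg : affine_germ [::] [::] k^-1%g a^-1 (- (b / a)).
Proof. exact: germ_inv. Qed.

Let r10 : bcons true zeroseq = bcat [:: true; false] zeroseq.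
Proof. by apply/funext => -[|[|n]]. Qed.

(** Where the three pieces of f meet, the two sides have the same scale, because
    k has scale a at its left end and, read through the exchange of letters,
    scale a^-1 at its right end; inside a piece the scales are those of k at a
    shorter word. *)
Lemma jump_unfolds s : (forall s', (size s' < size s)%N ->
    jump k s' 0 /\ jump k^-1%g s' 0) -> jump f s 0.
Proof.
move=> IH; case: s IH => [|[] s] IH.
- exists [:: true], a, b, (b - a); rewrite expr0z mulr1 flipf.
  split=> //.
  + by rewrite [LHS](f1 zeroseq) kz.
  + by rewrite /= /dyadic /= [in LHS]r10 [LHS]fV10 kz.
  + exact: germ_lift f1 kg.
  + have -> : b - a = b + 0%:R - a * 1%:R by lra.
    apply: (@germ_shift [:: true] [:: false; true] 1 0).
    exact: (germ_lift fV10 kg).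
- have [|Jk _] := IH s; first exact: ltnSn.
  have [t [c [d [e []]]]] := Jk.
  rewrite expr0z mulr1 flipk => c0 kt fkt R L.
  exists [:: true, true & t], c, d, e; rewrite expr0z mulr1 flipf.
  split=> //.
  + by rewrite dyadic_cons f1 kt.
  + by rewrite -[mirror (_ :: s)]/([:: false] ++ mirror s) dyadic_cat fV0 fkt.
  + exact: (germ_lift f1 R).
  + exact: (germ_lift fV0 L).
case: s IH => [|[] s] IH.
- exists [::], a^-1, (- (b / a) + 1), (- (b / a)).
  rewrite expr0z mulr1 flipf; split=> //.
  + by rewrite invr_gt0.
  + by rewrite /dyadic /= [in RHS]r10 [LHS](f01 zeroseq) kVz.
  + by rewrite [LHS](fV11 zeroseq) kVz.
  + have -> : - (b / a) + 1 = - (b / a) + 1%:R - a^-1 * 0%:R by lra.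
    apply: (@germ_shift [:: false; true] [:: true] 0 1).
    exact: (germ_lift f01 kVg).
  + exact: (germ_lift fV11 kVg).
- have [|_ Jk] := IH s; first exact: leqnSn.
  have [t [c [d [e []]]]] := Jk.
  rewrite expr0z mulr1 flip_conjV flipk invgK => c0 kt fkt R L.
  exists [:: true, false & t], c, d, e; rewrite expr0z mulr1 flipf.
  split=> //.
  + by rewrite -[[:: false, true & s]]/([:: false; true] ++ s) dyadic_cat f01 kt.
  + by rewrite -[mirror [:: false, true & s]]/([:: true; false] ++ mirror s) dyadic_cat fV10 fkt.
  + exact: (germ_lift f01 R).
  + exact: (germ_lift fV10 L).
- have [|Jk _] := IH s; first exact: leqnSn.
  have [t [c [d [e []]]]] := Jk.
  rewrite expr0z mulr1 flipk => c0 kt fkt R L.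
  exists [:: false & t], c, d, e; rewrite expr0z mulr1 flipf.
  split=> //.
  + by rewrite -[[:: false, false & s]]/([:: false; false] ++ s) dyadic_cat f00 kt.
  + by rewrite -[mirror [:: false, false & s]]/([:: true; true] ++ mirror s) dyadic_cat fV11 fkt.
  + exact: (germ_lift f00 R).
  + exact: (germ_lift fV11 L).
Qed.
End Unfolds.

Lemma x_root_zeroseq : x_root zeroseq = zeroseq.
Proof. by apply/funext => -[|[|n]]. Qed.

Lemma jump_x_root s : jump x_root s 0.
Proof.
apply: (@jump_unfolds _ 1%g 1 0) => //.
- exact: flip_conj_x_root.
- by rewrite invg1 flip_conj1.
- exact: germ_maps.
- by move=> s' _; rewrite invg1; split; exact: jump1.
Qed.

Lemma y_root_unfolds : unfolds y_root y_root.
Proof. by move=> eta; split; [exact: ymap00|exact: ymap01|exact: ymap1]. Qed.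

Lemma jump_y_root s : jump y_root s 0.
Proof.
have [n] := ubnP (size s); elim: n s => // n IH s sn.
have H s' : (size s' < n)%N -> jump y_root s' 0 /\ jump y_root^-1%g s' 0.
  move=> s'n; split; first exact: IH.
  rewrite -flip_conj_y_root -[s']mirrorK; apply: jump_flip.
  by apply: IH; rewrite size_mirror.
apply: (@jump_unfolds _ y_root 2^-1 0) => //; first exact: y_root_unfolds.
- exact: flip_conj_y_root.
- exact: flip_conj_y_root.
- by have [] := y_root_zeroseq.
- exact: germ_y_root.
- by move=> s' s's; apply: H; exact: leq_trans s's _.
Qed.

(** The point s10^oo is the left end of the cone of w. *)
Definition touches (w s : word) : bool :=
  w == rcons s true ++ nseq (size w - (size s).+1) false.

Lemma touches_size w s : touches w s -> (size s < size w)%N.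
Proof. by move/eqP->; rewrite size_cat size_rcons ltnS leq_addr. Qed.

Lemma dyadic_rcons s : dyadic s = bcat (rcons s true) zeroseq.
Proof. by rewrite -cats1 bcat_cat. Qed.

Lemma zeros_zeroseq n : bcat (nseq n false) zeroseq = zeroseq.
Proof. by elim: n => //= n ->; apply/funext => -[|k]. Qed.

(** To the right of a point that is not interior to the cone of w, the map f
    below w is visible only if the cone begins at that point. *)
Lemma below_side w s (f : biperm) a b : ~~ prefix w s -> f zeroseq = zeroseq ->
  affine_germ [::] [::] f a b ->
  below w f (dyadic s) = dyadic s /\ exists b',
    affine_germ (rcons s true) (rcons s true) (below w f)
      (if touches w s then a else 1) b'.
Proof.
move=> ws fz fab.
have [/prefixP[u wE]|sw] := boolP (prefix (rcons s true) w); last first.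
  have inc : incomparable w (rcons s true).
    rewrite /incomparable sw andbT; apply/negP => /prefixP[r E].
    case/lastP: r E => [|r c]; first by rewrite cats0 => E; rewrite E prefix_refl in sw.
    rewrite -rcons_cat => /rcons_inj[E _]; move: ws.
    by rewrite E prefix_prefix.
  have m := maps_below f inc.
  split; first by rewrite dyadic_rcons m.
  have -> : touches w s = false.
    by apply: contraNF sw => /eqP->; rewrite prefix_prefix.
  by exists 0; exact: germ_maps.
have su : (size w - (size s).+1 = size u)%N.
  by rewrite wE size_cat size_rcons addKn.
have tE : touches w s = (u == nseq (size u) false).
  by rewrite /touches su wE eqseq_cat // eqxx.
have lift eta : below w f (bcat (rcons s true) eta) =
    bcat (rcons s true) (below u f eta) by rewrite wE below_cat below_in.
rewrite tE; case: eqP => uE.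
- split.
    rewrite dyadic_rcons lift uE; congr bcat.
    by rewrite -{1}(zeros_zeroseq (size u)) below_in fz zeros_zeroseq.
  have bu := germ_below_zeros (size u) fab; rewrite -uE in bu.
  by eexists; rewrite -[rcons _ _]cats0; apply: germ_lift lift bu.
- have uz : ~ zeros u by move/zerosP.
  split; last first.
    exists 0; rewrite -[rcons _ _]cats0; apply: germ_lift lift _.
    exact: germ_below_out.
  rewrite dyadic_rcons lift below_out //; apply/eqP => E; apply/uz/zerosP.
  rewrite -[LHS]E; apply: (@eq_from_nth _ false); rewrite ?size_mkseq ?size_nseq //.
  by move=> i iu; rewrite nth_mkseq // nth_nseq iu.
Qed.

(** A copy of f on the cone of w is the identity outside; so if f has scale
    2^-e at its left end and 2^e at its right end, it has a jump of e at each
    end of the cone and no other jump. *)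
Lemma jump_below w (f : biperm) s (e : int) b b' :
  (forall s', jump f s' 0) ->
  f zeroseq = zeroseq -> flip_conj f zeroseq = zeroseq ->
  affine_germ [::] [::] f (2%:Q ^ (- e)) b ->
  affine_germ [::] [::] (flip_conj f) (2%:Q ^ e) b' ->
  jump (below w f) s (e *+ (touches w s + touches (mirror w) (mirror s))).
Proof.
move=> f0 fz ffz fg ffg.
have [/prefixP[s' ->]|ws] := boolP (prefix w s).
  have -> : touches w (w ++ s') = false.
    by apply/negP => /touches_size; rewrite size_cat; lia.
  have -> : touches (mirror w) (mirror (w ++ s')) = false.
    by apply/negP => /touches_size; rewrite !size_mirror size_cat; lia.
  have [t [a [c [d []]]]] := f0 s'.
  rewrite expr0z mulr1 => a0 ft fft R L.
  exists (w ++ t), a, c, d; rewrite flip_conj_below !mirror_cat -/(mirror w).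
  rewrite expr0z mulr1 !rcons_cat; split => //.
  - by rewrite !dyadic_cat below_in ft.
  - by rewrite !dyadic_cat below_in fft.
  - exact: germ_lift (below_in w f) R.
  - exact: germ_lift (below_in (mirror w) _) L.
have [p1 [c R]] := below_side ws fz fg.
have ws' : ~~ prefix (mirror w) (mirror s) by rewrite prefix_mirror.
have [p2 [d L]] := below_side ws' ffz ffg.
exists s, (if touches w s then 2%:Q ^ (- e) else 1), c, d.
rewrite flip_conj_below; split=> //; first by case: ifP => // _; exact: pow2_gt0.
move: L; congr affine_germ.
case: (touches w s); case: (touches _ _); rewrite ?addn0 ?add0n ?mulr0n ?mulr1n ?mulr2n
  ?expr0z ?mul1r ?mulr1 //.
  by rewrite -expfzDr // addKr.
by rewrite -expfzDr // addNr.
Qed.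

(** * The sum of the jumps *)

(** The first clause makes the map that g induces on the dyadic points a
    bijection, so that the sums for g and for h add up to the sum for g h. *)
Definition jump_sum (g : biperm) (k : int) : Prop :=
  (forall s, exists t, g^-1%g (dyadic s) = dyadic t) /\
  exists j : word -> int, [/\ forall s, jump g s (j s),
    finite_set [set s | j s != 0] & k = \sum_(s \in [set: word]) j s].

Lemma jump_dyadic g s j : jump g s j -> exists t, g (dyadic s) = dyadic t.
Proof. by move=> [t [a [b [c []]]]]; exists t. Qed.

Lemma jump_sum_uniq g k k' : jump_sum g k -> jump_sum g k' -> k = k'.
Proof.
move=> [_ [j [jg _ ->]]] [_ [j' [jg' _ ->]]].
by apply: eq_fsbigr => s _; exact: jump_uniq (jg s) (jg' s).
Qed.

Lemma jump_sum1 : jump_sum 1%g 0.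
Proof.
split=> [s|]; first by exists s.
exists (fun=> 0); split; [by move=> s; exact: jump1| |by rewrite fsbig1].
by rewrite (_ : [set s | _] = set0) //; apply/seteqP; split=> s //=; rewrite eqxx.
Qed.

Lemma dyadic_bij (g : biperm) (p : word -> word) : (forall s, g (dyadic s) = dyadic (p s)) ->
  (forall s, exists t, g^-1%g (dyadic s) = dyadic t) -> bijective p.
Proof.
move=> gp /choice[q gq]; exists q => s; apply: dyadic_inj.
  by rewrite -gq -gp bipermKV.
by rewrite -gp -gq bipermVK.
Qed.

Lemma finite_fsum_split (f g : word -> int) :
  finite_set [set s | f s != 0] -> finite_set [set s | g s != 0] ->
  \sum_(s \in [set: word]) (f s + g s) =
  \sum_(s \in [set: word]) f s + \sum_(s \in [set: word]) g s.
Proof.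
move=> ff gf; pose D := [set s | f s != 0] `|` [set s | g s != 0].
have W (h : word -> int) : (forall s, ~ D s -> h s = 0) ->
    \sum_(s \in [set: word]) h s = \sum_(s \in D) h s.
  by move=> hD; apply/esym/fsbig_widen => // s [_ /hD].
have fD s : ~ D s -> f s = 0.
  by move=> Ds; apply: contrapT => /eqP fs; apply: Ds; left.
have gD s : ~ D s -> g s = 0.
  by move=> Ds; apply: contrapT => /eqP fs; apply: Ds; right.
rewrite !W //; last by move=> s Ds; rewrite fD // gD // addr0.
by rewrite fsbig_split // finite_setU.
Qed.

Lemma jump_sumM (g h : biperm) k l : jump_sum g k -> jump_sum h l -> jump_sum (g * h)%g (k + l).
Proof.
move=> [gV [j [jg jf ->]]] [hV [i [ih hf ->]]].
have /choice[p gp] s := jump_dyadic (jg s).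
have pb := dyadic_bij gp gV.
split=> [s|].
  have [t ht] := hV s; have [u gu] := gV t.
  by exists u; rewrite invgM bipermE ht.
have pf : finite_set [set s | i (p s) != 0].
  case: pb => q pq qp; apply: sub_finite_set (finite_image q hf) => s /= ips.
  by exists (p s) => //; rewrite pq.
exists (fun s => j s + i (p s)); split.
- by move=> s; exact: jumpM (gp s) (jg s) (ih (p s)).
- apply: (@sub_finite_set _ _ ([set s | j s != 0] `|` [set s | i (p s) != 0])).
    move=> s /= js; apply: contrapT => /not_orP[/negP/negPn/eqP j0 /negP/negPn/eqP i0].
    by move: js; rewrite j0 i0 addr0 eqxx.
  by rewrite finite_setU.
- by rewrite finite_fsum_split // -(reindex_fsbigT p).
Qed.

Lemma jump_sumV (g : biperm) k : jump_sum g k -> jump_sum g^-1%g (- k).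
Proof.
move=> [gV [j [jg jf ->]]].
have /choice[p gp] s := jump_dyadic (jg s).
have [q pq qp] := dyadic_bij gp gV.
split=> [s|]; first by exists (p s); rewrite invgK gp.
have qf : finite_set [set s | j (q s) != 0].
  by apply: sub_finite_set (finite_image p jf) => s /= ips; exists (q s).
have fN (f : word -> int) : [set s | - f s != 0] = [set s | f s != 0].
  by apply/seteqP; split=> s /=; rewrite oppr_eq0.
exists (fun s => - j (q s)); split.
- by move=> s; apply: jumpV (jg (q s)); rewrite gp qp.
- by rewrite fN.
- have qb : bijective q by exists p.
  rewrite (reindex_fsbigT q) //; apply/esym/(addIr (\sum_(s \in setT) j (q s))).
  rewrite -finite_fsum_split ?fN // addNr fsbig1 // => s _; exact: addNr.
Qed.

Lemma jump_sum_below w (f : biperm) (e : int) b b' :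
  (forall s', jump f s' 0) -> (forall s', jump f^-1%g s' 0) ->
  f zeroseq = zeroseq -> flip_conj f zeroseq = zeroseq ->
  affine_germ [::] [::] f (2%:Q ^ (- e)) b ->
  affine_germ [::] [::] (flip_conj f) (2%:Q ^ e) b' ->
  jump_sum (below w f) (\sum_(s \in [set: word])
    e *+ (touches w s + touches (mirror w) (mirror s))).
Proof.
move=> f0 fV0 fz ffz fg ffg.
split=> [s|].
  have fVz : f^-1%g zeroseq = zeroseq by rewrite -[in LHS]fz bipermKV.
  have ffVz : flip_conj f^-1%g zeroseq = zeroseq.
    by rewrite flip_conjV -[in LHS]ffz bipermKV.
  have fVg := germ_inv (pow2_gt0 _) fg; have ffVg := germ_inv (pow2_gt0 _) ffg.
  rewrite invr_expz in fVg; rewrite invr_expz -flip_conjV in ffVg.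
  rewrite -belowV.
  by have [t] := jump_dyadic (jump_below w s fV0 fVz ffVz fVg ffVg); exists t.
eexists; split=> [s||]; [exact: jump_below fg ffg| |by []].
(* the points at the ends of the cone of w have words shorter than w *)
pose m := size w.
have [M HM] : exists M : seq word, forall s, (size s < m)%N -> s \in M.
  elim: m => [|m [M HM]]; first by exists [::].
  exists ([::] :: [seq b :: s | b <- [:: true; false], s <- M]) => -[|c s] sm //.
  by rewrite inE; apply: allpairs_f; [by case: (c)|exact: HM].
apply: sub_finite_set (finite_seq M) => s /= sj; apply: HM.
apply: contraR sj; rewrite -leqNgt => ms.
have -> : touches w s = false by apply/negP => /touches_size; rewrite ltnNge ms.
have -> // : touches (mirror w) (mirror s) = false.
by apply/negP => /touches_size; rewrite !size_mirror ltnNge ms.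
Qed.

Lemma jump_sum_x w : jump_sum (x_ w) 0.
Proof.
have -> : (0 : int) = \sum_(s \in [set: word])
    (0 : int) *+ (touches w s + touches (mirror w) (mirror s)).
  by rewrite fsbig1 // => s _; rewrite mul0rn.
have xV s : jump x_root^-1%g s 0.
  by rewrite -flip_conj_x_root -[s]mirrorK; exact/jump_flip/jump_x_root.
have xz := x_root_zeroseq.
apply: (@jump_sum_below w x_root 0 (- 1) (- (- 1 / 1))) => //.
- exact: jump_x_root.
- by rewrite flip_conj_x_root -{1}xz bipermKV.
- exact: germ_x_root.
- by rewrite flip_conj_x_root expr0z -[1]invr1; apply: germ_inv germ_x_root.
Qed.

Lemma jump_sum_y w : exists k : int, jump_sum (y_ w) k /\ (w = [:: true; false] -> k != 0).
Proof.
have yV s : jump y_root^-1%g s 0.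
  by rewrite -flip_conj_y_root -[s]mirrorK; exact/jump_flip/jump_y_root.
have [yz yz'] := y_root_zeroseq.
exists (\sum_(s \in [set: word])
    (1 : int) *+ (touches w s + touches (mirror w) (mirror s))); split.
  apply: (@jump_sum_below w y_root 1 0 (- (0 / 2^-1))) => //.
  - exact: jump_y_root.
  - by rewrite flip_conj_y_root.
  - exact: germ_y_root.
  - by rewrite flip_conj_y_root expr1z -[2]invrK; apply: germ_inv germ_y_root.
move=> ->; rewrite (fsbigE [:: [::]; [:: true]]) //; last first.
  move=> i _ iN; have [i2|i2] := leqP 2 (size i); last first.
    by case: i iN i2 => [|[] [|? ?]].
  have -> : touches [:: true; false] i = false.
    by apply/negP => /touches_size; rewrite ltnNge i2.
  have -> // : touches (mirror [:: true; false]) (mirror i) = false.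
  by apply/negP => /touches_size; rewrite !size_mirror ltnNge i2.
by rewrite !big_cons big_nil !ifT ?in_setT.
Qed.

(** * Homomorphisms defined by invariants of maps *)

(** The invariants in question are not defined for all bijections, so each is
    given as a partial function compatible with the group operations; it is
    then total on the group generated by its domain. *)
Lemma hom_of_relation (R : realType) (E : set word) (Rel : biperm -> R -> Prop) :
  (forall g v w, Rel g v -> Rel g w -> v = w) ->
  Rel 1%g 0 ->
  (forall g h v w, Rel g v -> Rel h w -> Rel (g * h)%g (v + w)) ->
  (forall g v, Rel g v -> Rel g^-1%g (- v)) ->
  (forall g, LM_gens E g -> exists v, Rel g v) ->
  exists c : LM E -> R, {morph c : g h / (g * h)%g >-> g + h} /\
    forall g, Rel (gen_val g) (c g).
Proof.
move=> uniq R1 RM RV Rgen.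
have Rex (g : LM E) : exists v, Rel (gen_val g) v.
  have /asboolP := gen_valP g.
  elim=> [h /Rgen//||h k _ [v hv] _ [w hw]|h _ [v hv]].
  - by exists 0.
  - by exists (v + w); exact: RM.
  - by exists (- v); exact: RV.
have [c Hc] := choice Rex.
exists c; split=> // g h.
exact: (uniq _ _ _ (Hc (g * h)%g) (RM _ _ _ _ (Hc g) (Hc h))).
Qed.

(** When y acts at the end, the logarithm of the scale is additive.  When it
    does not, all scales there are 1 and the translation length is additive. *)
Definition end_value (R : realType) (f : bool) (g : biperm) (v : R) : Prop :=
  exists k b, [/\ end_germ g k b, ~~ f -> k = 0 &
    v = if f then k%:~R else ratr b].

Section EndValue.
Variables (R : realType) (f : bool).
Implicit Types (g h : biperm) (v w : R).

Lemma end_value_uniq g v w : end_value f g v -> end_value f g w -> v = w.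
Proof.
move=> [k [b [gk _ ->]]] [k' [b' [gk' _ ->]]].
by have [-> ->] := end_germ_uniq gk gk'.
Qed.

Lemma end_value1 : end_value f 1%g (0 : R).
Proof.
exists 0, 0; split=> //; first exact: end_germ1.
by case: f; rewrite ?mulr0z ?raddf0.
Qed.

Lemma end_valueM g h v w :
  end_value f g v -> end_value f h w -> end_value f (g * h)%g (v + w).
Proof.
move=> [k [b [gk k0 ->]]] [k' [b' [hk k'0 ->]]].
exists (k + k'), (2%:Q ^ (- k') * b + b'); split; first exact: end_germ_mul.
  by move=> fF; rewrite k0 // k'0.
case: f k0 k'0 => [_ _|_ /(_ isT)->]; first by rewrite rmorphD.
by rewrite oppr0 expr0z mul1r rmorphD.
Qed.

Lemma end_valueV g v : end_value f g v -> end_value f g^-1%g (- v).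
Proof.
move=> [k [b [gk k0 ->]]].
exists (- k), (- (b * 2%:Q ^ k)); split; first exact: end_germ_inv.
  by move=> fF; rewrite k0 // oppr0.
case: f k0 => [_|/(_ isT)->]; first by rewrite rmorphN.
by rewrite expr0z mulr1 rmorphN.
Qed.

Lemma end_value_x_zeros n :
  end_value f (x_ (nseq n false)) (if f then 0 else - 1 : R).
Proof.
exists 0, (- 1); split=> //; first exact: end_germ_x_zeros.
by rewrite rmorphN1.
Qed.

Lemma end_value_out s h : ~ zeros s -> end_value f (below s h) (0 : R).
Proof.
move=> sz; exists 0, 0; split=> //; first exact: end_germ_out.
by case: f; rewrite ?mulr0z ?raddf0.
Qed.

Lemma end_value_y_zeros n : f -> end_value f (y_ (nseq n false)) (1 : R).
Proof.
move=> fT; exists 1, (n%:R / 2); split; [exact: end_germ_y_zeros| |].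
  by rewrite fT.
by rewrite fT.
Qed.

End EndValue.

Lemma zeros_mirror s : zeros (mirror s) <-> ones s.
Proof.
split=> [/zerosP E|/onesP ->].
  by apply/onesP; rewrite -[LHS]mirrorK E size_mirror /mirror map_nseq.
by apply/zerosP; rewrite size_mirror size_nseq /mirror map_nseq.
Qed.

Lemma flip_conj_x s : flip_conj (x_ s) = (x_ (mirror s))^-1%g.
Proof. by rewrite x_below flip_conj_below flip_conj_x_root belowV. Qed.

Lemma flip_conj_y s : flip_conj (y_ s) = (y_ (mirror s))^-1%g.
Proof. by rewrite y_below flip_conj_below flip_conj_y_root belowV. Qed.

Lemma mirror_ones n : mirror (nseq n true) = nseq n false.
Proof. exact: map_nseq. Qed.

Section Homs.
Variables (R : realType) (f0 f1 : bool) (E : set word).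
Hypothesis EP : ends_excluded f0 f1 E.

Lemma not_excluded_zeros n : ~ E (nseq n false) -> f0.
Proof.
by move=> En; apply: contrapT => /negP f0F; apply/En/EP; left; split=> //; exists n.
Qed.

Lemma not_excluded_ones n : ~ E (nseq n true) -> f1.
Proof.
by move=> En; apply: contrapT => /negP f0F; apply/En/EP; right; split=> //; exists n.
Qed.

(** The character read off the germ at the left end, with its values on the
    generators. *)
Lemma left_hom : exists c : LM E -> R,
  [/\ {morph c : g h / (g * h)%g >-> g + h},
      forall g, end_value f0 (gen_val g) (c g),
      forall n, c (x_gen E (nseq n false)) = if f0 then 0 else - 1,
      forall s, ~ zeros s -> c (x_gen E s) = 0 &
      forall t (Et : (~` E) t), c (y_gen Et) = if `[< zeros t >] then 1 else 0].
Proof.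
have genx s : exists v : R, end_value f0 (x_ s) v.
  have [[n _ <-]|sz] := pselect (zeros s); first by eexists; exact: end_value_x_zeros.
  by eexists; exact: (end_value_out _ _ x_root sz).
have geny t : ~ E t -> end_value f0 (y_ t) (if `[< zeros t >] then 1 else 0 : R).
  move=> Et; case: asboolP => [[n _ tE]|tz].
    by rewrite -tE; apply/end_value_y_zeros/(@not_excluded_zeros n); rewrite tE.
  exact: (end_value_out _ _ y_root tz).
have [|c [cM Hc]] := @hom_of_relation R E (end_value f0) (@end_value_uniq R f0)
    (end_value1 R f0) (@end_valueM R f0) (@end_valueV R f0).
  by move=> g [[s _ <-]|[t Et <-]] //; eexists; exact: geny.
exists c; split=> // [n|s sz|t Et]; apply: end_value_uniq (Hc _) _.
- exact: end_value_x_zeros.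
- exact: (end_value_out _ _ x_root sz).
- exact: geny.
Qed.

(** The right end is the left end seen through the exchange of letters, which
    inverts x and y; hence the opposite signs. *)
Lemma right_hom : exists c : LM E -> R,
  [/\ {morph c : g h / (g * h)%g >-> g + h},
      forall g, end_value f1 (flip_conj (gen_val g)) (c g),
      forall n, c (x_gen E (nseq n true)) = if f1 then 0 else 1,
      forall s, ~ ones s -> c (x_gen E s) = 0 &
      forall t (Et : (~` E) t), c (y_gen Et) = if `[< ones t >] then - 1 else 0].
Proof.
pose Rel g (v : R) := end_value f1 (flip_conj g) v.
have xones n : Rel (x_ (nseq n true)) (if f1 then 0 else 1).
  have -> : (if f1 then 0 else 1 : R) = - (if f1 then 0 else - 1).
    by case: f1; rewrite ?oppr0 ?opprK.
  by rewrite /Rel flip_conj_x mirror_ones; exact/end_valueV/end_value_x_zeros.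
have out s h : ~ ones s -> Rel (below s h) 0.
  move=> sz; rewrite /Rel flip_conj_below.
  by apply: end_value_out => /zeros_mirror.
have genx s : exists v : R, Rel (x_ s) v.
  have [[n _ <-]|sz] := pselect (ones s); first by eexists; exact: xones.
  by eexists; exact: (out _ x_root sz).
have geny t : ~ E t -> Rel (y_ t) (if `[< ones t >] then - 1 else 0 : R).
  move=> Et; case: asboolP => [[n _ tE]|tz]; last exact: (out _ y_root tz).
  rewrite -tE /Rel flip_conj_y mirror_ones; apply/end_valueV/end_value_y_zeros.
  by apply: (@not_excluded_ones n); rewrite tE.
have [|||||c [cM Hc]] := @hom_of_relation R E Rel.
- by move=> g v w; exact: end_value_uniq.
- by rewrite /Rel flip_conj1; exact: end_value1.
- by move=> g h v w; rewrite /Rel flip_conjM; exact: end_valueM.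
- by move=> g v; rewrite /Rel flip_conjV; exact: end_valueV.
- by move=> g [[s _ <-]|[t Et <-]] //; eexists; exact: geny.
exists c; split=> // [n|s sz|t Et]; apply: end_value_uniq (Hc _) _.
- exact: xones.
- exact: (out _ x_root sz).
- exact: geny.
Qed.

(** The total jump.  It does not vanish at y_10 because the two ends of the
    cone of 10 are interior points where the jumps of y_10 add up. *)
Lemma interior_hom : exists c : LM E -> R,
  {morph c : g h / (g * h)%g >-> g + h} /\
  forall Et : (~` E) [:: true; false], c (y_gen Et) != 0.
Proof.
pose Rel g (v : R) := exists2 k : int, jump_sum g k & v = k%:~R.
have [|||||c [cM Hc]] := @hom_of_relation R E Rel.
- by move=> g v w [k gk ->] [l gl ->]; rewrite (jump_sum_uniq gk gl).
- by exists 0 => //; exact: jump_sum1.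
- move=> g h v w [k gk ->] [l hl ->]; exists (k + l); first exact: jump_sumM.
  by rewrite rmorphD.
- move=> g v [k gk ->]; exists (- k); first exact: jump_sumV.
  by rewrite rmorphN.
- move=> g [[s _ <-]|[t _ <-]]; first by exists 0, 0 => //; exact: jump_sum_x.
  by have [k [tk _]] := jump_sum_y t; exists k%:~R, k.
exists c; split=> // Et.
have [k [yk /(_ erefl) k0]] := jump_sum_y [:: true; false].
have [l yl ->] := Hc (y_gen Et).
by rewrite (jump_sum_uniq yl yk) intr_eq0.
Qed.

End Homs.

(** * Conjugates of x that double its translation length at an end *)

Lemma commute_conjV (gT : groupType) (g h k : gT) :
  (h * g = g * k)%g -> (g ^ h^-1 = g * (k * h^-1))%g.
Proof. by move=> E; rewrite conjgE invgK !mulgA E. Qed.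

(** Conjugation by y_00^-1 doubles the translation by which x acts at the left
    end, so it turns x into x x_0 there; the two factors in y are supported
    away from the end. *)
Lemma x_conj_y00 : (x_ [::] ^ (y_ [:: false; false])^-1 =
  x_ [::] * x_ [:: false] * (y_ [:: false; true; false])^-1 *
  y_ [:: false; true; true])%g.
Proof.
rewrite (commute_conjV (belowC y_root (@maps_x00 [::]))) -!mulgA; congr (_ * _)%g.
rewrite -y_below (y_rel [:: false]) /=.
rewrite -!mulgA; congr (_ * _)%g.
have c1 : commute (y_ [:: false; false])
    ((y_ [:: false; true; false])^-1 * y_ [:: false; true; true])%g.
  by apply: commuteM; [apply: commuteV|]; exact: (@below_commute _ _ y_root y_root).
by rewrite (mulgA (y_ [:: false; true; false])^-1%g) mulgA c1 -y_below mulgK.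
Qed.

(** Conjugation by y_11 turns x into x_1 x near the right end; the two factors
    in y are supported away from that end. *)
Lemma x_conj_y11 : (x_ [::] ^ y_ [:: true; true] =
  x_ [:: true] * y_ [:: true; false] * (y_ [:: true; true; false])^-1 * x_ [::])%g.
Proof.
have c1 : commute (y_ [:: true; true; true])
    (y_ [:: true; false] * (y_ [:: true; true; false])^-1)%g.
  by apply: commuteM; [|apply: commuteV]; exact: (@below_commute _ _ y_root y_root).
have c2 : (x_ [:: true] * y_ [:: true; true; true] = y_ [:: true; true] * x_ [:: true])%g.
  exact: esym (belowC y_root (@maps_x1 [:: true])).
rewrite conjgE -(belowC y_root (@maps_x1 [::])) mulgA; congr (_ * _)%g.
rewrite [below _ _](y_rel [:: true]) -(mulgA (x_ _)) -mulgA -c1.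
by rewrite [in LHS](mulgA (x_ _)) c2 -!mulgA mulKg.
Qed.

(** * The Lodha--Moore groups *)

Section LM.
Variables (R : realType) (f0 f1 : bool) (E : set word).
Hypothesis EP : ends_excluded f0 f1 E.

Local Notation X := (x_gen E).

(** Total in t, so that lists of generators do not carry proofs that their
    words are allowed. *)
Definition y_el (t : word) : LM E :=
  match pselect ((~` E) t) with left Et => y_gen Et | right _ => 1%g end.

Local Notation Y := y_el.

Lemma gen_val_inj : injective (@gen_val _ (LM_gens E)).
Proof. exact: val_inj. Qed.

Lemma gen_val_y t : ~ E t -> gen_val (Y t) = y_ t.
Proof. by move=> Et; rewrite /y_el; case: pselect. Qed.

Lemma y_genE t (Et : (~` E) t) : y_gen Et = Y t.
Proof. by apply: gen_val_inj; rewrite gen_val_y. Qed.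

Lemma gen_val_commute (g h : LM E) : commute (gen_val g) (gen_val h) -> commute g h.
Proof. by move=> gh; apply: gen_val_inj. Qed.

Lemma ncE t : nonconst t -> ~ E t. Proof. exact (@allowed_nonconst _ _ _ EP t). Qed.

(** The facts on generation above concern sets of bijections; this carries
    subgroups of the abstract group over to them. *)
Definition image_of (T : set (LM E)) : set biperm :=
  [set b | exists2 g, generated T g & gen_val g = b].

Lemma image_subgroup T : subgroup_set (image_of T).
Proof.
split=> [|g h [g' Tg <-] [h' Th <-]|g [g' Tg <-]].
- by exists 1%g => //; exact: gen_one.
- by exists (g' * h')%g => //; exact: gen_mul.
- by exists (g'^-1)%g => //; exact: gen_inv.
Qed.

Lemma image_ofP T g : image_of T (gen_val g) -> generated T g.
Proof. by move=> [h Th /gen_val_inj <-]. Qed.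

Lemma image_of_gen (T : set (LM E)) g b : T g -> gen_val g = b -> image_of T b.
Proof. by move=> Tg <-; exists g => //; exact: gen_in. Qed.

Lemma image_generates (T : set (LM E)) :
  image_of T (x_ [::]) -> image_of T (x_ [:: true]) ->
  image_of T (y_ [:: true; false]) ->
  (f0 -> image_of T (y_ [:: false])) -> (f1 -> image_of T (y_ [:: true])) ->
  generated T = [set: LM E].
Proof.
move=> Tx Tx1 Ty Ty0 Ty1; apply/seteqP; split=> // g _; apply: image_ofP.
have sub : LM_gens E `<=` image_of T by exact: (LM_gens_sub EP (image_subgroup T)).
exact/(generated_min (image_subgroup T) sub)/asboolP/gen_valP.
Qed.

Definition optional (f : bool) (g : LM E) : seq (LM E) := if f then [:: g] else [::].

(** A generating list in which the element g stands for x: either x itself, or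
    the element x x_1^-1, from which x is recovered with the help of x_1. *)
Definition LM_list (g : LM E) : seq (LM E) :=
  [:: g; X [:: true]; Y [:: true; false]] ++
  optional f0 (Y [:: false]) ++ optional f1 (Y [:: true]).

Lemma in_optional f (g h : LM E) : h \in optional f g -> f /\ h = g.
Proof. by case: f => //=; rewrite inE => /eqP. Qed.

Lemma optional_in (f : bool) (g : LM E) : f -> g \in optional f g.
Proof. by move=> -> /=; rewrite inE. Qed.

Let nz10 : ~ E [:: true; false]. Proof. exact: ncE. Qed.
Let nz110 : ~ E [:: true; true; false]. Proof. exact: ncE. Qed.
Let nz0 : f0 -> ~ E [:: false]. Proof. exact (@allowed_zeros _ _ _ EP 0). Qed.
Let nz00 : f0 -> ~ E [:: false; false]. Proof. exact (@allowed_zeros _ _ _ EP 1). Qed.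
Let nz1 : f1 -> ~ E [:: true]. Proof. exact (@allowed_ones _ _ _ EP 0). Qed.
Let nz11 : f1 -> ~ E [:: true; true]. Proof. exact (@allowed_ones _ _ _ EP 1). Qed.

Lemma LM_list_generates (T : seq (LM E)) :
  {subset LM_list (X [::]) <= T} -> generated [set` T] = [set: LM E].
Proof.
move=> sT; have inT g b : g \in LM_list (X [::]) -> gen_val g = b -> image_of [set` T] b.
  by move=> /sT gT; exact: image_of_gen.
apply: image_generates.
- by apply: (inT (X [::])); rewrite // mem_head.
- by apply: (inT (X [:: true])); rewrite // !inE eqxx orbT.
- by apply: (inT (Y [:: true; false])); rewrite ?gen_val_y // !inE eqxx !orbT.
- move=> h0; apply: (inT (Y [:: false])); last exact/gen_val_y/nz0.
  by rewrite !mem_cat optional_in ?orbT.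
- move=> h1; apply: (inT (Y [:: true])); last exact/gen_val_y/nz1.
  by rewrite !mem_cat optional_in ?orbT.
Qed.

Lemma LM_finitely_generated : finitely_generated (LM E).
Proof.
by exists [set` LM_list (X [::])]; split; [exact: finite_seq|exact: LM_list_generates].
Qed.

(** The values of a character at the next three elements determine it. *)
Definition end_gen0 : LM E := if f0 then Y [:: false] else X [:: false].
Definition end_gen1 : LM E := if f1 then Y [:: true] else X [:: true].
Definition mid_gen : LM E := Y [:: true; false].

Local Notation end0 := end_gen0.
Local Notation end1 := end_gen1.
Local Notation middle := mid_gen.

Section Character.
Variable c : LM E -> R.
Hypothesis cM : {morph c : g h / (g * h)%g >-> g + h}.

(** Characters are constant on conjugacy classes, and copies of f on two cones
    of one orbit are conjugate. *)
Lemma char_belowJ s t f (g gs gt : LM E) : maps (gen_val g) s t ->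
  gen_val gs = below s f -> gen_val gt = below t f -> c gs = c gt.
Proof.
move=> m Es Et; rewrite -(chiJ cM gs g); congr c; apply: gen_val_inj.
by rewrite Et -(belowJ f m) -Es.
Qed.

Lemma char_x_root : c (X [::]) = c (X [:: false]) + c (X [:: true]).
Proof.
have : (X [::] * X [::] = X [:: false] * X [::] * X [:: true])%g.
  by apply: gen_val_inj; exact: (x_rel [::]).
by move/(congr1 c); rewrite !cM addrAC => /addIr.
Qed.

Lemma char_x11 : c (X [:: true; true]) = c (X [:: true]).
Proof. by apply/esym/(@char_belowJ _ _ x_root (X [::])); first exact: (@maps_x1 [::]). Qed.

Lemma char_y11 : f1 -> c (Y [:: true; true]) = c (Y [:: true]).
Proof.
move=> h1; apply/esym/(@char_belowJ _ _ y_root (X [::])); first exact: (@maps_x1 [::]).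
  exact/gen_val_y/nz1.
exact/gen_val_y/nz11.
Qed.

Lemma char_y00 : f0 -> c (Y [:: false; false]) = c (Y [:: false]).
Proof.
move=> h0; apply: (@char_belowJ _ _ y_root (X [::])); first exact: (@maps_x00 [::]).
  exact/gen_val_y/nz00.
exact/gen_val_y/nz0.
Qed.

Lemma nonconst_maps s : nonconst s ->
  exists g : LM E, maps (gen_val g) s [:: true; false].
Proof.
have sub : subgroup_set [set b | exists g : LM E, gen_val g = b].
  split=> [|g h [g' <-] [h' <-]|g [g' <-]]; first by exists 1%g.
    by exists (g' * h')%g.
  by exists g'^-1%g.
move=> ns; have [||g [[h <-] m]] := @nonconst_transitive _ [::] sub _ _ s ns.
- by exists (X [::]).
- by exists (X [:: true]).
- by exists h.
Qed.

Lemma char_nonconst s : nonconst s -> c (Y s) = c middle.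
Proof.
move=> ns; have [g m] := nonconst_maps ns.
by apply: (char_belowJ (f := y_root) m); apply: gen_val_y => //; exact: ncE.
Qed.

Lemma char_nonconst_x s : nonconst s -> c (X s) = 0.
Proof.
move=> ns; have [g m] := nonconst_maps ns.
have -> : c (X s) = c (X [:: true; false]) by exact: (char_belowJ (f := x_root) m).
have : (X [:: true] * X [:: true] =
    X [:: true; false] * X [:: true] * X [:: true; true])%g.
  by apply: gen_val_inj; exact: (x_rel [:: true]).
by move/(congr1 c); rewrite !cM char_x11; lra.
Qed.

(** The conjugate of x that doubles its translation length has the value of x,
    and the two copies of y in it have opposite contributions. *)
Lemma char_x0 : f0 -> c (X [:: false]) = 0.
Proof.
move=> h0; have : (X [::] ^ (Y [:: false; false])^-1 = X [::] * X [:: false] *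
    (Y [:: false; true; false])^-1 * Y [:: false; true; true])%g.
  apply: gen_val_inj; have := x_conj_y00.
  by rewrite !conjgE /= !gen_val_y //; [exact: ncE|exact: ncE|exact: nz00].
move/(congr1 c); rewrite (chiJ cM) !cM (chiV cM) !char_nonconst //.
lra.
Qed.

Lemma char_x1 : f1 -> c (X [:: true]) = 0.
Proof.
move=> h1; have : (X [::] ^ Y [:: true; true] = X [:: true] * Y [:: true; false] *
    (Y [:: true; true; false])^-1 * X [::])%g.
  apply: gen_val_inj; have := x_conj_y11.
  by rewrite !conjgE /= !gen_val_y //; exact: nz11.
move/(congr1 c); rewrite (chiJ cM) !cM (chiV cM) !char_nonconst //.
lra.
Qed.

Lemma char_eq0 : c end0 = 0 -> c end1 = 0 -> c middle = 0 -> forall g, c g = 0.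
Proof.
move=> c0 c1 cm g.
have x0 : c (X [:: false]) = 0.
  by case h0 : f0; [exact: char_x0|move: c0; rewrite /end_gen0 h0].
have x1 : c (X [:: true]) = 0.
  by case h1 : f1; [exact: char_x1|move: c1; rewrite /end_gen1 h1].
have sub : subgroup_set [set g | c g = 0].
  split=> /= [|h k h0 k0|h h0]; first exact: chi1.
    by rewrite cM h0 k0 addr0.
  by rewrite (chiV cM) h0 oppr0.
have : generated [set` LM_list (X [::])] g by rewrite LM_list_generates.
apply: (generated_min sub) => h /=; rewrite !inE !mem_cat.
move=> /or4P[/eqP->|/eqP->|/eqP->|/orP[]] //.
- by rewrite char_x_root x0 x1 addr0.
- by move=> /in_optional[h0 ->]; move: c0; rewrite /end_gen0 h0.
- by move=> /in_optional[h1 ->]; move: c1; rewrite /end_gen1 h1.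
Qed.
End Character.

Lemma char_eq (c d : LM E -> R) :
  {morph c : g h / (g * h)%g >-> g + h} -> {morph d : g h / (g * h)%g >-> g + h} ->
  c end0 = d end0 -> c end1 = d end1 -> c middle = d middle -> c =1 d.
Proof.
move=> cM dM e0 e1 em g; apply/eqP; rewrite -subr_eq0; apply/eqP.
apply: (@char_eq0 (fun g => c g - d g)) => [h k|||]; rewrite ?e0 ?e1 ?em ?subrr //.
by rewrite cM dM opprD addrACA.
Qed.
End LM.

Section Connectivity.
Variables (R : realType) (f0 f1 : bool) (E : set word).
Hypothesis EP : ends_excluded f0 f1 E.
Variables (S : set (LM E)) (c : LM E -> R).
Hypotheses (genS : generates S) (cM : {morph c : g h / (g * h)%g >-> g + h}).
Hypothesis c_neq0 : exists g, c g != 0.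

Local Notation X := (x_gen E).
Local Notation Y := (y_el E).
Local Notation end0 := (end_gen0 f0 E).
Local Notation end1 := (end_gen1 f1 E).
Local Notation middle := (mid_gen E).

(** No proper cone is fixed by x, but this element fixes the cone of 11
    pointwise, hence commutes with everything supported there. *)
Let u : LM E := (X [::] * (X [:: true])^-1)%g.

Lemma commute_u f (g : LM E) : gen_val g = below [:: true; true] f -> commute u g.
Proof.
move=> gE; apply/gen_val_commute; rewrite gE.
have m : maps (gen_val u) [:: true; true] [:: true; true].
  apply: (@mapsM _ _ _ [:: true; true; true]).
    exact: (maps_cat [:: true] (@maps_x1 [::])).
  by apply/mapsV; exact: (@maps_x1 [:: true]).
exact: (commute_sym (belowC f m)).
Qed.

Lemma local_list_generates :
  generated [set` LM_list f0 f1 u] = [set: LM E].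
Proof.
apply: (generated_setT (LM_list_generates EP (fun g => id))) => g /=.
rewrite /LM_list inE => /predU1P[->|gT]; last by apply: gen_in; rewrite /= inE gT orbT.
have -> : X [::] = (u * X [:: true])%g by rewrite /u mulgVK.
by apply: gen_mul; apply: gen_in; rewrite /= !inE eqxx ?orbT.
Qed.

Lemma commute_incomparable s t f h (g k : LM E) : incomparable s t ->
  gen_val g = below s f -> gen_val k = below t h -> commute g k.
Proof. by move=> st gE kE; apply/gen_val_commute; rewrite gE kE; exact: below_commute. Qed.

Let nc t : nonconst t -> gen_val (Y t) = below t y_root.
Proof. by move=> nt; apply/gen_val_y/(allowed_nonconst EP). Qed.
Let gX s : gen_val (X s) = below s x_root. Proof. by []. Qed.
Let gY0 : f0 -> gen_val (Y [:: false]) = below [:: false] y_root.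
Proof. by move=> h; apply/gen_val_y; exact: (@allowed_zeros _ _ _ EP 0). Qed.
Let gY1 : f1 -> gen_val (Y [:: true]) = below [:: true] y_root.
Proof. by move=> h; apply/gen_val_y; exact: (@allowed_ones _ _ _ EP 0). Qed.
Let gY00 : f0 -> gen_val (Y [:: false; false]) = below [:: false; false] y_root.
Proof. by move=> h; apply/gen_val_y; exact: (@allowed_zeros _ _ _ EP 1). Qed.
Let gY11 : f1 -> gen_val (Y [:: true; true]) = below [:: true; true] y_root.
Proof. by move=> h; apply/gen_val_y; exact: (@allowed_ones _ _ _ EP 1). Qed.

Lemma in_LM_list (P : LM E -> Prop) g0 : P g0 -> P (X [:: true]) -> P (Y [:: true; false]) ->
  (f0 -> P (Y [:: false])) -> (f1 -> P (Y [:: true])) ->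
  forall g, g \in LM_list f0 f1 g0 -> P g.
Proof.
move=> Pg P1 P10 P0 P1' g; rewrite !inE !mem_cat.
move=> /or4P[/eqP->|/eqP->|/eqP->|/orP[]] //.
  by move=> /in_optional[h0 ->]; exact: P0.
by move=> /in_optional[h0 ->]; exact: P1'.
Qed.

Let connected := full_subgraph_connected (cayley S) [set g | 0 <= c g].

(** The cones of 01, of 10 and of 110 leave enough room: y_01 commutes with
    y_10 and y_110, and every generator in the list commutes with one of the
    three. *)
Lemma connected_middle : c middle != 0 -> connected.
Proof.
move=> cm; pose a := Y [:: false; true]; pose b := Y [:: true; true; false].
have ca : c a = c middle by exact: (char_nonconst EP cM).
have cb : c b = c middle by exact: (char_nonconst EP cM).
apply: (connected_of_commuting cM genS c_neq0 (T := LM_list f0 f1 u)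
  (B := [:: a; b; middle]) (a := a)); rewrite ?ca //.
- exact: local_list_generates.
- move=> d; rewrite !inE => /or3P[]/eqP->; rewrite ?ca ?cb; split=> //.
    exact: (commute_incomparable (s := [:: false; true]) (t := [:: true; true; false]) _ (nc _) (nc _)).
  exact: (commute_incomparable (s := [:: false; true]) (t := [:: true; false]) _ (nc _) (nc _)).
apply: in_LM_list.
- exists b; first by rewrite !inE eqxx ?orbT.
  by apply: (commute_u (f := below [:: false] y_root)); rewrite nc // -below_cat.
- exists a; first by rewrite !inE eqxx ?orbT.
  exact: (commute_incomparable (s := [:: true]) (t := [:: false; true]) _ (gX _) (nc _)).
- exists a; first by rewrite !inE eqxx ?orbT.
  exact: (commute_incomparable (s := [:: true; false]) (t := [:: false; true]) _ (nc _) (nc _)).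
- move=> h0; exists middle; first by rewrite !inE eqxx ?orbT.
  exact: (commute_incomparable (s := [:: false]) (t := [:: true; false]) _ (gY0 h0) (nc _)).
- move=> h1; exists a; first by rewrite !inE eqxx ?orbT.
  exact: (commute_incomparable (s := [:: true]) (t := [:: false; true]) _ (gY1 h1) (nc _)).
Qed.

Let gend0 : exists f, gen_val end0 = below [:: false] f.
Proof. by rewrite /end_gen0; case h : f0; [exists y_root; exact: gY0|exists x_root]. Qed.
Let gend1 : exists f, gen_val end1 = below [:: true] f.
Proof. by rewrite /end_gen1; case h : f1; [exists y_root; exact: gY1|exists x_root]. Qed.

(** The two end elements have disjoint supports, and every generator in the
    list fixes the cone of 0, of 1 or of 11 pointwise. *)
Lemma connected_ends : c end0 != 0 -> c end1 != 0 -> connected.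
Proof.
move=> c0 c1; have [e0 gE0] := gend0; have [e1 gE1] := gend1.
pose b := if f1 then Y [:: true; true] else X [:: true; true].
have cb : c b = c end1.
  by rewrite /b /end_gen1; case h1 : f1; [exact: (char_y11 EP cM)|exact: char_x11].
have [e gb] : exists f, gen_val b = below [:: true; true] f.
  by rewrite /b; case h : f1; [exists y_root; exact: gY11|exists x_root].
apply: (connected_of_commuting cM genS c_neq0 (T := LM_list f0 f1 u)
  (B := [:: end0; end1; b]) (a := end0)) => //.
- exact: local_list_generates.
- move=> d; rewrite !inE => /or3P[]/eqP->; rewrite ?cb; split=> //.
    exact: (commute_incomparable (s := [:: false]) (t := [:: true]) _ gE0 gE1).
  exact: (commute_incomparable (s := [:: false]) (t := [:: true; true]) _ gE0 gb).
apply: in_LM_list.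
- exists b; first by rewrite !inE eqxx ?orbT.
  exact: commute_u gb.
- exists end0; first by rewrite !inE eqxx ?orbT.
  exact: (commute_incomparable (s := [:: true]) (t := [:: false]) _ (gX _) gE0).
- exists end0; first by rewrite !inE eqxx ?orbT.
  exact: (commute_incomparable (s := [:: true; false]) (t := [:: false]) _ (nc _) gE0).
- move=> h0; exists end1; first by rewrite !inE eqxx ?orbT.
  exact: (commute_incomparable (s := [:: false]) (t := [:: true]) _ (gY0 h0) gE1).
- move=> h1; exists end0; first by rewrite !inE eqxx ?orbT.
  exact: (commute_incomparable (s := [:: true]) (t := [:: false]) _ (gY1 h1) gE0).
Qed.

Section Span.
Variables (T0 : seq (LM E)) (p : word).
Let N := image_of [set` T0].
Hypotheses (Np : N (x_ p)) (Np1 : N (x_ (p ++ [:: true]))).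

Lemma span_x s : N (x_ (p ++ s)).
Proof. exact: gen_x (image_subgroup _) Np Np1 s. Qed.

Lemma span_y s : N (y_ (p ++ [:: true; false])) -> nonconst s -> N (y_ (p ++ s)).
Proof. by move=> ny ns; exact: (@gen_nonconst _ p (image_subgroup _) Np Np1 y_root s ns). Qed.

Lemma span_y0 n : N (y_ (p ++ [:: false])) -> N (y_ (p ++ nseq n.+1 false)).
Proof. exact: (@gen_zeros _ p (image_subgroup _) Np y_root n). Qed.

Lemma span_y1 n : N (y_ (p ++ [:: true])) -> N (y_ (p ++ nseq n.+1 true)).
Proof. exact: (@gen_ones _ p (image_subgroup _) Np y_root n). Qed.
End Span.

Lemma in_span (T0 : seq (LM E)) g b : g \in T0 -> gen_val g = b -> image_of [set` T0] b.
Proof. by move=> gT; exact: image_of_gen. Qed.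

Lemma span_subset (T0 T : seq (LM E)) b : {subset T0 <= T} ->
  image_of [set` T0] b -> image_of [set` T] b.
Proof.
move=> sT [g Tg <-]; exists g => //.
by apply: (generated_min (generated_subgroup _)) Tg => h /= /sT; exact: gen_in.
Qed.

Let gen_conj (T0 : seq (LM E)) (b t : LM E) :
  image_of [set` T0] (gen_val b ^ gen_val t)%g -> generated [set` T0] (b ^ t)%g.
Proof. by move=> h; apply: image_ofP. Qed.

Let c_x0_end : c end0 = 0 -> c (X [:: false]) = 0.
Proof. by rewrite /end_gen0; case h : f0 => // _; exact: (char_x0 EP cM). Qed.
Let c_x1_end : c end1 = 0 -> c (X [:: true]) = 0.
Proof. by rewrite /end_gen1; case h : f1 => // _; exact: (char_x1 EP cM). Qed.
Let c_middle s : nonconst s -> c (Y s) = c middle.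
Proof. exact: (char_nonconst EP cM). Qed.

Let mapsVx00 s : maps (x_ [::])^-1%g (false :: s) [:: false, false & s].
Proof. exact/mapsV/(maps_cat s (@maps_x00 [::])). Qed.
Let mapsx1 s : maps (x_ [::]) (true :: s) [:: true, true & s].
Proof. exact: (maps_cat s (@maps_x1 [::])). Qed.

Ltac in_list := rewrite ?mem_cat ?inE ?eqxx ?orbT //.

(** The stable letter y_00^-1 doubles the translation of x and commutes with the
    other elements of T0. *)
Lemma connected_left_y : f0 -> c middle = 0 -> c end1 = 0 -> c end0 < 0 -> connected.
Proof.
move=> h0 cm c1 c0.
pose T0 := [:: X [::]; X [:: true]; middle] ++ optional f1 (Y [:: true]).
pose t := ((Y [:: false; false])^-1)%g.
have Tx : image_of [set` T0] (x_ [::]) by apply: (in_span (g := X [::])); in_list.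
have Tx1 : image_of [set` T0] (x_ [:: true]) by apply: (in_span (g := X [:: true])); in_list.
have Ty : image_of [set` T0] (y_ [:: true; false]).
  by apply: (in_span (g := middle)); [in_list|exact: nc].
have Ty1 : f1 -> image_of [set` T0] (y_ [:: true]).
  move=> h1; apply: (in_span (g := Y [:: true])); last exact: gY1.
  by rewrite mem_cat optional_in ?orbT.
have sub : {subset T0 <= t :: T0} by move=> g gT; rewrite inE gT orbT.
apply: (connected_of_ascending cM genS c_neq0 (T0 := T0) (t := t)).
- apply: (image_generates EP); do ?[exact: (span_subset sub)].
    move=> _; have ty : image_of [set` t :: T0] (y_ [:: false; false])^-1%g.
      by apply: (in_span (g := t)); rewrite ?mem_head //= gY00.
    have NS := image_subgroup [set` t :: T0]; have [_ _ NV] := NS.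
    have := NV _ ty; rewrite invgK => ty00.
    rewrite -[y_ _](belowJ y_root (@maps_x00 [::])); apply: conj_closed => //.
    exact: (span_subset sub).
  by move=> h1; exact/(span_subset sub)/Ty1.
- by rewrite (chiV cM) (char_y00 EP cM h0) oppr_gt0; move: c0; rewrite /end_gen0 h0.
- move=> b; rewrite mem_cat !inE => /orP[/or3P[]/eqP-> //|/in_optional[h1 ->]].
  + by rewrite (char_x_root cM) (char_x0 EP cM h0) (c_x1_end c1) addr0.
  + exact: c_x1_end.
  + by move: c1; rewrite /end_gen1 h1.
- have com f s (b : LM E) : b \in T0 -> incomparable s [:: false; false] ->
      gen_val b = below s f -> generated [set` T0] (b ^ t)%g.
    move=> bT inc bE; have cb : commute b t.
      by apply: commuteV; exact: (commute_incomparable inc bE (gY00 h0)).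
    by rewrite conjgE cb mulKg; exact: gen_in.
  move=> b bT; move: (bT); rewrite mem_cat !inE => /orP[/or3P[]/eqP bE|/in_optional[h1 bE]].
  + apply: gen_conj; rewrite bE /t /= gY00 // -/(y_ _) [X in image_of _ X]x_conj_y00.
    have [_ NM NV] := image_subgroup [set` T0].
    apply: (NM); last exact: (span_y Tx Tx1 (s := [:: false; true; true]) Ty).
    apply: (NM); last exact/NV/(span_y Tx Tx1 (s := [:: false; true; false]) Ty).
    by apply: (NM) => //; exact: (span_x Tx Tx1 [:: false]).
  + by apply: (com x_root [:: true]); rewrite // bE.
  + by apply: (com y_root [:: true; false]); rewrite // bE; exact: nc.
  + by apply: (com y_root [:: true]); rewrite // bE; exact: gY1.
Qed.

(** The stable letter x pushes the cone of 1, which supports T0, into the cone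
    of 11. *)
Lemma connected_left_x : ~~ f0 -> c middle = 0 -> c end1 = 0 -> 0 < c end0 -> connected.
Proof.
move=> /negbTE h0 cm c1 c0.
pose T0 := [:: X [:: true]; X [:: true; true]; Y [:: true; true; false]; middle] ++
  optional f1 (Y [:: true; true]).
pose t := X [::].
have Tx1 : image_of [set` T0] (x_ [:: true]) by apply: (in_span (g := X [:: true])); in_list.
have Tx11 : image_of [set` T0] (x_ [:: true; true]).
  by apply: (in_span (g := X [:: true; true])); in_list.
have Ty110 : image_of [set` T0] (y_ [:: true; true; false]).
  by apply: (in_span (g := Y [:: true; true; false])); [in_list|exact: nc].
have Ty : image_of [set` T0] (y_ [:: true; false]).
  by apply: (in_span (g := middle)); [in_list|exact: nc].
have Ty11 : f1 -> image_of [set` T0] (y_ [:: true; true]).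
  move=> h1; apply: (in_span (g := Y [:: true; true])); last exact: gY11.
  by rewrite mem_cat optional_in ?orbT.
have sub : {subset T0 <= t :: T0} by move=> g gT; rewrite inE gT orbT.
have xT : image_of [set` t :: T0] (x_ [::]).
  by apply: (in_span (g := t)); rewrite ?mem_head.
apply: (connected_of_ascending cM genS c_neq0 (T0 := T0) (t := t)).
- apply: (image_generates EP) => //; do ?[exact: (span_subset sub)]; first by rewrite h0.
  move=> h1; apply: (conj_closedV (image_subgroup _) (belowJ y_root (mapsx1 [::])) xT).
  exact/(span_subset sub)/Ty11.
- by rewrite (char_x_root cM) (c_x1_end c1) addr0; move: c0; rewrite /end_gen0 h0.
- move=> b; rewrite mem_cat !inE => /orP[/or4P[]/eqP-> //|/in_optional[h1 ->]].
  + exact: c_x1_end.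
  + by rewrite (char_x11 cM) c_x1_end.
  + by rewrite c_middle.
  + by rewrite (char_y11 EP cM) //; move: c1; rewrite /end_gen1 h1.
- have step f s (b : LM E) : gen_val b = below (true :: s) f ->
      image_of [set` T0] (below [:: true, true & s] f) -> generated [set` T0] (b ^ t)%g.
    move=> bE fT; apply: gen_conj; rewrite bE [X in image_of _ X](belowJ f (mapsx1 s)) //.
  move=> b; rewrite mem_cat !inE => /orP[/or4P[]/eqP->|/in_optional[h1 ->]].
  + exact: (step x_root [::]).
  + by apply: (step x_root [:: true]) => //; exact: (span_x Tx1 Tx11 [:: true; true]).
  + apply: (step y_root [:: true; false]); first exact: nc.
    exact: (span_y Tx1 Tx11 (s := [:: true; true; false]) Ty110).
  + by apply: (step y_root [:: false]); first exact: nc.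
  + apply: (step y_root [:: true]); first exact: gY11.
    exact: (span_y1 Tx1 1 (Ty11 h1)).
Qed.

(** The stable letter y_11 conjugates x into the span of T0 and commutes with
    the other elements of T0. *)
Lemma connected_right_y : f1 -> c middle = 0 -> c end0 = 0 -> 0 < c end1 -> connected.
Proof.
move=> h1 cm c0 c1.
pose T0 := [:: X [::]; X [:: false]; middle] ++ optional f0 (Y [:: false]).
pose t := Y [:: true; true].
have Tx : image_of [set` T0] (x_ [::]) by apply: (in_span (g := X [::])); in_list.
have Tx0 : image_of [set` T0] (x_ [:: false]) by apply: (in_span (g := X [:: false])); in_list.
have [_ NM NV] := image_subgroup [set` T0].
have Tx1 : image_of [set` T0] (x_ [:: true]).
  have -> : x_ [:: true] = ((x_ [::])^-1 * (x_ [:: false])^-1 * (x_ [::] * x_ [::]))%g.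
    by rewrite (x_rel [::]) -!mulgA mulKg mulKg.
  by apply: (NM); [apply: (NM); exact: NV|exact: NM].
have Ty : image_of [set` T0] (y_ [:: true; false]).
  by apply: (in_span (g := middle)); [in_list|exact: nc].
have Ty0 : f0 -> image_of [set` T0] (y_ [:: false]).
  move=> h0; apply: (in_span (g := Y [:: false])); last exact: gY0.
  by rewrite mem_cat optional_in ?orbT.
have sub : {subset T0 <= t :: T0} by move=> g gT; rewrite inE gT orbT.
apply: (connected_of_ascending cM genS c_neq0 (T0 := T0) (t := t)).
- apply: (image_generates EP); do ?[exact: (span_subset sub)].
    by move=> h0; exact/(span_subset sub)/Ty0.
  move=> _; apply: (conj_closedV (image_subgroup _) (belowJ y_root (mapsx1 [::]))).
    exact: (span_subset sub).
  by apply: (in_span (g := t)); rewrite ?mem_head //= gY11.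
- by rewrite (char_y11 EP cM h1); move: c1; rewrite /end_gen1 h1.
- move=> b; rewrite mem_cat !inE => /orP[/or3P[]/eqP-> //|/in_optional[h0 ->]].
  + by rewrite (char_x_root cM) (char_x1 EP cM h1) (c_x0_end c0) addr0.
  + exact: c_x0_end.
  + by move: c0; rewrite /end_gen0 h0.
- have com f s (b : LM E) : b \in T0 -> incomparable s [:: true; true] ->
      gen_val b = below s f -> generated [set` T0] (b ^ t)%g.
    move=> bT inc bE; have cb : commute b t.
      exact: (commute_incomparable inc bE (gY11 h1)).
    by rewrite conjgE cb mulKg; exact: gen_in.
  move=> b bT; move: (bT); rewrite mem_cat !inE => /orP[/or3P[]/eqP bE|/in_optional[h0 bE]].
  + apply: gen_conj; rewrite bE /t /= gY11 // -/(y_ _) [X in image_of _ X]x_conj_y11.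
    apply: (NM) => //; apply: (NM); first exact: NM.
    exact/NV/(span_y Tx Tx1 (s := [:: true; true; false]) Ty).
  + by apply: (com x_root [:: false]); rewrite // bE.
  + by apply: (com y_root [:: true; false]); rewrite // bE; exact: nc.
  + by apply: (com y_root [:: false]); rewrite // bE; exact: gY0.
Qed.

(** The stable letter x^-1 pushes the cone of 0, which supports T0, into the
    cone of 00. *)
Lemma connected_right_x : ~~ f1 -> c middle = 0 -> c end0 = 0 -> c end1 < 0 -> connected.
Proof.
move=> /negbTE h1 cm c0 c1.
pose T0 := [:: X [:: false]; X [:: false; true]; Y [:: false; true; false];
  Y [:: false; true]] ++ optional f0 (Y [:: false; false]).
pose t := ((X [::])^-1)%g.
have Tx0 : image_of [set` T0] (x_ [:: false]) by apply: (in_span (g := X [:: false])); in_list.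
have Tx01 : image_of [set` T0] (x_ [:: false; true]).
  by apply: (in_span (g := X [:: false; true])); in_list.
have Ty010 : image_of [set` T0] (y_ [:: false; true; false]).
  by apply: (in_span (g := Y [:: false; true; false])); [in_list|exact: nc].
have Ty01 : image_of [set` T0] (y_ [:: false; true]).
  by apply: (in_span (g := Y [:: false; true])); [in_list|exact: nc].
have Ty00 : f0 -> image_of [set` T0] (y_ [:: false; false]).
  move=> h0; apply: (in_span (g := Y [:: false; false])); last exact: gY00.
  by rewrite mem_cat optional_in ?orbT.
have sub : {subset T0 <= t :: T0} by move=> g gT; rewrite inE gT orbT.
have NS := image_subgroup [set` t :: T0]; have [_ NM NV] := NS.
have xT : image_of [set` t :: T0] (x_ [::]).
  rewrite -[x_ [::]]invgK; apply: NV.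
  by apply: (in_span (g := t)); rewrite ?mem_head.
have x0T := span_subset sub Tx0.
apply: (connected_of_ascending cM genS c_neq0 (T0 := T0) (t := t)).
- apply: (image_generates EP) => //.
  + have -> : x_ [:: true] = ((x_ [::])^-1 * (x_ [:: false])^-1 * (x_ [::] * x_ [::]))%g.
      by rewrite (x_rel [::]) -!mulgA mulKg mulKg.
    by apply: (NM); [apply: (NM); exact: NV|exact: NM].
  + rewrite -[y_ _](belowJ y_root (@maps_x01 [::])); apply: conj_closed => //.
    exact: (span_subset sub).
  + move=> h0; rewrite -[y_ _](belowJ y_root (@maps_x00 [::])); apply: conj_closed => //.
    exact/(span_subset sub)/Ty00.
  + by rewrite h1.
- by rewrite (chiV cM) (char_x_root cM) (c_x0_end c0) add0r oppr_gt0; move: c1; rewrite /end_gen1 h1.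
- move=> b; rewrite mem_cat !inE => /orP[/or4P[]/eqP-> //|/in_optional[h0 ->]].
  + exact: c_x0_end.
  + exact: (char_nonconst_x cM).
  + by rewrite c_middle.
  + by rewrite c_middle.
  + by rewrite (char_y00 EP cM) //; move: c0; rewrite /end_gen0 h0.
- have step f s (b : LM E) : gen_val b = below (false :: s) f ->
      image_of [set` T0] (below [:: false, false & s] f) -> generated [set` T0] (b ^ t)%g.
    move=> bE fT; apply: gen_conj; rewrite bE [X in image_of _ X](belowJ f (mapsVx00 s)) //.
  move=> b; rewrite mem_cat !inE => /orP[/or4P[]/eqP->|/in_optional[h0 ->]].
  + by apply: (step x_root [::]) => //; exact: (span_x Tx0 Tx01 [:: false]).
  + by apply: (step x_root [:: true]) => //; exact: (span_x Tx0 Tx01 [:: false; true]).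
  + apply: (step y_root [:: true; false]); first exact: nc.
    exact: (span_y Tx0 Tx01 (s := [:: false; true; false]) Ty010).
  + apply: (step y_root [:: true]); first exact: nc.
    exact: (span_y Tx0 Tx01 (s := [:: false; true]) Ty010).
  + apply: (step y_root [:: false]); first exact: gY00.
    exact: (span_y0 Tx0 1 (Ty00 h0)).
Qed.

End Connectivity.

(** * Half-spaces that are not connected *)

Section Disconnected.
Variables (R : realType) (H : groupType) (S : set H) (chi : H -> R).
Variable theta : H -> biperm.
Hypotheses (finS : finite_set S) (chiM : {morph chi : g h / (g * h)%g >-> g + h}).
Hypothesis thetaM : {morph theta : g h / (g * h)%g >-> (g * h)%g}.

Let theta1 : theta 1%g = 1%g.
Proof. by apply: (mulgI (theta 1%g)); rewrite -thetaM !mulg1. Qed.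

Let thetaV g : theta g^-1%g = (theta g)^-1%g.
Proof. by apply: (mulgI (theta g)); rewrite -thetaM !mulgV. Qed.

(** Closed sets indexed by a directed set, each element lying in all of them
    from some index on: one of the sets then contains the finitely many
    generators, hence everything reachable. *)
Lemma reach_in_directed (I : Type) (le : I -> I -> Prop) (i0 : I) (M : I -> set H) :
  (forall i j, exists k, le i k /\ le j k) ->
  (forall i j k, le i j -> le j k -> le i k) ->
  (forall h, 0 <= chi h -> exists i, forall j, le i j -> M j h) ->
  (forall i, quot_closed chi (M i)) ->
  full_subgraph_connected (cayley S) [set g | 0 <= chi g] ->
  exists i, forall g, 0 <= chi g -> M i g.
Proof.
move=> dir trans ev MC con.
have [s SE] : exists s : seq H, S = [set` s] by exact/finite_seqP.
have [i Mi] : exists i, forall j, le i j -> forall h, h \in s ->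
    (0 <= chi h -> M j h) /\ (chi h <= 0 -> M j h^-1%g).
  elim: s {SE} => [|h s [i Mi]]; first by exists i0.
  have ev' (k : H) : exists i, forall j, le i j -> 0 <= chi k -> M j k.
    have [k0|k0] := leP 0 (chi k); last by exists i0.
    by have [l Ml] := ev k k0; exists l => j /Ml.
  have [j Mj] := ev' h; have [k Mk] := ev' h^-1%g.
  have [l [il jl]] := dir i j; have [m [lm km]] := dir l k.
  exists m => n mn g; rewrite inE => /predU1P[->|gs].
    split; first by apply: Mj; apply: trans jl (trans _ _ _ lm mn).
    by move=> h0; apply: Mk; [exact: trans km mn|rewrite chiV // oppr_ge0].
  by apply: Mi gs; apply: trans il (trans _ _ _ lm mn).
have [j [ij _]] := dir i i.
exists j => g g0; apply: (@reach_min _ _ _ chiM S (M j)) => //.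
- by rewrite SE => h /= hs h0; have [] := Mi j ij h hs; auto.
- by rewrite SE => h /= hs h0; have [] := Mi j ij h hs; auto.
- by have /(connected_reach chiM S) := con; exact.
Qed.

(** Closed sets: the elements acting on all z >= n + 1 as a translation of
    nonnegative length.  An element with trivial germ that moves points beyond
    n + 1 lies outside, and x at the word 0^(n+1) 1 is one. *)
Lemma disconnected_translation :
  (forall g, end_value false (theta g) (chi g)) ->
  (forall n, exists g, theta g = x_ (rcons (nseq n false) true)) ->
  ~ full_subgraph_connected (cayley S) [set g | 0 <= chi g].
Proof.
move=> val wit con.
pose M (n : nat) : set H := [set g | exists b : rat, [/\ 0 <= b, chi g = ratr b &
  forall s, n.+1%:R <= sbcoord s -> exists t, theta g (dyadic s) = dyadic t /\ sbcoord t = sbcoord s + b]].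
have [||||n Mn] := @reach_in_directed nat leq 0%N M _ _ _ _ con.
- by move=> i j; exists (maxn i j); rewrite leq_maxl leq_maxr.
- by move=> i j k; exact: leq_trans.
- move=> h h0; have [k [b [[N HN] /(_ isT) k0 cE]]] := val h.
  have [n Nn] := nat_above N; exists n => m nm; exists b; split=> //.
    by move: h0; rewrite cE ler0q.
  move=> s ms; have [|t ht tE] := HN s.
    apply: le_trans Nn (le_trans _ ms).
    by rewrite ler_nat; exact: leq_trans nm (leqnSn _).
  by exists t; split=> //; rewrite tE k0 oppr0 expr0z mul1r.
- move=> n; split.
  + by exists 0; split=> [||s ns]; rewrite ?rmorph0 ?chi1 //; exists s; rewrite theta1 addr0.
  + move=> g h [b [b0 gE Hg]] [b' [b'0 hE Hh]]; exists (b + b'); split.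
    * exact: addr_ge0.
    * by rewrite chiM gE hE rmorphD.
    * move=> s ns; have [t [gs tE]] := Hg s ns.
      have [|r [ht rE]] := Hh t; first by rewrite tE; lra.
      by exists r; rewrite thetaM bipermE gs ht rE tE addrA.
  + move=> g h [b [b0 gE Hg]] [b' [b'0 hE Hh]]; rewrite gE hE ler_rat => bb'.
    exists (b - b'); split; first by rewrite subr_ge0.
      by rewrite chiM chiV // gE hE rmorphB.
    move=> s ns; have [t [gs tE]] := Hg s ns.
    have s1 : 1 <= n.+1%:R :> rat by rewrite ler1n.
    have [|r rE] := @sbcoord_surj (sbcoord s + b - b'); first lra.
    have [|t' [hr t'E]] := Hh r; first by rewrite rE; lra.
    have tt' : t' = t by apply: sbcoord_inj; rewrite t'E tE rE subrK.
    exists r; rewrite rE addrA; split=> //.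
    by rewrite thetaM bipermE thetaV gs -tt' -hr bipermKV.
(* x at 0^(n+1) 1 sends the point with word s below to one whose word is
   shorter, whereas a member of M n of value zero fixes that point *)
have [g gE] := wit n.+1.
have g0 : chi g = 0.
  apply: end_value_uniq (val g) _; rewrite gE; apply: (end_value_out _ _ x_root).
  move/zerosP; rewrite size_rcons size_nseq => /(congr1 (last false)).
  by rewrite last_rcons; have := mem_last false (nseq n.+2 false);
     case: last => //; rewrite inE mem_nseq.
have [|b [_ bE Hg]] := Mn g; first by rewrite g0.
move: bE; rewrite g0 => /esym/eqP; rewrite fmorph_eq0 => /eqP b0.
pose s := nseq n.+1 false ++ [:: true; false; false].
have [|t [gs]] := Hg s; first by rewrite sbcoord_zeros lerDl ltW // sbcoord_gt0.
rewrite b0 addr0 => /sbcoord_inj ts; move: gs; rewrite ts gE.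
have sE : s = rcons (nseq n.+1 false) true ++ [:: false; false].
  by rewrite /s -cats1 -catA.
have -> : x_ (rcons (nseq n.+1 false) true) (dyadic s) =
    dyadic (rcons (nseq n.+1 false) true ++ [:: false]).
  by rewrite sE !dyadic_cat x_below below_in; congr bcat; exact: (x_root00 (dyadic [::])).
rewrite sE => /dyadic_inj/(congr1 size).
by rewrite !size_cat => /addnI.
Qed.

(** Closed sets: the elements with germ z |-> 2^-k (z + c), where k >= 0 and the
    denominator of c divides m + 1.  Conjugating x by powers of y gives
    translations of lengths 2^-i, which have value zero and unbounded
    denominators. *)
Lemma disconnected_scaling :
  (forall g, end_value true (theta g) (chi g)) ->
  (exists g, theta g = x_ [:: false]) -> (exists g, theta g = y_ [:: false]) ->
  ~ full_subgraph_connected (cayley S) [set g | 0 <= chi g].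
Proof.
move=> val [x xE] [y yE] con.
pose M (m : nat) : set H := [set g | exists (k : nat) (b : rat),
  [/\ chi g = k%:R, end_germ (theta g) k b &
      exists z : int, b * 2%:Q ^ k * m.+1%:R = z%:~R]].
have pow2n (k : nat) : (2 ^+ k : int)%:~R = 2%:Q ^ k :> rat by rewrite rmorphXn.
have [||||m Mm] := @reach_in_directed nat (fun i j => (i.+1 %| j.+1)%N) 0%N M _ _ _ _ con.
- move=> i j; exists (i.+1 * j.+1).-1; rewrite prednK ?muln_gt0 //.
  by rewrite dvdn_mulr // dvdn_mull.
- by move=> i j k; exact: dvdn_trans.
- move=> h h0; have [k [b [hk _ cE]]] := val h.
  move: h0 hk cE; case: k => k; last first.
    move=> + _ cE; rewrite cE NegzE ler0z.
    by [].
  move=> _ hk cE; pose q := b * 2%:Q ^ k.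
  exists (`|denq q|%N.-1) => j dj; exists k, b; split=> //.
  have d0 : (0 < `|denq q|)%N by rewrite absz_gt0 denq_neq0.
  rewrite prednK // in dj; case/dvdnP: dj => l ->.
  have dE : `|denq q|%N%:R = (denq q)%:~R :> rat.
    by rewrite -[LHS]/((`|denq q|%N%:Z)%:~R) absz_denq.
  exists (numq q * l); rewrite -/q natrM dE [l%:R * _]mulrC mulrA -numqE intrM.
  by [].
- move=> m; split.
  + exists 0%N, 0; split; rewrite ?chi1 //; first by rewrite theta1; exact: end_germ1.
    by exists 0; rewrite !mul0r.
  + move=> g h [k [b [gE gk [z zE]]]] [l [b' [hE hl [w wE]]]].
    exists (k + l)%N, (2%:Q ^ (- l%:Z) * b + b'); split.
    * by rewrite chiM gE hE natrD.
    * by rewrite thetaM PoszD; exact: end_germ_mul.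
    exists (z + 2 ^+ k * w); rewrite PoszD expfzDr // intrD intrM -zE -wE pow2n.
    have : 2%:Q ^ (- l%:Z) * 2%:Q ^ l = 1 by rewrite -expfzDr // addNr.
    move: (2%:Q ^ (- l%:Z)) (2%:Q ^ l) (2%:Q ^ k) (m.+1%:R : rat) => r p q n rp.
    have -> : (r * b + b') * (q * p) * n = b * q * n * (r * p) + q * (b' * p * n) by lra.
    by rewrite rp mulr1.
  + move=> g h [k [b [gE gk [z zE]]]] [l [b' [hE hl [w wE]]]].
    rewrite gE hE ler_nat => lk.
    exists (k - l)%N, (2%:Q ^ (- - l%:Z) * b + - (b' * 2%:Q ^ l)); split.
    * by rewrite chiM chiV // gE hE natrB.
    * rewrite thetaM thetaV -subzn //; exact: end_germ_mul gk (end_germ_inv hl).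
    exists (z - 2 ^+ (k - l) * w); rewrite intrB intrM -zE -wE pow2n opprK.
    have : 2%:Q ^ l * 2%:Q ^ (k - l)%N = 2%:Q ^ k.
      by rewrite -expfzDr // -PoszD subnKC.
    move: (2%:Q ^ l) (2%:Q ^ (k - l)%N) (2%:Q ^ k) (m.+1%:R : rat) => p e q n pe.
    have -> : (p * b - b' * p) * e * n = b * (p * e) * n - e * (b' * p * n) by lra.
    by rewrite pe.
(* conjugating the translation x by y halves its length *)
have wit i : exists g, end_germ (theta g) 0 (- (2%:Q ^- i)).
  elim: i => [|i [g gE]].
    by exists x; rewrite xE expr0 invr1; exact: (end_germ_x_zeros 1).
  exists (y^-1 * g * y)%g; rewrite !thetaM thetaV yE.
  have yg := end_germ_y_zeros 1.
  have := end_germ_mul (end_germ_mul (end_germ_inv yg) gE) yg.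
  rewrite addr0 addNr oppr0 expr0z mul1r expr1z exprN1.
  by congr end_germ; rewrite exprS invfM; lra.
have [g gE] := wit m.+1.
have g0 : chi g = 0.
  have [k [b [gk _ ->]]] := val g.
  by have [-> _] := end_germ_uniq gk gE.
have [|k [b [gk kg [z]]]] := Mm g; first by rewrite g0.
have [-> ->] := end_germ_uniq kg gE.
rewrite expr0z mulr1 => zE.
(* (m + 1) / 2^(m + 1) is not an integer *)
have lt2 : m.+1%:R < 2 ^+ m.+1 :> rat by rewrite -natrX ltr_nat ltn_expl.
have p0 : 0 < 2 ^+ m.+1 :> rat by rewrite exprn_gt0.
have h1 : - 1 < z%:~R :> rat.
  by rewrite -zE mulNr ltrN2 mulrC ltr_pdivrMr // mul1r.
have h2 : z%:~R < 0 :> rat by rewrite -zE mulNr oppr_lt0 mulr_gt0 ?ltr0n ?invr_gt0.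
move: h1 h2; rewrite ltrz0 -[- 1]/((- 1)%:~R) ltr_int; lia.
Qed.

End Disconnected.

(** * The character sphere *)

Lemma continuous_ptws (U : Type) (V T : topologicalType) (K : T -> {ptws U -> V}) :
  (forall u, continuous (fun t => K t u)) -> continuous K.
Proof.
move=> cK x; apply/cvg_sup => u Z [W [[B oB <-]] /= Bx /filterS]; apply.
by apply: (cK u x); exact: open_nbhs_nbhs.
Qed.

Lemma continuous_row (K : numFieldType) (T : topologicalType) n (M : T -> 'rV[K]_n) :
  (forall j, continuous (fun t => M t 0 j)) -> continuous M.
Proof.
move=> cM x A [P Px /filterS]; apply.
apply: filter_forall => i; apply: filter_forall => j; rewrite ord1.
by apply: (cM j x); have := Px i j; rewrite ord1.
Qed.

Lemma continuous_into_set (X Z : topologicalType) (A : set Z) (f : X -> set_type A) :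
  continuous (fun x => set_val (f x)) -> continuous f.
Proof. by move=> cf; exact: (@continuous_comp_initial _ _ _ set_val). Qed.

Lemma set_val_continuous (Z : topologicalType) (A : set Z) :
  continuous (set_val : set_type A -> Z).
Proof. exact: initial_continuous. Qed.

Lemma char_val_continuous (R : realType) (H : groupType) (g : H) :
  continuous (fun c : nzchar R H => char_val c g).
Proof.
move=> c; apply: (@continuous_comp _ _ _ set_val (fun f : {ptws H -> R} => f g)).
  exact: set_val_continuous.
exact: (@proj_continuous _ (fun=> R) g).
Qed.

Section Sphere.
Variables (R : realType) (H : groupType) (e : 'I_3 -> H) (B : 'I_3 -> H -> R).
Hypotheses (BM : forall i, {morph B i : g h / (g * h)%g >-> g + h})
  (Be : forall i j, B i (e j) = (i == j)%:R).
Hypothesis uniq_e : forall c d : H -> R, {morph c : g h / (g * h)%g >-> g + h} ->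
  {morph d : g h / (g * h)%g >-> g + h} -> (forall j, c (e j) = d (e j)) -> c =1 d.

Let sq (v : 'rV[R]_3) : R := \sum_i v 0 i ^+ 2.

Let coords (c : nzchar R H) : 'rV[R]_3 := \row_j char_val c (e j).

Let sq_ge0 v : 0 <= sq v.
Proof. by apply: sumr_ge0 => i _; exact: sqr_ge0. Qed.

Let sq_gt0 (v : 'rV[R]_3) i : v 0 i != 0 -> 0 < sq v.
Proof.
move=> vi; rewrite /sq (bigD1 i) //= ltr_pwDl ?exprn_even_gt0 //.
by apply: sumr_ge0 => j _; exact: sqr_ge0.
Qed.

Let sqZ (r : R) (v : 'rV[R]_3) : sq (r *: v) = r ^+ 2 * sq v.
Proof. by rewrite mulr_sumr; apply: eq_bigr => i _; rewrite mxE exprMn. Qed.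

Let coords_gt0 c : 0 < sq (coords c).
Proof.
have [cM [g cg]] := set_valP c.
apply: contrapT => /negP; rewrite -leNgt => s0.
have z j : char_val c (e j) = 0.
  apply/eqP/negPn/negP => cj; move: s0; rewrite leNgt (@sq_gt0 _ j) //.
  by rewrite mxE.
move: cg; rewrite (uniq_e cM (d := fun=> 0)) ?eqxx // => h k.
by rewrite addr0.
Qed.

Let radius c : R := Num.sqrt (sq (coords c)).

Let radius_gt0 c : 0 < radius c. Proof. by rewrite sqrtr_gt0. Qed.

Let normalize_subproof c :
  (radius c)^-1 *: coords c \in [set v : 'rV[R]_3 | \sum_i v 0 i ^+ 2 = 1].
Proof.
apply/mem_set => /=; rewrite -/(sq _) sqZ exprVn sqr_sqrtr // mulVf //.
by rewrite gt_eqF.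
Qed.

Let normalize c : sphere2 R :=
  exist _ ((radius c)^-1 *: coords c) (normalize_subproof c).

Let from_coords_subproof (w : sphere2 R) :
  (fun h => \sum_i set_val w 0 i * B i h) \in @nonzero_characters R H.
Proof.
apply/mem_set; split=> [g h|].
  by rewrite -big_split; apply: eq_bigr => i _; rewrite BM mulrDr.
have [i wi] : exists i, set_val w 0 i != 0.
  apply: contrapT => no; have := set_valP w => /= /eqP.
  rewrite big1 ?(eq_sym 0) ?oner_eq0 // => i _.
  have /eqP -> : set_val w 0 i == 0 by apply/negPn/negP => wi; apply: no; exists i.
  by rewrite expr0n.
exists (e i); rewrite (bigD1 i) //= Be eqxx mulr1 big1 ?addr0 // => j ji.
by rewrite Be (negbTE ji) mulr0.
Qed.

Let from_coords (w : sphere2 R) : nzchar R H :=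
  exist _ (fun h => \sum_i set_val w 0 i * B i h) (from_coords_subproof w).

Let from_coordsE (w : sphere2 R) j : char_val (from_coords w) (e j) = set_val w 0 j.
Proof.
rewrite -[LHS]/(\sum_i set_val w 0 i * B i (e j)).
rewrite (bigD1 j) //= Be eqxx mulr1 big1 ?addr0 // => i ij.
by rewrite Be (negbTE ij) mulr0.
Qed.

Let cval g : continuous (fun c : nzchar R H => char_val c g : R).
Proof. exact: char_val_continuous. Qed.

Let sq_continuous : continuous (fun c => sq (coords c)).
Proof.
have cc j c : {for c, continuous (fun c : nzchar R H => char_val c (e j) * char_val c (e j))}.
  exact: (continuousM (@cval (e j) c) (@cval (e j) c)).
have -> : (fun c => sq (coords c)) = (fun c =>
    char_val c (e ord0) * char_val c (e ord0) +
    (char_val c (e (lift ord0 ord0)) * char_val c (e (lift ord0 ord0)) +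
     char_val c (e (lift ord0 (lift ord0 ord0))) *
     char_val c (e (lift ord0 (lift ord0 ord0))))).
  by apply/funext => c; rewrite /sq !big_ord_recl big_ord0 addr0 !mxE !expr2.
by move=> c; exact: (continuousD (cc _ c) (continuousD (cc _ c) (cc _ c))).
Qed.

Let normalize_continuous : continuous normalize.
Proof.
apply: continuous_into_set; apply: continuous_row => j.
have -> : (fun c => set_val (normalize c) 0 j) =
    (fun c => (radius c)^-1 * char_val c (e j)).
  by apply/funext => c; rewrite -[LHS]/(((radius c)^-1 *: coords c) 0 j) !mxE.
have rc c : {for c, continuous radius}.
  exact: (@continuous_comp _ _ _ (fun c => sq (coords c)) Num.sqrt c
    (@sq_continuous c) (@sqrt_continuous R _)).
move=> c; have r0 : radius c != 0 by rewrite gt_eqF.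
exact: (continuousM (continuousV r0 (rc c)) (@cval (e j) c)).
Qed.

Let from_coords_continuous : continuous from_coords.
Proof.
apply: continuous_into_set; apply: continuous_ptws => h.
have cj j : continuous (fun w : sphere2 R => set_val w 0 j : R).
  move=> w; apply: (@continuous_comp _ _ _ set_val (fun v : 'rV[R]_3 => v 0 j)).
    exact: set_val_continuous.
  exact: coord_continuous.
have cw j w : {for w, continuous (fun w : sphere2 R => set_val w 0 j * B j h)}.
  exact: (continuousM (@cj j w) (@cst_continuous _ _ (B j h) w)).
have -> : (fun w => set_val (from_coords w) h) = (fun w : sphere2 R =>
    set_val w 0 ord0 * B ord0 h + (set_val w 0 (lift ord0 ord0) * B (lift ord0 ord0) h +
    set_val w 0 (lift ord0 (lift ord0 ord0)) * B (lift ord0 (lift ord0 ord0)) h)).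
  apply/funext => w; rewrite -[LHS]/(\sum_i set_val w 0 i * B i h).
  by rewrite !big_ord_recl big_ord0 addr0.
by move=> w; exact: (continuousD (cw _ w) (continuousD (cw _ w) (cw _ w))).
Qed.

Let normalize_ray c d : char_class c = char_class d -> normalize c = normalize d.
Proof.
move=> /char_classP[r [r0 E]]; apply: val_inj => /=.
have cE : coords d = r *: coords c by apply/rowP => j; rewrite !mxE E.
have rE : radius d = r * radius c.
  by rewrite /radius cE sqZ sqrtrM ?sqr_ge0 // sqrtr_sqr gtr0_norm.
by rewrite rE cE scalerA invfM mulrAC mulVf ?mul1r // gt_eqF.
Qed.

Let from_coords_ray c : char_class (from_coords (normalize c)) = char_class c.
Proof.
apply/char_classP; exists (radius c); split; first exact: radius_gt0.
apply: uniq_e; first exact: char_valM.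
  by move=> g h; rewrite char_valM mulrDr.
move=> j; rewrite from_coordsE -[X in _ = _ * X]/(((radius c)^-1 *: coords c) 0 j).
  by rewrite !mxE mulrA mulfV ?mul1r // gt_eqF ?radius_gt0.
Qed.

Let normalizeK w : normalize (from_coords w) = w.
Proof.
have cE : coords (from_coords w) = set_val w by apply/rowP => j; rewrite !mxE from_coordsE.
have sE : sq (set_val w) = 1 by have := set_valP w.
by apply: val_inj; rewrite /= /radius cE sE sqrtr1 invr1 scale1r.
Qed.

(** The values at the three elements e identify characters with R^3, the dual
    characters B providing the inverse; rays then correspond to unit vectors. *)
Theorem char_sphere_homeomorphism :
  exists f : char_sphere R H -> sphere2 R, homeomorphism f.
Proof.
exists (normalize \o repr); split.
  apply: repr_comp_continuous; first exact: normalize_continuous.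
  by move=> c d /eqP cd; apply/eqP/normalize_ray.
have reprE (k : char_sphere R H) : char_class (repr k) = k by exact: reprK.
exists (fun w => char_class (from_coords w)); split.
- by move=> k; rewrite /= from_coords_ray reprE.
- by move=> w; rewrite /= -[RHS]normalizeK; apply: normalize_ray; rewrite reprE.
- move=> w; apply: (@continuous_comp _ _ _ from_coords (@char_class R H)).
    exact: from_coords_continuous.
  exact: (@pi_continuous _ _).
Qed.
End Sphere.

Lemma card_set2 (T : Type) (a b : T) : a <> b -> ([set a; b] #= `I_2)%card.
Proof.
move=> ab; apply/eq_cardSP; exists a; first by left.
rewrite (_ : _ `\ a = [set b]) ?card_set1 //.
by apply/seteqP; split=> x /= => [[[]]//|->]; split; [right|move=> ba; apply: ab].
Qed.

Lemma image_setC_bij (T U : Type) (f : T -> U) (g : U -> T) (A : set T) :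
  cancel f g -> cancel g f -> f @` (~` A) = ~` (f @` A).
Proof.
move=> fK gK; apply/seteqP; split=> [_ [x Ax <-] [y Ay /(can_inj fK) yx]|u fAu].
  by apply: Ax; rewrite -yx.
by exists (g u); rewrite ?gK // => Agu; apply: fAu; exists (g u); rewrite ?gK.
Qed.

Section Main.
Variables (R : realType) (f0 f1 : bool) (E : set word).
Hypothesis EP : ends_excluded f0 f1 E.

Local Notation end0 := (end_gen0 f0 E).
Local Notation end1 := (end_gen1 f1 E).
Local Notation middle := (mid_gen E).

Variables (l r m : LM E -> R).
Hypotheses (lM : {morph l : g h / (g * h)%g >-> g + h})
  (rM : {morph r : g h / (g * h)%g >-> g + h})
  (mM : {morph m : g h / (g * h)%g >-> g + h}).
Hypotheses (lval : forall g, end_value f0 (gen_val g) (l g))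
  (rval : forall g, end_value f1 (flip_conj (gen_val g)) (r g)).
Hypotheses (l0 : l end0 = if f0 then 1 else - 1) (l1 : l end1 = 0) (lm : l middle = 0).
Hypotheses (r1 : r end1 = if f1 then - 1 else 1) (r0 : r end0 = 0) (rm : r middle = 0).
Hypothesis mm : m middle != 0.

Lemma nzchar_subproof (c : LM E -> R) : {morph c : g h / (g * h)%g >-> g + h} ->
  (exists g, c g != 0) -> c \in @nonzero_characters R (LM E).
Proof. by move=> cM c0; apply/mem_set. Qed.

Lemma l_neq0 : exists g, l g != 0.
Proof. by exists end0; rewrite l0; case: f0; rewrite ?oppr_eq0 oner_eq0. Qed.
Lemma r_neq0 : exists g, r g != 0.
Proof. by exists end1; rewrite r1; case: f1; rewrite ?oppr_eq0 oner_eq0. Qed.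

Definition left_char : nzchar R (LM E) := exist _ l (nzchar_subproof lM l_neq0).
Definition right_char : nzchar R (LM E) := exist _ r (nzchar_subproof rM r_neq0).

Lemma left_not_connected (S : set (LM E)) : finite_set S ->
  ~ full_subgraph_connected (cayley S) [set g | 0 <= l g].
Proof.
move=> finS; have gM : {morph @gen_val _ (LM_gens E) : g h / (g * h)%g >-> (g * h)%g} by [].
case h0 : f0 lval => val.
  apply: (disconnected_scaling finS lM gM val); first by exists (x_gen E [:: false]).
  by exists (y_el E [:: false]); apply: gen_val_y; exact: (@allowed_zeros _ _ _ EP 0 h0).
apply: (disconnected_translation finS lM gM val) => n.
by exists (x_gen E (rcons (nseq n false) true)).
Qed.

Lemma right_not_connected (S : set (LM E)) : finite_set S ->
  ~ full_subgraph_connected (cayley S) [set g | 0 <= r g].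
Proof.
move=> finS; pose theta (g : LM E) := flip_conj (gen_val g).
have gM : {morph theta : g h / (g * h)%g >-> (g * h)%g}.
  by move=> g h; rewrite /theta -flip_conjM.
case h1 : f1 rval => val.
  apply: (disconnected_scaling finS rM gM val).
    by exists (x_gen E [:: true])^-1%g; rewrite /theta flip_conjV flip_conj_x invgK.
  exists (y_el E [:: true])^-1%g; rewrite /theta /= gen_val_y.
    by rewrite flip_conjV flip_conj_y invgK.
  exact: (@allowed_ones _ _ _ EP 0 h1).
apply: (disconnected_translation finS rM gM val) => n.
exists (x_gen E (rcons (nseq n true) false))^-1%g.
rewrite /theta flip_conjV flip_conj_x invgK; congr x_.
by rewrite /mirror map_rcons map_nseq.
Qed.

Lemma left_charE g : char_val left_char g = l g. Proof. by []. Qed.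
Lemma right_charE g : char_val right_char g = r g. Proof. by []. Qed.

(** A case analysis on the three determining values and on the sign of the only
    one that is nonzero. *)
Lemma connected_or_ray (S : set (LM E)) (c : nzchar R (LM E)) : generates S ->
  char_class c <> char_class left_char -> char_class c <> char_class right_char ->
  full_subgraph_connected (cayley S) [set g | 0 <= char_val c g].
Proof.
move=> genS cl cr.
have cM := char_valM c.
have cn : exists g, char_val c g != 0 by have [_] := set_valP c.
have ray (d : nzchar R (LM E)) (a : R) : 0 < a -> char_class c <> char_class d ->
    char_val c end0 = a * char_val d end0 -> char_val c end1 = a * char_val d end1 ->
    char_val c middle = a * char_val d middle -> False.
  move=> a0 cd e0 e1 em; apply: cd; apply/esym/char_classP; exists a; split=> //.
  by apply: (char_eq EP cM) => // g h; rewrite char_valM mulrDr.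
have [cm0|] := eqVneq (char_val c middle) 0; last exact: (connected_middle EP).
have [c00|c0n] := eqVneq (char_val c end0) 0; have [c10|c1n] := eqVneq (char_val c end1) 0.
- by case: cn => g; rewrite (char_eq0 EP cM c00 c10 cm0) eqxx.
- have [neg|pos|] := ltgtP (char_val c end1) 0; last by move/eqP; rewrite (negbTE c1n).
  + case h1 : f1; last by apply: (connected_right_x EP); rewrite // h1.
    case: (ray right_char (- char_val c end1)); rewrite ?oppr_gt0 //.
    * by rewrite c00 right_charE r0 mulr0.
    * by rewrite right_charE r1 h1 mulrNN mulr1.
    * by rewrite cm0 right_charE rm mulr0.
  + case h1 : f1; first by apply: (connected_right_y EP); rewrite // h1.
    case: (ray right_char (char_val c end1)) => //.
    * by rewrite c00 right_charE r0 mulr0.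
    * by rewrite right_charE r1 h1 mulr1.
    * by rewrite cm0 right_charE rm mulr0.
- have [neg|pos|] := ltgtP (char_val c end0) 0; last by move/eqP; rewrite (negbTE c0n).
  + case h0 : f0; first by apply: (connected_left_y EP); rewrite // h0.
    case: (ray left_char (- char_val c end0)); rewrite ?oppr_gt0 //.
    * by rewrite left_charE l0 h0 mulrNN mulr1.
    * by rewrite c10 left_charE l1 mulr0.
    * by rewrite cm0 left_charE lm mulr0.
  + case h0 : f0; last by apply: (connected_left_x EP); rewrite // h0.
    case: (ray left_char (char_val c end0)) => //.
    * by rewrite left_charE l0 h0 mulr1.
    * by rewrite c10 left_charE l1 mulr0.
    * by rewrite cm0 left_charE lm mulr0.
- exact: (connected_ends EP).
Qed.

Lemma left_neq_right : char_class left_char <> char_class right_char.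
Proof.
move/char_classP => [a [a0 E']]; have := E' end1.
rewrite left_charE l1 mulr0 right_charE r1 => /eqP.
by case: f1; rewrite ?oppr_eq0 oner_eq0.
Qed.

Lemma Sigma1_LM (S : set (LM E)) : finite_set S -> generates S ->
  @Sigma1 R (LM E) S = ~` [set char_class left_char; char_class right_char].
Proof.
move=> finS genS; apply/seteqP; split=> [k [c /= con <-]|k kP].
- have up d : char_class c = char_class d ->
      full_subgraph_connected (cayley S) [set g | 0 <= char_val d g].
    move=> /char_classP[a [a0 dE]]; rewrite (_ : [set g | _] = [set g | 0 <= char_val c g]) //.
    by apply/seteqP; split=> g /=; rewrite dE pmulr_rge0.
  by move=> [] /up; [exact: left_not_connected|exact: right_not_connected].
- have kE : char_class (repr k) = k by exact: reprK.
  exists (repr k) => //=; apply: connected_or_ray => // kE'; apply: kP.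
    by left; rewrite -kE kE'.
  by right; rewrite -kE kE'.
Qed.

(** The three characters are triangular with respect to the three determining
    elements, so correcting the third by the first two gives a dual system. *)
Lemma LM_sphere : exists f : char_sphere R (LM E) -> sphere2 R, homeomorphism f.
Proof.
pose b0 g := l end0 * l g; pose b1 g := r end1 * r g.
pose b2 g := (m middle)^-1 * (m g - m end0 * b0 g - m end1 * b1 g).
pose e (i : 'I_3) := nth end0 [:: end0; end1; middle] i.
pose b (i : 'I_3) := nth b0 [:: b0; b1; b2] i.
have l00 : l end0 * l end0 = 1 by rewrite l0; case: f0; rewrite ?mulrNN mulr1.
have r11 : r end1 * r end1 = 1 by rewrite r1; case: f1; rewrite ?mulrNN mulr1.
have b0M : {morph b0 : g h / (g * h)%g >-> g + h} by move=> g h; rewrite /b0 lM mulrDr.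
have b1M : {morph b1 : g h / (g * h)%g >-> g + h} by move=> g h; rewrite /b1 rM mulrDr.
have b2M : {morph b2 : g h / (g * h)%g >-> g + h}.
  by move=> g h; rewrite /b2 mM b0M b1M; lra.
apply: (@char_sphere_homeomorphism R (LM E) e b).
- by move=> [[|[|[|i]]] hi].
- move=> [[|[|[|i]]] hi] [[|[|[|j]]] hj] //; rewrite /e /b /= ?/b2 /b0 /b1
    ?l00 ?r11 ?l1 ?lm ?r0 ?rm ?mulr0 ?mulr1 ?subr0 ?subrr ?mulr0 ?mulVf //.
- move=> c d cM dM cd; apply: (char_eq EP cM dM).
  + exact: (cd (@Ordinal 3 0 isT)).
  + exact: (cd (@Ordinal 3 1 isT)).
  + exact: (cd (@Ordinal 3 2 isT)).
Qed.

Theorem LM_BNS : BNS_is_sphere_minus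
  [set char_class left_char; char_class right_char].
Proof.
have [f fh] := LM_sphere; have [_ [g [fK gK _]]] := fh.
split; first exact: (LM_finitely_generated EP).
- exact: Sigma1_LM.
- exact/card_set2/left_neq_right.
- by exists f; split=> //; exact: image_setC_bij fK gK.
Qed.
End Main.

Section Characters.
Variables (R : realType) (f0 f1 : bool) (E : set word).
Hypothesis EP : ends_excluded f0 f1 E.

(** Each end contributes one ray.  At the right end the sign changes when y acts
    there, because the exchange of letters inverts y. *)
Theorem LM_BNS_characters : exists left right : nzchar R (LM E),
  [/\ if f0 then is_psi0 left else is_chi0 left,
      if f1 then is_psi1 (nzchar_opp right) else is_chi1 right &
      BNS_is_sphere_minus [set char_class left; char_class right]].
Proof.
have [l [lM lval lx lx0 ly]] := left_hom R EP.
have [r [rM rval rx rx0 ry]] := right_hom R EP.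
have [m [mM my]] := interior_hom R E.
have nE10 : (~` E) [:: true; false] by exact: (@allowed_nonconst _ _ _ EP).
have midE : mid_gen E = y_gen nE10 by rewrite /mid_gen -y_genE.
have nz n : ~ zeros (nseq n.+1 true) by move/zerosP.
have no n : ~ ones (nseq n.+1 false) by move/onesP.
have lY t (Et : ~ E t) : l (y_el E t) = if `[< zeros t >] then 1 else 0.
  by rewrite -(y_genE (Et : (~` E) t)) ly.
have rY t (Et : ~ E t) : r (y_el E t) = if `[< ones t >] then - 1 else 0.
  by rewrite -(y_genE (Et : (~` E) t)) ry.
have E0 (h : f0) : ~ E [:: false] by exact: (@allowed_zeros _ _ _ EP 0 h).
have E1 (h : f1) : ~ E [:: true] by exact: (@allowed_ones _ _ _ EP 0 h).
have l0 : l (end_gen0 f0 E) = if f0 then 1 else - 1.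
  rewrite /end_gen0; case h0 : f0; last by have := lx 1%N; rewrite h0.
  by rewrite (lY _ (E0 h0)) asboolT //; exists 1%N.
have l1 : l (end_gen1 f1 E) = 0.
  rewrite /end_gen1; case h1 : f1; last exact/lx0/(nz 0%N).
  by rewrite (lY _ (E1 h1)) asboolF //; exact: (nz 0%N).
have lm : l (mid_gen E) = 0.
  by rewrite midE ly asboolF // => /zerosP.
have r1 : r (end_gen1 f1 E) = if f1 then - 1 else 1.
  rewrite /end_gen1; case h1 : f1; last by have := rx 1%N; rewrite h1.
  by rewrite (rY _ (E1 h1)) asboolT //; exists 1%N.
have r0 : r (end_gen0 f0 E) = 0.
  rewrite /end_gen0; case h0 : f0; last exact/rx0/(no 0%N).
  by rewrite (rY _ (E0 h0)) asboolF //; exact: (no 0%N).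
have rm : r (mid_gen E) = 0.
  by rewrite midE ry asboolF // => /onesP.
have mm : m (mid_gen E) != 0 by rewrite midE.
have oppE (w : nzchar R (LM E)) g : char_val (nzchar_opp w) g = - char_val w g by [].
have rightP (w : nzchar R (LM E)) : char_val w =1 r ->
    if f1 then is_psi1 (nzchar_opp w) else is_chi1 w.
  move=> wr; case h1 : f1 rx => rx'; split.
  - by move=> n En; rewrite oppE wr ry asboolT ?opprK //; exists n.
  - by move=> t Et to; rewrite oppE wr ry asboolF ?oppr0.
  - move=> s; rewrite oppE wr; have [[n _ <-]|so] := pselect (ones s).
      by rewrite rx' oppr0.
    by rewrite rx0 ?oppr0.
  - by move=> n; rewrite wr rx'.
  - by move=> s so; rewrite wr rx0.
  - move=> t Et; rewrite wr ry asboolF // => to.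
    by apply/Et/EP; right; rewrite h1.
have leftP (w : nzchar R (LM E)) : char_val w =1 l ->
    if f0 then is_psi0 w else is_chi0 w.
  move=> wl; case h0 : f0 lx => lx'; split.
  - by move=> n En; rewrite wl ly asboolT //; exists n.
  - by move=> t Et tz; rewrite wl ly asboolF.
  - move=> s; rewrite wl; have [[n _ <-]|sz] := pselect (zeros s); first exact: lx'.
    exact: lx0.
  - by move=> n; rewrite wl lx'.
  - by move=> s sz; rewrite wl lx0.
  - move=> t Et; rewrite wl ly asboolF // => tz.
    by apply/Et/EP; left; rewrite h0.
exists (left_char lM l0), (right_char rM r1).
by split; [exact: leftP|exact: rightP|exact: (LM_BNS EP lM rM mM lval rval)].
Qed.
End Characters.

Lemma char_class_oppK (R : realType) (H : groupType) (c : nzchar R H) :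
  char_class (nzchar_opp (nzchar_opp c)) = char_class c.
Proof.
apply/char_classP; exists 1; split=> // g.
by rewrite mul1r -[RHS]/(- - char_val c g) opprK.
Qed.

Theorem theorem4p5 (R : realType) :
  [/\ exists chi0 chi1 : nzchar R LM_G,
        [/\ is_chi0 chi0, is_chi1 chi1 &
            BNS_is_sphere_minus [set char_class chi0; char_class chi1]],
      exists psi0 chi1 : nzchar R LM_yG,
        [/\ is_psi0 psi0, is_chi1 chi1 &
            BNS_is_sphere_minus [set char_class psi0; char_class chi1]],
      exists chi0 psi1 : nzchar R LM_Gy,
        [/\ is_chi0 chi0, is_psi1 psi1 &
            BNS_is_sphere_minus
              [set char_class chi0; char_class (nzchar_opp psi1)]] &
      exists psi0 psi1 : nzchar R LM_yGy,
        [/\ is_psi0 psi0, is_psi1 psi1 &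
            BNS_is_sphere_minus
              [set char_class psi0; char_class (nzchar_opp psi1)]]].
Proof.
split.
- apply: (@LM_BNS_characters R false false) => t.
  by split=> [[]|[[]|[]]]; [left|right|left|right].
- apply: (@LM_BNS_characters R true false) => t.
  by split=> [|[[]|[]]]; [right| |].
- have [|chi0 [chi1 [h0 h1 B]]] := @LM_BNS_characters R false true zeros.
    by move=> t; split=> [|[[]|[]]]; [left| |].
  by exists chi0, (nzchar_opp chi1); split=> //; rewrite char_class_oppK.
- have [|chi0 [chi1 [h0 h1 B]]] := @LM_BNS_characters R true true set0.
    by move=> t; split=> [|[[]|[]]].
  by exists chi0, (nzchar_opp chi1); split=> //; rewrite char_class_oppK.
Qed.
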